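(* Let $d\ge1$. For all $t>0$ we have, with $s:=\frac{1-e^{-t}}{1+e^{-t}}$, $$\exp(-tL)=(1+s)^d\,a_s(Q,P)$$ as operators on $L^2(\mathbb{R}^d,\gamma)$, where $a_s(x,\xi):=\exp(-s(|x|^2+|\xi|^2))$ for $x,\xi\in\mathbb{R}^d$.
   Context: $\gamma$ is the standard Gaussian measure on $\mathbb{R}^d$, with density $(2\pi)^{-d/2}\exp(-|x|^2/2)$. $L$ is the Ornstein-Uhlenbeck operator, i.e. the self-adjoint nonnegative realisation on $L^2(\mathbb{R}^d,\gamma)$ of $Lf=-\Delta f+x\cdot\nabla f$ (for $f\in C_{\rm c}^2(\mathbb{R}^d)$), and $\exp(-tL)$ is the semigroup generated by $-L$. Let $dm(x)=(2\pi)^{-d/2}dx$. Let $U:L^2(\mathbb{R}^d,\gamma)\to L^2(\mathbb{R}^d,m)$ be the unitary operator $Uf(x)=2^{d/4}\exp(-\frac12|x|^2)f(\sqrt2\,x)$. For a Schwartz function $a:\mathbb{R}^{2d}\to\mathbb{C}$, the Weyl operator $a(X,D)$ on $L^2(\mathbb{R}^d,m)$ is $$a(X,D)f(y)=\int_{\mathbb{R}^{2d}}\widehat a(u,v)\,\exp\bigl(iu\cdot y+\tfrac12 iu\cdot v\bigr)f(v+y)\,dm(u)\,dm(v),$$ where $\widehat a(u,v)=\int_{\mathbb{R}^{2d}}a(x,\xi)\exp(-i(x\cdot u+\xi\cdot v))\,dm(x)\,dm(\xi)$, and the Gaussian Weyl calculus is $a(Q,P):=U^{-1}\circ a(X,D)\circ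 U$, a bounded operator on $L^2(\mathbb{R}^d,\gamma)$. *)

(* Defs.v *)
From HB Require Import structures.
From mathcomp Require Import all_boot all_order all_algebra.
From mathcomp Require Import all_classical all_reals all_analysis.
From mathcomp Require Import measurable_realfun.
From mathcomp Require Import complex ring.

Set Implicit Arguments.
Unset Strict Implicit.
Unset Printing Implicit Defensive.
Import Order.TTheory GRing.Theory Num.Theory.
Import numFieldNormedType.Exports.

Local Open Scope classical_set_scope.
Local Open Scope ring_scope.
Local Open Scope complex_scope.

Definition measure_rV_display : measure_display -> measure_display.
Proof. exact. Qed.

(* Row vectors carry the product sigma-algebra (over the reals: the Borel
   sigma-algebra), exactly as the library does for n.-tuple T. *)
Section measurable_rV.
Context {d : measure_display} {T : measurableType d} (n : nat).

Let coord (i : 'I_n) (x : 'rV[T]_n) : T := x ord0 i.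

Let rV_set0 : g_sigma_preimage coord set0.
Proof. exact: sigma_algebra0. Qed.

Let rV_setC A : g_sigma_preimage coord A -> g_sigma_preimage coord (~` A).
Proof. exact: sigma_algebraC. Qed.

Let rV_bigcup (F : _^nat) : (forall i, g_sigma_preimage coord (F i)) ->
  g_sigma_preimage coord (\bigcup_i (F i)).
Proof. exact: sigma_algebra_bigcup. Qed.

HB.instance Definition _ := @isMeasurable.Build (measure_rV_display d)
  'rV[T]_n (g_sigma_preimage coord) rV_set0 rV_setC rV_bigcup.

End measurable_rV.

Lemma measurable_rV_coord (d : measure_display) (T : measurableType d) (n : nat)
  (i : 'I_n) : measurable_fun [set: 'rV[T]_n] (fun x => x ord0 i).
Proof.
move=> _ Y mY; rewrite setTI; apply: sub_sigma_algebra => /=.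
rewrite -bigcup_seq/=; exists i => /=; first by rewrite mem_index_enum.
by exists Y => //; rewrite setTI.
Qed.

Lemma measurable_fun_rVP (d1 d2 : measure_display) (T1 : measurableType d1)
  (T2 : measurableType d2) (n : nat) (f : T1 -> 'rV[T2]_n) :
  (forall i, measurable_fun [set: T1] (fun x => f x ord0 i)) ->
  measurable_fun [set: T1] f.
Proof.
move=> mf _ A mA; rewrite setTI.
suff: preimage_set_system setT f measurable `<=` measurable.
  by apply; exists A => //; rewrite setTI.
rewrite -[X in X `<=` _]g_sigma_preimage_comp.
apply: smallest_sub; first exact: sigma_algebra_measurable.
move=> B; rewrite -bigcup_seq => -[i _ [C mC <-]].
exact: mf.
Qed.


Section lebesgue_cons.
Context {R : realType} (n : nat).

Definition rV_cons (p : R * 'rV[R]_n) : 'rV[R]_n.+1 :=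
  \row_i oapp (fun j => p.2 ord0 j) p.1 (unlift ord0 i).

Definition rV_uncons (x : 'rV[R]_n.+1) : R * 'rV[R]_n :=
  (x ord0 ord0, \row_i x ord0 (lift ord0 i)).

Lemma rV_consK : cancel rV_cons rV_uncons.
Proof.
move=> [a x]; congr pair; first by rewrite /= mxE unlift_none.
by apply/rowP => i; rewrite !mxE liftK.
Qed.

Lemma measurable_rV_cons : measurable_fun setT rV_cons.
Proof.
apply: measurable_fun_rVP => i; rewrite /rV_cons.
under eq_fun do rewrite mxE.
case: (unliftP ord0 i) => [j _|_] /=; last exact: measurable_fst.
exact: measurableT_comp (measurable_rV_coord j) measurable_snd.
Qed.

Lemma measurable_rV_uncons : measurable_fun setT rV_uncons.
Proof.
apply: measurable_fun_pair; first exact: measurable_rV_coord.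
apply: measurable_fun_rVP => i; under eq_fun do rewrite mxE.
exact: measurable_rV_coord.
Qed.

Variable mu : {sigma_finite_measure set 'rV[R]_n -> \bar R}.

Definition lebesgue_cons : set 'rV[R]_n.+1 -> \bar R :=
  pushforward (@lebesgue_measure R \x mu)%E rV_cons.

Let m0 : lebesgue_cons set0 = 0%E.
Proof. by rewrite /lebesgue_cons /pushforward preimage_set0 measure0. Qed.

Let mge0 A : (0 <= lebesgue_cons A)%E.
Proof. by rewrite /lebesgue_cons /pushforward; exact: measure_ge0. Qed.

Let msa : semi_sigma_additive lebesgue_cons.
Proof.
exact: (@measure_semi_sigma_additive _ _ _
  (measure_function_pushforward__canonical__measure_function_Measure
    (@lebesgue_measure R \x mu)%E measurable_rV_cons)).
Qed.

HB.instance Definition _ := isMeasure.Build _ _ _ lebesgue_cons m0 mge0 msa.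

Let msf : sigma_finite setT lebesgue_cons.
Proof.
have /sigma_finiteP[F [TF ndF Foo]] := sigma_finiteT (@lebesgue_measure R).
have /sigma_finiteP[G [TG ndG Goo]] := sigma_finiteT mu.
exists (fun k => rV_uncons @^-1` (F k `*` G k)).
  rewrite -preimage_bigcup (_ : \bigcup_k (F k `*` G k) = setT) ?preimage_setT//.
  apply/seteqP; split=> // -[x y] _.
  have [j _ Fnx] : (\bigcup_j F j) x by rewrite -TF.
  have [k _ Gky] : (\bigcup_k G k) y by rewrite -TG.
  exists (maxn j k) => //; split => /=.
  - by move: x Fnx; exact/subsetPset/ndF/leq_maxl.
  - by move: y Gky; exact/subsetPset/ndG/leq_maxr.
move=> k; have [mF Fk] := Foo k; have [mG Gk] := Goo k; split.
  rewrite -[X in measurable X]setTI; apply: measurable_rV_uncons => //.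
  exact: measurableX.
rewrite /lebesgue_cons /pushforward -comp_preimage.
rewrite (_ : rV_uncons \o rV_cons = id); last by apply/funext; exact: rV_consK.
by rewrite preimage_id product_measure1E// lte_mul_pinfty// ge0_fin_numE.
Qed.

HB.instance Definition _ := Measure_isSigmaFinite.Build _ _ _ lebesgue_cons msf.

End lebesgue_cons.

Fixpoint lebesgue_rV (R : realType) (n : nat) :
    {sigma_finite_measure set 'rV[R]_n -> \bar R} :=
  match n with
  | 0 => \d_(0 : 'rV[R]_0)
  | k.+1 => lebesgue_cons (lebesgue_rV R k)
  end.

Lemma lebesgue_rV_box (R : realType) (n : nat) (A : 'I_n -> set R) :
  (forall i, measurable (A i)) ->
  lebesgue_rV R n [set x | forall i, A i (x ord0 i)] =
  (\prod_(i < n) lebesgue_measure (A i))%E.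
Proof.
elim: n A => [|n IHn] A mA.
  rewrite big_ord0 /= diracE mem_set//=; by case.
rewrite big_ord_recl -IHn; last by move=> i; exact: mA.
set B := (X in lebesgue_rV R n X).
have mB : measurable B.
  rewrite (_ : B = \bigcap_(i in [set: 'I_n])
      ((fun x : 'rV[R]_n => x ord0 i) @^-1` A (lift ord0 i))); last first.
    by apply/seteqP; split => x /= Ax i; [move=> _|]; exact: Ax.
  apply: fin_bigcap_measurable => // i _; rewrite -[X in measurable X]setTI.
  by apply: measurable_rV_coord => //; exact: mA.
rewrite /= /lebesgue_cons /pushforward -product_measure1E//; last exact: mA.
congr (_ _); apply/seteqP; split => -[a x] /=.
  move=> Ax; split; first by have := Ax ord0; rewrite mxE unlift_none.
  by move=> i; have := Ax (lift ord0 i); rewrite mxE liftK.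
by move=> [Aa Ax] i; rewrite mxE; case: unliftP => [j|] ->.
Qed.

(* The library norm on 'rV[R]_n is the sup norm, so the Euclidean structure is
   spelled out. *)
Definition dotv (R : realType) (n : nat) (x y : 'rV[R]_n) : R :=
  \sum_(i < n) x ord0 i * y ord0 i.

Definition sqnv (R : realType) (n : nat) (x : 'rV[R]_n) : R := dotv x x.

Definition gauss_const (R : realType) (n : nat) : R :=
  (2 * pi) `^ (- (n%:R / 2)).

Section lebesgue_m.
Context (R : realType) (n : nat).

(* dm(x) = (2 pi)^(-n/2) dx *)
Definition lebesgue_m : set 'rV[R]_n -> \bar R :=
  mscale (NngNum (powR_ge0 (2 * pi) (- (n%:R / 2)))) (lebesgue_rV R n).

HB.instance Definition _ := Measure.on lebesgue_m.

Let sigma_finite_lebesgue_m : sigma_finite setT lebesgue_m.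
Proof.
have [F FT Ffin] := sigma_finiteT (lebesgue_rV R n).
exists F => // k; have [mF Fk] := Ffin k; split => //.
by rewrite /lebesgue_m /mscale lte_mul_pinfty// lee_fin powR_ge0.
Qed.

HB.instance Definition _ := Measure_isSigmaFinite.Build _ _ _
  lebesgue_m sigma_finite_lebesgue_m.

End lebesgue_m.
Arguments lebesgue_m : clear implicits.

Section gaussian_measure.
Context (R : realType) (n : nat).

Definition gauss_density (x : 'rV[R]_n) : R :=
  gauss_const R n * expR (- (sqnv x / 2)).

Definition gaussian_measure (A : set 'rV[R]_n) : \bar R :=
  (\int[lebesgue_rV R n]_(x in A) (gauss_density x)%:E)%E.

Lemma gauss_density_ge0 x : 0 <= gauss_density x.
Proof. by rewrite mulr_ge0 ?powR_ge0 ?expR_ge0. Qed.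

Lemma measurable_gauss_density : measurable_fun setT gauss_density.
Proof.
apply: measurable_funM => //; apply: measurableT_comp => //.
apply: measurableT_comp => //; apply: measurable_funM => //.
apply: measurable_sum => i.
by apply: measurable_funM; exact: measurable_rV_coord.
Qed.

Let gaussian_measure0 : gaussian_measure set0 = 0%E.
Proof. exact: integral_set0. Qed.

Let gaussian_measure_ge0 A : (0 <= gaussian_measure A)%E.
Proof. by apply: integral_ge0 => x _; rewrite lee_fin gauss_density_ge0. Qed.

Let gaussian_measure_sigma_additive : semi_sigma_additive gaussian_measure.
Proof.
move=> F mF tF mUF; rewrite /gaussian_measure ge0_integral_bigcup//; last 2 first.
- apply/measurable_EFinP; exact: measurable_funS measurable_gauss_density.
- by move=> x _; rewrite lee_fin gauss_density_ge0.
apply: is_cvg_ereal_nneg_natsum_cond => k _ _; exact: gaussian_measure_ge0.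
Qed.

HB.instance Definition _ := isMeasure.Build _ _ _ gaussian_measure
  gaussian_measure0 gaussian_measure_ge0 gaussian_measure_sigma_additive.

End gaussian_measure.
Arguments gaussian_measure : clear implicits.

(* Complex-valued functions are measured, integrated and differentiated
   componentwise. *)
Definition cmeasurable (d : measure_display) (T : measurableType d)
    (R : realType) (f : T -> R[i]) : Prop :=
  measurable_fun setT (fun x => complex.Re (f x)) /\
  measurable_fun setT (fun x => complex.Im (f x)).

Definition cintegral (d : measure_display) (T : measurableType d)
    (R : realType) (mu : {measure set T -> \bar R}) (f : T -> R[i]) : R[i] :=
  (\int[mu]_x complex.Re (f x)) +i* (\int[mu]_x complex.Im (f x)).

Definition cis (R : realType) (theta : R) : R[i] := cos theta +i* sin theta.

(** An unbounded operator A is given by its graph: [A f g] means that f is in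
    the domain of A and that A f = g. *)
Definition opgraph (T : Type) (R : realType) : Type :=
  (T -> R[i]) -> (T -> R[i]) -> Prop.

(** The Hilbert space L^2(mu; C). Its elements are represented by functions;
    functions equal almost everywhere represent the same element. *)
Section L2.
Context (d : measure_display) (T : measurableType d) (R : realType).
Variable mu : {measure set T -> \bar R}.
Implicit Types (f g h k : T -> R[i]) (F : (T -> R[i]) -> (T -> R[i])) (A : opgraph T R).

Definition sqnorm f : \bar R :=
  (\int[mu]_x (complex.Re (f x) ^+ 2 + complex.Im (f x) ^+ 2)%:E)%E.

Definition L2 : set (T -> R[i]) :=
  [set f | cmeasurable f /\ (sqnorm f < +oo)%E].

Definition inner f g : R[i] := cintegral mu (fun x => f x * conjc (g x)).

Definition eqL2 f g : Prop := {ae mu, forall x, f x = g x}.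

Definition bounded_operator F : Prop :=
  [/\ forall f, L2 f -> L2 (F f),
      forall f g, L2 f -> L2 g -> eqL2 f g -> eqL2 (F f) (F g),
      forall (a : R[i]) f g, L2 f -> L2 g ->
        eqL2 (F (fun x => a * f x + g x)) (fun x => a * F f x + F g x) &
      exists M : R, forall f, L2 f -> (sqnorm (F f) <= M%:E * sqnorm f)%E].


Definition densely_defined A : Prop :=
  forall f (e : R), L2 f -> 0 < e ->
    exists h k, A h k /\ (sqnorm (fun x => f x - h x)%R < e%:E)%E.

Definition adjoint A : opgraph T R := fun f g =>
  [/\ L2 f, L2 g & forall h k, A h k -> inner k f = inner h g].

(* An adjoint is always a linear (closed) relation on L^2 compatible with eqL2,
   and it is single-valued when A is densely defined; hence these properties
   are not repeated here. *)
Definition selfadjoint A : Prop :=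
  [/\ forall f g, A f g -> L2 f /\ L2 g,
      densely_defined A &
      forall f g, A f g <-> adjoint A f g].

Definition nonnegative A : Prop := forall f g, A f g -> 0 <= inner g f.

Definition oppg A : opgraph T R := fun f g => A f (fun x => - g x).

Definition C0_semigroup (E : R -> (T -> R[i]) -> (T -> R[i])) : Prop :=
  [/\ forall t, 0 <= t -> bounded_operator (E t),
      forall f, L2 f -> eqL2 (E 0 f) f,
      forall s t f, 0 <= s -> 0 <= t -> L2 f ->
        eqL2 (E (s + t) f) (E s (E t f)) &
      forall f, L2 f ->
        sqnorm (fun x => E t f x - f x)%R @[t --> 0^'+] --> 0%E].

Definition generator (E : R -> (T -> R[i]) -> (T -> R[i])) : opgraph T R :=
  fun f g => [/\ L2 f, L2 g &
    sqnorm (fun x => (t^-1)%:C * (E t f x - f x) - g x)%R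
      @[t --> 0^'+] --> 0%E].

(** E t = exp(t A). *)
Definition semigroup_generated_by A (E : R -> (T -> R[i]) -> (T -> R[i])) :
    Prop :=
  C0_semigroup E /\ forall f g, generator E f g <-> A f g.

End L2.

Section ornstein_uhlenbeck.
Context (R : realType) (n : nat).
Implicit Types (g : 'rV[R]_n -> R) (f : 'rV[R]_n -> R[i]).

Definition partial (i : 'I_n) g : 'rV[R]_n -> R :=
  fun x => 'D_(delta_mx ord0 i) g x.

Definition C1 g : Prop :=
  continuous g /\
  forall i : 'I_n, (forall x, derivable g x (delta_mx ord0 i)) /\
                   continuous (partial i g).

Definition C2 g : Prop := C1 g /\ forall i : 'I_n, C1 (partial i g).

Definition C2c f : Prop :=
  [/\ C2 (fun x => complex.Re (f x)), C2 (fun x => complex.Im (f x)) &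
      compact (closure [set x | f x != 0])].

Definition OUr g (x : 'rV[R]_n) : R :=
  - (\sum_(i < n) partial i (partial i g) x) +
  \sum_(i < n) x ord0 i * partial i g x.

Definition OU f (x : 'rV[R]_n) : R[i] :=
  OUr (fun y => complex.Re (f y)) x +i* OUr (fun y => complex.Im (f y)) x.

Definition OU_realisation (L : opgraph 'rV[R]_n R) : Prop :=
  [/\ forall f, C2c f -> L f (OU f),
      selfadjoint (gaussian_measure R n) L &
      nonnegative (gaussian_measure R n) L].

End ornstein_uhlenbeck.

Section weyl.
Context (R : realType) (n : nat).
Implicit Types (a : 'rV[R]_n * 'rV[R]_n -> R[i]) (f : 'rV[R]_n -> R[i]).

Local Notation mm := (lebesgue_m R n \x lebesgue_m R n)%E.

Definition fourier a (w : 'rV[R]_n * 'rV[R]_n) : R[i] :=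
  cintegral mm (fun z => a z * cis (- (dotv z.1 w.1 + dotv z.2 w.2))).

(** a(X, D), acting on L^2(m) *)
Definition weyl a f (y : 'rV[R]_n) : R[i] :=
  cintegral mm (fun w =>
    fourier a w * cis (dotv w.1 y + dotv w.1 w.2 / 2) * f (w.2 + y)).

Definition U f (x : 'rV[R]_n) : R[i] :=
  (2 `^ (n%:R / 4) * expR (- (sqnv x / 2)))%:C * f (Num.sqrt 2 *: x).

Definition Uinv f (x : 'rV[R]_n) : R[i] :=
  (2 `^ (- (n%:R / 4)) * expR (sqnv x / 4))%:C * f ((Num.sqrt 2)^-1 *: x).

Lemma sqnvZ (c : R) (x : 'rV[R]_n) : sqnv (c *: x) = c ^+ 2 * sqnv x.
Proof.
rewrite /sqnv /dotv mulr_sumr; apply: eq_bigr => i _.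
by rewrite !mxE mulrACA expr2.
Qed.

Let powR2_neq0 : 2 `^ (n%:R / 4) != 0 :> R.
Proof. by rewrite gt_eqF// powR_gt0. Qed.

Let sqrt2_neq0 : Num.sqrt 2 != 0 :> R.
Proof. by rewrite sqrtr_eq0 -ltNge. Qed.

Lemma UK : cancel U Uinv.
Proof.
move=> f; apply/funext => x; rewrite /Uinv /U scalerA mulfV// scale1r mulrA.
rewrite -rmorphM/= sqnvZ exprVn sqr_sqrtr// mulrACA powRN mulVf// mul1r -expRD.
rewrite (_ : _ + _ = 0) ?expR0 ?mul1r//.
by field.
Qed.

Lemma UinvK : cancel Uinv U.
Proof.
move=> f; apply/funext => x; rewrite /Uinv /U scalerA mulVf// scale1r mulrA.
rewrite -rmorphM/= sqnvZ sqr_sqrtr// mulrACA powRN mulfV// mul1r -expRD.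
rewrite (_ : _ + _ = 0) ?expR0 ?mul1r//.
by field.
Qed.

(** a(Q, P), acting on L^2(gamma) *)
Definition gauss_weyl a : ('rV[R]_n -> R[i]) -> ('rV[R]_n -> R[i]) :=
  Uinv \o weyl a \o U.

End weyl.

Definition gauss_symbol (R : realType) (n : nat) (s : R)
    (z : 'rV[R]_n * 'rV[R]_n) : R[i] :=
  (expR (- (s * (sqnv z.1 + sqnv z.2))))%:C.

(* Main.v *)
(** L is known only through its self-adjointness and its values on C_c^2, so
    the semigroup is identified by duality. Let p_u(y, x) be the density at y of
    the Gaussian law with mean e^-u x and variance 1 - e^-2u: in (u, x) it
    solves the backward equation d/du p_u = - L p_u. Cutting p_u(y, .) off and
    using self-adjointness, s |-> int (exp(-sL) f) p_(t+tau-s)(y, .) dgamma has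
    zero right derivative for f in the domain of L, so that
    int (exp(-tL) f) p_tau(y, .) dgamma = int f p_(t+tau)(y, .) dgamma, for all
    f in L^2 by density. Integrating y over a box and letting tau tend to 0,
    exp(-tL) f times the Gaussian density has the same integral over every box
    as y |-> int f p_t(y, .) dgamma: this is Mehler's formula.
    On the Weyl side the Fourier transform of a_s is Gaussian; integrating out u
    and completing the square with s = (1 - r) / (1 + r), r = e^-t, produces the
    same kernel. *)

Require Import Defs.
From HB Require Import structures.
From mathcomp Require Import all_boot all_order all_algebra.
From mathcomp Require Import all_classical all_reals all_analysis.
From mathcomp Require Import measurable_realfun.
From mathcomp Require Import complex ring lra.
Set Implicit Arguments.
Unset Strict Implicit.
Unset Printing Implicit Defensive.
Import Order.TTheory GRing.Theory Num.Theory.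
Import numFieldNormedType.Exports.
Local Open Scope classical_set_scope.
Local Open Scope ring_scope.

(** * Integration on row vectors *)

(** The semigroup axioms bound each [E t] separately and give strong continuity at time 0 only, so
    orbits are at first merely right continuous. A vanishing right derivative forces constancy only
    together with left continuity, and left continuity of the pairing needs bounds on E (s - h)
    uniform in small h. These come from Baire's theorem and the semigroup law.

    The extra time tau keeps every kernel away from time 0: for u >= tau, p_u and its u-derivative
    are bounded uniformly in x. As gamma is finite, L^2 functions are integrable, and every passage
    to the limit is dominated convergence against a bounded factor. The cutoffs survive the
    unbounded drift x . grad because t times the derivative of the cutoff at scale 1/a is controlled
    by (a t)^2, which is at most 1 on the support.

    Kernel and test functions are products of one-variable functions, so the calculus is
    one-dimensional. The duality is run on real parts only; imaginary parts follow by applying the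
    result to -i f. Squared norms are used throughout, so that the triangle inequality costs a
    factor 2 and no square roots of integrals appear. *)

Section density.
Local Open Scope ereal_scope.
Context d (T : measurableType d) (R : realType).
Variables (mu nu : {measure set T -> \bar R}) (w : T -> R).
Hypothesis w0 : forall x, (0 <= w x)%R.
Hypothesis mw : measurable_fun setT w.
Hypothesis nuE : forall A, measurable A -> nu A = \int[mu]_(x in A) (w x)%:E.

Import HBNNSimple.

Let mwE : measurable_fun setT (fun x => (w x)%:E).
Proof. exact/measurable_EFinP. Qed.

Let integral_density_nnsfun (h : {nnsfun T >-> R}) :
  \int[nu]_x (h x)%:E = \int[mu]_x (h x * w x)%:E.
Proof.
under [LHS]eq_integral do rewrite fimfunE -fsumEFin//.
rewrite [LHS]ge0_integral_fsum//; last 2 first.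
  - by move=> r; exact/measurable_EFinP/measurableT_comp.
  - by move=> n x _; rewrite EFinM nnfun_muleindic_ge0.
under [RHS]eq_integral.
  move=> x xD; rewrite EFinM fimfunE -fsumEFin// ge0_mule_fsuml; last first.
    by move=> r; exact: nnfun_muleindic_ge0.
  over.
rewrite [RHS]ge0_integral_fsum//; last 2 first.
  - by move=> r; apply: emeasurable_funM => //; exact/measurable_EFinP/measurableT_comp.
  - by move=> n x _; rewrite mule_ge0 ?lee_fin//; exact: nnfun_muleindic_ge0.
apply: eq_fsbigr => r _; rewrite integralZl_indic_nnsfun// integral_indic// setIT.
rewrite nuE//.
(* A negative [r] is not a value of [h]: its fibre is empty and both sides vanish. *)
have [r0|r0] := leP 0%R r; last first.
  have h0 : h @^-1` [set r] = set0.
    by apply/seteqP; split => // x /= hx; move: r0; rewrite -hx ltNge fun_ge0.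
  rewrite h0 integral_set0 mule0 integral0_eq// => x _.
  by rewrite indicE in_set0 mulr0 mul0e.
rewrite integral_mkcond -ge0_integralZl//.
- apply: eq_integral => x _; rewrite patchE indicE; case: ifPn => // _.
    by rewrite mulr1.
  by rewrite mulr0 mul0e mule0.
- exact/(measurable_restrictT _ _).1/measurable_funTS.
- by move=> x _; rewrite patchE; case: ifPn => // _; rewrite lee_fin.
Qed.

(** Monotone approximation by simple functions. Only the values of [nu] on measurable sets enter, so
    the same result serves the Gaussian measure and measures with a constant density. *)
Lemma ge0_integral_density (f : T -> \bar R) : measurable_fun setT f ->
  (forall x, 0 <= f x) -> \int[nu]_x f x = \int[mu]_x (f x * (w x)%:E).
Proof.
move=> mf f0; pose f_ := nnsfun_approx measurableT mf.
transitivity (limn (fun n => \int[nu]_x (f_ n x)%:E)).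
  rewrite -monotone_convergence//=.
  - apply: eq_integral => x _; apply/esym/cvg_lim => //=.
    exact: cvg_nnsfun_approx.
  - by move=> n; exact: measurableT_comp.
  - by move=> n x _; rewrite lee_fin.
  - by move=> x _ a b ab; rewrite lee_fin//; exact/lefP/nd_nnsfun_approx.
rewrite (_ : \int[mu]_x _ =
    limn (fun n => \int[mu]_x (f_ n x * w x)%:E)).
  by congr (limn _); apply/funext => n; exact: integral_density_nnsfun.
rewrite -monotone_convergence//=.
- apply: eq_integral => x _; apply/esym/cvg_lim => //=.
  under eq_fun do rewrite EFinM.
  apply: cvgeZr => //; exact: cvg_nnsfun_approx.
- by move=> n; apply/measurable_EFinP/measurable_funM => //.
- by move=> n x _; rewrite lee_fin mulr_ge0.
- move=> x _ a b ab; rewrite lee_fin//; apply: ler_wpM2r => //.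
  exact/lefP/nd_nnsfun_approx.
Qed.

Lemma integral_density (f : T -> R) : measurable_fun setT f ->
  \int[nu]_x (f x)%:E = \int[mu]_x (f x * w x)%:E.
Proof.
move=> mf; have mfE : measurable_fun setT (EFin \o f) by exact/measurable_EFinP.
rewrite integralE [RHS]integralE; congr (_ - _).
- rewrite ge0_integral_density//; last exact: measurable_funepos.
  apply: eq_integral => x _; rewrite !funeposE -!EFin_max -EFinM.
  by rewrite maxr_pMl// mul0r.
- rewrite ge0_integral_density//; last exact: measurable_funeneg.
  apply: eq_integral => x _; rewrite !funenegE -!EFinN -!EFin_max -EFinM.
  by rewrite maxr_pMl// mul0r mulNr.
Qed.

Lemma integrable_density (f : T -> R) : measurable_fun setT f ->
  mu.-integrable setT (fun x => (f x * w x)%:E) ->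
  nu.-integrable setT (EFin \o f).
Proof.
move=> mf /integrableP[_ fwoo]; apply/integrableP; split.
  exact/measurable_EFinP.
rewrite ge0_integral_density//.
  apply: le_lt_trans fwoo; apply: ge0_le_integral => //.
  - by move=> x _; rewrite mule_ge0// lee_fin.
  - apply: emeasurable_funM => //; apply: measurableT_comp => //.
    exact/measurable_EFinP.
  - by apply: measurableT_comp => //; apply/measurable_EFinP/measurable_funM.
  - by move=> x _; rewrite /= normrM EFinM (ger0_norm (w0 x)).
by apply: measurableT_comp => //; exact/measurable_EFinP.
Qed.

End density.

(** * Affine changes of variables and product integrands *)

Section lebesgue_affine.
Context (R : realType).
Local Notation mu := (@lebesgue_measure R).

(** Both sides are measures in [A] that agree on half-open intervals, and these determine Lebesgue
    measure. *)
Lemma lebesgue_measure_affine (c b : R) (A : set R) : 0 < c -> measurable A ->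
  lebesgue_measure A =
  (c%:E * mu ((fun x : R => (c * x + b)%R) @^-1` A))%E.
Proof.
move=> c0 mA.
have mphi : measurable_fun [set: measurableTypeR R]
    ((fun x => c * x + b) : measurableTypeR R -> measurableTypeR R).
  by apply: measurable_funD => //; exact: measurable_funM.
pose nu : {measure set (measurableTypeR R) -> \bar R} :=
  mscale (NngNum (ltW c0))
    (measure_function_pushforward__canonical__measure_function_Measure mu mphi).
apply: (@lebesgue_measure_unique R nu) => // X /ocitvP[->|[[x y] /= xy ->]].
  by rewrite !measure0.
rewrite /nu /= /mscale /= /pushforward.
rewrite (_ : _ @^-1` _ = `](x - b) / c, (y - b) / c]%classic); last first.
  apply/seteqP; split => z /=; rewrite !in_itv /=;
    by rewrite ltr_pdivrMr// ler_pdivlMr// ltrBlDr lerBrDr mulrC.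
rewrite !lebesgue_measure_itv/= !lte_fin ltr_pM2r ?invr_gt0// ltrD2r xy.
rewrite -!EFinD -EFinM; congr EFin.
by field; rewrite gt_eqF.
Qed.

Lemma ge0_integral_affine (c b : R) (F : R -> \bar R) : 0 < c ->
  measurable_fun [set: R] F -> (forall x, 0 <= F x)%E ->
  (\int[mu]_x F x = c%:E * \int[mu]_x F (c * x + b)%R)%E.
Proof.
move=> c0 mF F0.
have mphi : measurable_fun [set: measurableTypeR R]
    ((fun x => c * x + b) : measurableTypeR R -> measurableTypeR R).
  by apply: measurable_funD => //; exact: measurable_funM.
pose nu : {measure set (measurableTypeR R) -> \bar R} :=
  measure_function_pushforward__canonical__measure_function_Measure mu mphi.
rewrite (eq_measure_integral (mscale (NngNum (ltW c0)) nu)); last first.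
  by move=> A mA _; rewrite /= /mscale/= (@lebesgue_measure_affine c b).
by rewrite ge0_integral_mscale//= ge0_integral_pushforward.
Qed.

End lebesgue_affine.

Section lebesgue_rV_theory.
Context (R : realType).

Lemma measurable_funcons (n : nat) (a : R) :
  measurable_fun [set: 'rV[R]_n] (fun x => rV_cons (a, x)).
Proof. by apply: measurableT_comp; [exact: measurable_rV_cons|exact: measurable_pair1]. Qed.

Lemma ge0_integral_rV_cons (n : nat) (F : 'rV[R]_n.+1 -> \bar R) :
  measurable_fun setT F -> (forall x, 0 <= F x)%E ->
  (\int[lebesgue_rV R n.+1]_x F x =
   \int[lebesgue_measure]_a \int[lebesgue_rV R n]_x F (rV_cons (a, x)))%E.
Proof.
move=> mF F0.
rewrite [LHS](_ : _ =
  (\int[pushforward (@lebesgue_measure R \x lebesgue_rV R n) (@rV_cons R n)]_x F x)%E)//.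
rewrite ge0_integral_pushforward//; last exact: measurable_rV_cons.
rewrite preimage_setT fubini_tonelli1//.
  by apply: measurableT_comp => //; exact: measurable_rV_cons.
by move=> x /=.
Qed.

Lemma lebesgue_rV0 (F : 'rV[R]_0 -> \bar R) : measurable_fun setT F ->
  (\int[lebesgue_rV R 0]_x F x = F 0%R)%E.
Proof. by move=> mF; rewrite /= integral_dirac// diracT mul1e. Qed.

Lemma measurable_rV_affine (n : nat) (c : R) (b : 'rV[R]_n) :
  measurable_fun setT (fun x : 'rV[R]_n => c *: x + b).
Proof.
apply: measurable_fun_rVP => i; under eq_fun do rewrite !mxE.
apply: measurable_funD => //; apply: measurable_funM => //.
exact: measurable_rV_coord.
Qed.

(** Tonelli splits off the first coordinate; each coordinate contributes one factor [c]. *)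
Lemma ge0_integral_rV_affine (n : nat) (c : R) (b : 'rV[R]_n)
  (F : 'rV[R]_n -> \bar R) : 0 < c ->
  measurable_fun setT F -> (forall x, 0 <= F x)%E ->
  (\int[lebesgue_rV R n]_x F x =
   (c ^+ n)%:E * \int[lebesgue_rV R n]_x F (c *: x + b)%R)%E.
Proof.
move=> c0; elim: n b F => [|n IH] b F mF F0.
  rewrite expr0 mul1e !lebesgue_rV0//; first by rewrite [X in _ = F X]thinmx0.
  under eq_fun do rewrite [X in F X]thinmx0. exact: measurable_cst.
have mFa m (a' : 'rV[R]_m) (G : 'rV[R]_m -> \bar R) : measurable_fun setT G ->
    measurable_fun setT (fun x : 'rV[R]_m => G (c *: x + a')%R).
  by move=> mG; apply: measurableT_comp => //; exact: measurable_rV_affine.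
rewrite ge0_integral_rV_cons//.
rewrite [in RHS]ge0_integral_rV_cons//; last exact: mFa.
pose b' : 'rV[R]_n := \row_i b ord0 (lift ord0 i).
have consE a x : c *: rV_cons (a, x) + b = rV_cons (c * a + b ord0 ord0, c *: x + b').
  apply/rowP => i; rewrite !mxE; case: unliftP => [j ->|->]//=.
  by rewrite !mxE.
under [in RHS]eq_integral do under eq_integral do rewrite consE.
have mFc a : measurable_fun setT (fun x : 'rV[R]_n => F (rV_cons (a, x))).
  by apply: measurableT_comp => //; exact: measurable_funcons.
transitivity (\int[lebesgue_measure]_a ((c ^+ n)%:E * \int[lebesgue_rV R n]_x F (rV_cons (a, c *: x + b')%R)))%E; first by apply: eq_integral => a _; rewrite (IH b').
have mG : measurable_fun [set: R]
    (fun a => \int[lebesgue_rV R n]_x F (rV_cons (a, c *: x + b')%R))%E.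
  apply: (@measurable_fun_fubini_tonelli_F _ _ R _ _ (lebesgue_rV R n)
    (fun p => F (rV_cons (p.1, c *: p.2 + b')))) => //.
  apply: measurableT_comp => //; apply: measurableT_comp.
    exact: measurable_rV_cons.
  apply: measurable_fun_pair => //.
  exact: (measurableT_comp (measurable_rV_affine c b') measurable_snd).
rewrite ge0_integralZl; [|by []|exact: mG|by move=> a _; apply: integral_ge0|]; last first.
  by rewrite lee_fin exprn_ge0// ltW.
rewrite (@ge0_integral_affine _ c (b ord0 ord0)) ?muleA//.
  by rewrite -EFinM -exprSr.
by move=> a; apply: integral_ge0.
Qed.

Lemma ge0_integral_rV_prod (n : nat) (g : 'I_n -> R -> R) :
  (forall i, measurable_fun setT (g i)) -> (forall i x, 0 <= g i x) ->
  (\int[lebesgue_rV R n]_x (\prod_i g i (x ord0 i))%:E =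
   \prod_i \int[lebesgue_measure]_a (g i a)%:E)%E.
Proof.
elim: n g => [|n IH] g mg g0.
  rewrite big_ord0 lebesgue_rV0 ?big_ord0//.
  by rewrite (_ : (fun x => _) = cst 1%E)//; apply/funext => x; rewrite big_ord0.
have mp m (h : 'I_m -> R -> R) : (forall i, measurable_fun setT (h i)) ->
    measurable_fun setT (fun x : 'rV[R]_m => (\prod_i h i (x ord0 i))%:E).
  move=> mh; apply/measurable_EFinP/measurable_prod => i _.
  by apply: measurableT_comp => //; exact: measurable_rV_coord.
rewrite ge0_integral_rV_cons//; [|exact: mp|by move=> x; rewrite lee_fin prodr_ge0].
rewrite big_ord_recl -IH//.
transitivity (\int[lebesgue_measure]_a ((g ord0 a)%:E * \int[lebesgue_rV R n]_x
    (\prod_(i < n) g (lift ord0 i) (x ord0 i))%:E))%E.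
  apply: eq_integral => a _; rewrite -ge0_integralZl//.
  - apply: eq_integral => x _; rewrite -EFinM big_ord_recl mxE unlift_none /=.
    by under eq_bigr do rewrite mxE liftK /=.
  - by apply: (mp n (fun i => g (lift ord0 i))) => i; exact: mg.
  - by move=> x _; rewrite lee_fin prodr_ge0.
  - by rewrite lee_fin.
rewrite ge0_integralZr//.
- by move/measurable_EFinP : (mg ord0).
- by move=> x _; rewrite lee_fin.
- by apply: integral_ge0 => x _; rewrite lee_fin prodr_ge0.
Qed.

End lebesgue_rV_theory.

(** * Gaussian Fourier transforms and the Weyl operator *)

Section gaussian_integral.
Context (R : realType).
Local Notation mu := (@lebesgue_measure R).
Implicit Types c p x : R.

Lemma measurable_gaussc c m :
  measurable_fun [set: R] (fun x : R => expR (- (c * (x - m) ^+ 2))).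
Proof.
apply: measurableT_comp => //; apply: measurableT_comp => //.
apply: measurable_funM => //; apply: measurable_funX.
exact: measurable_funB.
Qed.

Lemma integral_gaussc c m : 0 < c ->
  (\int[mu]_x (expR (- (c * (x - m) ^+ 2)))%:E = (Num.sqrt (pi / c))%:E)%E.
Proof.
move=> c0; have sc0 : 0 < Num.sqrt c by rewrite sqrtr_gt0.
have := @integralT_gauss R.
rewrite (@ge0_integral_affine R (Num.sqrt c) (- Num.sqrt c * m)) //; last 2 first.
- by apply/measurable_EFinP; exact: measurable_gauss_fun.
- by move=> x; rewrite lee_fin gauss_fun_ge0.
under eq_integral => x _.
  rewrite /gauss_fun mulNr -mulrBr exprMn sqr_sqrtr; last exact: ltW.
  over.
move=> /(congr1 (fun z => ((Num.sqrt c)^-1)%:E * z)%E).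
rewrite muleA -EFinM mulVf ?gt_eqF// mul1e => ->; rewrite -EFinM; congr EFin.
by rewrite mulrC sqrtrM ?pi_ge0// sqrtrV// ltW.
Qed.

Lemma integrable_gaussc c m : 0 < c ->
  mu.-integrable setT (EFin \o (fun x => expR (- (c * (x - m) ^+ 2)))).
Proof.
move=> c0; apply/integrableP; split.
  by apply/measurable_EFinP; exact: measurable_gaussc.
under eq_integral do rewrite /= ger0_norm ?expR_ge0//.
by rewrite integral_gaussc// ltry.
Qed.

Lemma integrable_gauss0 c : 0 < c ->
  mu.-integrable setT (EFin \o (fun x => expR (- (c * x ^+ 2)))).
Proof.
by move=> /(integrable_gaussc 0); under eq_fun do rewrite subr0.
Qed.

(** |x| <= (1 + x^2)/2, and half of the Gaussian decay absorbs x^2, since q <= e^q at q = c x^2 /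
    2. *)
Lemma normr_gauss_le c x : 0 < c -> `|x| * expR (- (c * x ^+ 2)) <=
  2^-1 * expR (- (c * x ^+ 2)) + c^-1 * expR (- (c / 2 * x ^+ 2)).
Proof.
move=> c0.
have h1 : `|x| <= 2^-1 + 2^-1 * x ^+ 2.
  have := sqr_ge0 (`|x| - 1); rewrite sqrrB1 real_normK ?num_real//; lra.
have h2 : 2^-1 * x ^+ 2 * expR (- (c * x ^+ 2)) <= c^-1 * expR (- (c / 2 * x ^+ 2)).
  rewrite (_ : - (c * x ^+ 2) = - (c / 2 * x ^+ 2) + - (c / 2 * x ^+ 2)); last by field.
  rewrite expRD mulrA ler_wpM2r ?expR_ge0// expRN ler_pdivrMr ?expR_gt0//.
  rewrite [leRHS]mulrC ler_pdivlMr//.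
  apply: (@le_trans _ _ (1 + c / 2 * x ^+ 2)); last exact: expR_ge1Dx.
  lra.
apply: le_trans (ler_wpM2r (expR_ge0 _) h1) _.
by rewrite mulrDl lerD2l.
Qed.

Lemma integrable_id_gauss c : 0 < c ->
  mu.-integrable setT (EFin \o (fun x => `|x| * expR (- (c * x ^+ 2)))).
Proof.
move=> c0.
have c20 : 0 < c / 2 by rewrite divr_gt0.
apply: (@le_integrable _ _ _ mu _ _ _ (fun x => (2^-1)%:E * (expR (- (c * x ^+ 2)))%:E
   + (c^-1)%:E * (expR (- (c / 2 * x ^+ 2)))%:E)%E) => //.
- apply/measurable_EFinP/measurable_funM => //.
  by have /measurable_int/measurable_EFinP := integrable_gauss0 c0.
- move=> x _; rewrite /= lee_fin ger0_norm ?mulr_ge0 ?expR_ge0//.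
  by rewrite [leRHS]ger0_norm ?normr_gauss_le// addr_ge0 ?mulr_ge0 ?expR_ge0 ?invr_ge0 ?(ltW c0).
- apply: integrableD => //; apply: integrableZl => //; exact: integrable_gauss0.
Qed.

Definition fgauss c p x := expR (- (c * x ^+ 2)) * cos (p * x).

Lemma measurable_cosM p : measurable_fun [set: R] (fun x : R => cos (p * x)).
Proof.
apply: (@measurableT_comp _ _ _ _ _ _ (@cos R)); last exact: measurable_funM.
apply: continuous_measurable_fun; exact: continuous_cos.
Qed.

Lemma measurable_sinM p : measurable_fun [set: R] (fun x : R => sin (p * x)).
Proof.
apply: (@measurableT_comp _ _ _ _ _ _ (@sin R)); last exact: measurable_funM.
apply: continuous_measurable_fun; exact: continuous_sin.
Qed.

Lemma integrable_gauss_bounded c (h : R -> R) : 0 < c ->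
  measurable_fun setT h -> (forall x, `|h x| <= 1) ->
  mu.-integrable setT (EFin \o (fun x => expR (- (c * x ^+ 2)) * h x)).
Proof.
move=> c0 mh h1; apply: le_integrable (integrable_gauss0 c0) => //.
  apply/measurable_EFinP/measurable_funM => //.
  by have /measurable_int/measurable_EFinP := integrable_gauss0 c0.
by move=> x _ /=; rewrite lee_fin normrM ler_piMr.
Qed.

(** The fundamental theorem on growing symmetric intervals; integrability of [f] identifies the
    limit of the truncated integrals. *)
Lemma Rintegral_derive_eq0 (F f : R -> R) :
  (forall x, is_derive x (1 : R) F (f x)) -> continuous f ->
  mu.-integrable setT (EFin \o f) ->
  F n%:R @[n --> \oo] --> 0 -> F (- n%:R) @[n --> \oo] --> 0 ->
  \int[mu]_x f x = 0.
Proof.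
move=> dF cf intf Fy FNy.
(* With [n.+1] the interval is never degenerate, as the fundamental theorem of calculus requires. *)
pose D (n : nat) : set R := `[- n.+1%:R, n.+1%:R]%classic.
have mf : measurable_fun setT (EFin \o f) by case/integrableP : intf.
have FTC n : (\int[mu]_x ((EFin \o f) \_ (D n)) x = (F n.+1%:R - F (- n.+1%:R))%:E)%E.
  rewrite -integral_mkcond.
  have nn : - n.+1%:R < n.+1%:R :> R by rewrite -subr_gt0 opprK.
  have dF' x : derivable F x 1 by have [] := dF x.
  have cF : continuous F.
    by move=> x; apply/differentiable_continuous/derivable1_diffP/dF'.
  rewrite (@continuous_FTC2 R f F _ _ nn) ?EFinB//.
  - by apply: continuous_subspaceT.
  - split => //; first by apply: cvg_at_right_filter; exact: cF.
    by apply: cvg_at_left_filter; exact: cF.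
  - by move=> x _; rewrite derive1E; have [] := dF x.
have [//||//|||_ _] := @dominated_convergence _ _ _ mu setT measurableT
  (fun n => (EFin \o f) \_ (D n)) (EFin \o f) (abse \o (EFin \o f)).
- move=> n; apply/(measurable_restrictT _ _).1; first exact: measurable_itv.
  exact: measurable_funTS.
- exact: mf.
- apply: aeW => x _; apply: cvg_near_cst; near=> n.
  rewrite patchE ifT// inE /D /= in_itv /= -ler_norml.
  apply: (@le_trans _ _ n%:R); last by rewrite ler_nat.
  by near: n; exact: nbhs_infty_ger.
- exact: integrable_abse.
- apply: aeW => x n _; rewrite patchE; case: ifPn => // _.
  by rewrite abse0 abse_ge0.
rewrite -(fineK (integrable_fin_num measurableT intf)) => /fine_cvgP[_] h.
have : (fine \o (fun n => (\int[mu]_x ((EFin \o f) \_ (D n)) x)%E)) n @[n --> \oo] --> (0 : R).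
  under eq_fun do rewrite /= FTC /=.
  rewrite -(subrr (0 : R)); apply: cvgB.
    by rewrite (cvg_shiftS (fun n => F n%:R)).
  by rewrite (cvg_shiftS (fun n => F (- n%:R))).
by move/(cvg_lim (@Rhausdorff R)) => <-; apply/esym/cvg_lim.
Unshelve. all: by end_near. Qed.

Lemma integrable_fgauss c p : 0 < c -> mu.-integrable setT (EFin \o fgauss c p).
Proof.
move=> c0; apply: integrable_gauss_bounded => //; first exact: measurable_cosM.
by move=> x; rewrite cos_max.
Qed.

Lemma cvg_gauss0 c : 0 < c ->
  expR (- (c * (n%:R : R) ^+ 2)) @[n --> \oo] --> 0.
Proof.
move=> c0; apply: (@squeeze_cvgr _ _ _ _ (cst 0) (fun n => c^-1 * (n%:R : R)^-1)).
- near=> n; rewrite /= expR_ge0 /= expRN -invfM lef_pV2 ?posrE ?expR_gt0//; last first.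
    by rewrite mulr_gt0// ltr0n; near: n; exact: nbhs_infty_gt.
  apply: (@le_trans _ _ (1 + c * n%:R ^+ 2)); last exact: expR_ge1Dx.
  apply: (@le_trans _ _ (c * n%:R ^+ 2)); last by rewrite lerDr.
  rewrite ler_pM2l// expr2 ler_peMl// ler1n; near: n; exact: nbhs_infty_gt.
- exact: cvg_cst.
- rewrite -(mulr0 c^-1); apply: cvgM; first exact: cvg_cst.
  apply/gtr0_cvgV0; last exact: cvgr_idn.
  by near=> n; rewrite ltr0n; near: n; exact: nbhs_infty_gt.
Unshelve. all: by end_near. Qed.

Lemma is_derive_continuous (f : R -> R) x l :
  is_derive x (1 : R) f l -> {for x, continuous f}.
Proof.
by move=> df; apply/differentiable_continuous/derivable1_diffP; have [] := df.
Qed.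

Lemma cvg_sin_gauss c p (u : nat -> R) : 0 < c -> (forall n, u n ^+ 2 = n%:R ^+ 2) ->
  (2 * c)^-1 * (sin (p * u n) * expR (- (c * u n ^+ 2))) @[n --> \oo] --> 0.
Proof.
move=> c0 u2; rewrite -(mulr0 (2 * c)^-1); apply: cvgM; first exact: cvg_cst.
apply: norm_cvg0; apply: (@squeeze_cvgr _ _ _ _ (cst 0) (fun n => expR (- (c * (n%:R : R) ^+ 2)))).
- near=> n; rewrite normr_ge0 u2 normrM (ger0_norm (expR_ge0 _)).
  by rewrite ler_piMl ?expR_ge0// sin_max.
- exact: cvg_cst.
- exact: cvg_gauss0.
Unshelve. all: by end_near. Qed.

(** Integration by parts: the difference of the two integrands is the derivative of sin(p x) e^(-c
    x^2) / (2c), which vanishes at infinity. *)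
Lemma integral_fgauss_deriv c p : 0 < c ->
  \int[mu]_x (- (x * sin (p * x)) * expR (- (c * x ^+ 2))) =
  - (p / (2 * c)) * \int[mu]_x (fgauss c p x).
Proof.
move=> c0; have cn0 : c != 0 by rewrite gt_eqF.
have is2 : mu.-integrable setT
    (EFin \o (fun x => - (x * sin (p * x)) * expR (- (c * x ^+ 2)))).
  apply: le_integrable (integrable_id_gauss c0) => //.
    apply/measurable_EFinP/measurable_funM => //.
      apply: measurableT_comp => //; apply: measurable_funM => //.
      exact: measurable_sinM.
    by have /measurable_int/measurable_EFinP := integrable_gauss0 c0.
  move=> x _ /=; rewrite lee_fin normrM normrN normrM normrM normr_id.
  by rewrite ler_wpM2r// ler_piMr// sin_max.
have is1 := integrableZl measurableT (p / (2 * c)) (integrable_fgauss p c0).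
pose f x := p / (2 * c) * fgauss c p x + - (x * sin (p * x)) * expR (- (c * x ^+ 2)).
suff : \int[mu]_x f x = 0.
  rewrite /f RintegralD//= RintegralZl//; last exact: integrable_fgauss.
  by move=> h; apply/eqP; rewrite mulNr -addr_eq0 addrC h.
apply: (@Rintegral_derive_eq0
  (fun x => (2 * c)^-1 * (sin (p * x) * expR (- (c * x ^+ 2))))).
- move=> x; rewrite /f /fgauss; apply: is_derive_eq.
  by rewrite /GRing.scale /=; field.
- move=> x; apply: is_derive_continuous; rewrite /f /fgauss; apply: is_derive_eq.
- have := integrableD measurableT is1 is2.
  by apply: eq_integrable.
- by apply: cvg_sin_gauss.
- by apply: cvg_sin_gauss => // n; rewrite sqrrN.
Qed.

(** Differentiation under the integral sign, dominated by |y| e^(-c y^2). With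
    [integral_fgauss_deriv] it becomes a linear differential equation in [p]. *)
Lemma is_derive_fgauss c p : 0 < c ->
  is_derive p (1 : R) (fun p => \int[mu]_x (fgauss c p x))
    (- (p / (2 * c)) * \int[mu]_x (fgauss c p x)).
Proof.
move=> c0; have pu : `](p - 1), (p + 1)[%classic p.
  by rewrite /= in_itv /=; apply/andP; split; lra.
have dE q y : is_derive q (1 : R) (fun q => fgauss c q y)
    (- (y * sin (q * y)) * expR (- (c * y ^+ 2))).
  by rewrite /fgauss; apply: is_derive_eq; rewrite /GRing.scale /=; ring.
have pE q y : partial1of2 (fgauss c) q y = - (y * sin (q * y)) * expR (- (c * y ^+ 2)).
  by rewrite partial1of2E; have [] := dE q y.
have intf q : `](p - 1), (p + 1)[%classic q -> mu.-integrable setT (EFin \o fgauss c q).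
  by move=> _; exact: integrable_fgauss.
have df q y : `](p - 1), (p + 1)[%classic q -> [set: R] y ->
    derivable (fun q => fgauss c q y) q 1 by move=> _ _; have [] := dE q y.
have G0 (y : R) : 0 <= `|y| * expR (- (c * y ^+ 2)) by rewrite mulr_ge0 ?expR_ge0.
have Gub q y : `](p - 1), (p + 1)[%classic q -> [set: R] y ->
    `|partial1of2 (fgauss c) q y| <= `|y| * expR (- (c * y ^+ 2)).
  move=> _ _; rewrite pE normrM normrN normrM (ger0_norm (expR_ge0 _)).
  by rewrite ler_wpM2r ?expR_ge0// ler_piMr// sin_max.
have D := @derivable_under_integral R _ _ mu (fgauss c) setT measurableT p _ _ pu
  intf df _ G0 (integrable_id_gauss c0) Gub.
apply: DeriveDef; first exact: D.
rewrite -derive1E (@differentiation_under_integral R _ _ mu (fgauss c) setT measurableT p _ _ pu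
  intf df _ G0 (integrable_id_gauss c0) Gub).
by rewrite -integral_fgauss_deriv//; apply: eq_Rintegral => y _; exact: pE.
Qed.

(** e^(p^2/(4c)) is an integrating factor of the equation in [is_derive_fgauss]; at p = 0 the
    integral is the Gaussian one. *)
Lemma integral_fgauss c p : 0 < c ->
  \int[mu]_x (fgauss c p x) = Num.sqrt (pi / c) * expR (- (p ^+ 2 / (4 * c))).
Proof.
move=> c0; have cn0 : c != 0 by rewrite gt_eqF.
pose J p := expR (p ^+ 2 / (4 * c)) * \int[mu]_x (fgauss c p x).
have J0 q : is_derive q (1 : R) J 0.
  have h := is_derive_fgauss q c0.
  rewrite /J; apply: is_derive_eq; rewrite /GRing.scale /=; field.
  by [].
have : J p = J 0 by apply: is_derive_0_is_cst.
rewrite /J expr0n /= mul0r expR0 mul1r.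
have -> : \int[mu]_x fgauss c 0 x = Num.sqrt (pi / c).
  rewrite -[RHS]/(fine (Num.sqrt (pi / c))%:E) -(integral_gaussc 0 c0).
  congr fine; apply: eq_integral => x _.
  by rewrite /fgauss mul0r cos0 mulr1 subr0.
move=> <-; rewrite mulrAC -expRD subrr expR0 mul1r.
by [].
Qed.

(** The integrand is odd and Lebesgue measure is invariant under reflection. *)
Lemma integral_sin_gauss c p : 0 < c ->
  \int[mu]_x (expR (- (c * x ^+ 2)) * sin (p * x)) = 0.
Proof.
move=> c0; set f := fun x => _.
have intf : mu.-integrable setT (EFin \o f).
  apply: integrable_gauss_bounded => //; first exact: measurable_sinM.
  by move=> x; rewrite sin_max.
have mN : measurable_fun [set: measurableTypeR R] (-%R : R -> measurableTypeR R).
  exact: oppr_measurable.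
have fN : f \o -%R = (fun x => - f x).
  by apply/funext => x; rewrite /f /= sqrrN mulrN sinN mulrN.
have E : \int[mu]_x f x = \int[mu]_x (f (- x)).
  rewrite /Rintegral; congr fine.
  rewrite (eq_measure_integral (pushforward mu (-%R : R -> measurableTypeR R))); last first.
    by move=> A mA _; exact/esym/lebesgue_measureN.
  rewrite (@integral_pushforward _ _ _ _ R _ mN mu setT (EFin \o f)) ?preimage_setT//.
    by case/integrableP : intf.
  rewrite -compA fN; have := integrableN intf.
  by apply: eq_integrable.
have : \int[mu]_x f x = - \int[mu]_x f x.
  rewrite [LHS]E (@eq_Rintegral _ _ _ mu setT (fun x => -1 * f x)).
    by rewrite RintegralZl// mulN1r.
  by move=> x _; rewrite mulN1r; exact: (congr1 (@^~ x) fN).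
by move/eqP; rewrite -addr_eq0 -mulr2n mulrn_eq0 /= => /eqP.
Qed.

End gaussian_integral.

Section integral_prod_mul.
Context d1 d2 (T1 : measurableType d1) (T2 : measurableType d2) (R : realType).
Variable m1 : {sigma_finite_measure set T1 -> \bar R}.
Variable m2 : {sigma_finite_measure set T2 -> \bar R}.
Variables (f : T1 -> R) (g : T2 -> R).
Hypothesis intf : m1.-integrable setT (EFin \o f).
Hypothesis intg : m2.-integrable setT (EFin \o g).

Let mf : measurable_fun setT f.
Proof. by case/integrableP : intf => /measurable_EFinP. Qed.

Let mg : measurable_fun setT g.
Proof. by case/integrableP : intg => /measurable_EFinP. Qed.

Let mfg : measurable_fun setT (fun z : T1 * T2 => (f z.1 * g z.2)%:E).
Proof.
by apply/measurable_EFinP/measurable_funM; apply: measurableT_comp.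
Qed.

Lemma integrable_prod_mul :
  (m1 \x m2)%E.-integrable setT (EFin \o (fun z : T1 * T2 => f z.1 * g z.2)).
Proof.
apply/(integrable12ltyP _ _ mfg).
have -> : (\int[m1]_x \int[m2]_y `|(f (x, y).1 * g (x, y).2)%:E| =
    \int[m1]_x (`|(f x)%:E| * \int[m2]_y `|(g y)%:E|))%E.
  apply: eq_integral => x _; rewrite -ge0_integralZl//.
  - by apply: eq_integral => y _; rewrite /= normrM.
  - by apply: measurableT_comp => //; exact/measurable_EFinP.
have [_ foo] := integrableP _ _ _ intf.
have [_ goo] := integrableP _ _ _ intg.
rewrite ge0_integralZr//.
- by apply: lte_mul_pinfty => //; [exact: integral_ge0|rewrite ge0_fin_numE//; exact: integral_ge0].
- by apply: measurableT_comp => //; exact/measurable_EFinP.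
- exact: integral_ge0.
Qed.

Lemma Rintegral_prod_mul :
  \int[(m1 \x m2)%E]_z (f z.1 * g z.2) = \int[m1]_x f x * \int[m2]_y g y.
Proof.
rewrite /Rintegral -integral12_prod_meas1; last exact: integrable_prod_mul.
rewrite /fubini_F /=.
have fing := integrable_fin_num measurableT intg.
have -> : (\int[m1]_x \int[m2]_y (f x * g y)%:E =
    \int[m1]_x ((fine (\int[m2]_y (g y)%:E))%:E * (f x)%:E))%E.
  apply: eq_integral => x _; rewrite fineK// muleC -integralZl//.
rewrite integralZl// fineM//; last exact: integrable_fin_num.
by rewrite mulrC.
Qed.

End integral_prod_mul.

Section lebesgue_rV_gauss.
Context (R : realType).

Lemma measurable_dotv (n : nat) (p : 'rV[R]_n) :
  measurable_fun setT (fun x : 'rV[R]_n => dotv x p).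
Proof.
apply: measurable_sum => i; apply: measurable_funM => //.
exact: measurable_rV_coord.
Qed.

Lemma measurable_sqnv (n : nat) : measurable_fun setT (fun x : 'rV[R]_n => sqnv x).
Proof.
by apply: measurable_sum => i; apply: measurable_funM; exact: measurable_rV_coord.
Qed.

Section cons.
Variables (n : nat) (f : R -> R) (g : 'rV[R]_n -> R).
Hypothesis intf : (@lebesgue_measure R).-integrable setT (EFin \o f).
Hypothesis intg : (lebesgue_rV R n).-integrable setT (EFin \o g).
Let h (x : 'rV[R]_n.+1) := f (x ord0 ord0) * g (rV_uncons x).2.

Let hE : (EFin \o h) \o @rV_cons R n = EFin \o (fun z => f z.1 * g z.2).
Proof.
by apply/funext => -[a x]; rewrite /h /comp rV_consK mxE unlift_none.
Qed.

Let mh : measurable_fun setT (EFin \o h).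
Proof.
have [/measurable_EFinP mf _] := integrableP _ _ _ intf.
have [/measurable_EFinP mg _] := integrableP _ _ _ intg.
apply/measurable_EFinP/measurable_funM.
  by apply: measurableT_comp => //; exact: measurable_rV_coord.
apply: measurableT_comp => //; apply: (measurableT_comp measurable_snd).
exact: measurable_rV_uncons.
Qed.

Lemma integrable_rV_consM : (lebesgue_rV R n.+1).-integrable setT (EFin \o h).
Proof.
have : (pushforward (@lebesgue_measure R \x lebesgue_rV R n)%E (@rV_cons R n)).-integrable
  setT (EFin \o h).
  apply: integrable_pushforward => //; first exact: measurable_rV_cons.
  by rewrite preimage_setT hE; exact: integrable_prod_mul.
by [].
Qed.

Lemma Rintegral_rV_consM : \int[lebesgue_rV R n.+1]_x h x =
  \int[lebesgue_measure]_a f a * \int[lebesgue_rV R n]_x g x.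
Proof.
rewrite -Rintegral_prod_mul// /Rintegral; congr fine.
transitivity (\int[pushforward (@lebesgue_measure R \x lebesgue_rV R n) (@rV_cons R n)]_x
  (EFin \o h) x)%E; first by [].
rewrite integral_pushforward//.
- by rewrite preimage_setT hE.
- exact: measurable_rV_cons.
- by rewrite preimage_setT hE; exact: integrable_prod_mul.
Qed.

End cons.

Definition expsq (n : nat) (c : R) (x : 'rV[R]_n) := expR (- (c * sqnv x)).

Lemma measurable_expsq n c : measurable_fun setT (@expsq n c).
Proof.
apply: measurableT_comp => //; apply: measurableT_comp => //.
by apply: measurable_funM => //; exact: measurable_sqnv.
Qed.

Lemma dotv_cons n (x p : 'rV[R]_n.+1) :
  dotv x p = x ord0 ord0 * p ord0 ord0 + dotv (rV_uncons x).2 (rV_uncons p).2.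
Proof.
by rewrite /dotv big_ord_recl; congr (_ + _); apply: eq_bigr => i _; rewrite !mxE.
Qed.

Lemma expsq_cons n c (x : 'rV[R]_n.+1) :
  expsq c x = expR (- (c * x ord0 ord0 ^+ 2)) * expsq c (rV_uncons x).2.
Proof. by rewrite /expsq /sqnv dotv_cons mulrDr opprD expRD expr2. Qed.

Lemma integrable_expsq n c : 0 < c ->
  (lebesgue_rV R n).-integrable setT (EFin \o @expsq n c).
Proof.
move=> c0; elim: n => [|n IH].
  apply/integrableP; split; first by apply/measurable_EFinP; exact: measurable_expsq.
  rewrite lebesgue_rV0 ?ltry//; apply: measurableT_comp => //.
  by apply/measurable_EFinP; exact: measurable_expsq.
have := integrable_rV_consM (integrable_gauss0 c0) IH.
by apply: eq_integrable => // x _; rewrite /= expsq_cons.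
Qed.

Lemma integrable_expsq_bounded n c (h : 'rV[R]_n -> R) : 0 < c ->
  measurable_fun setT h -> (forall x, `|h x| <= 1) ->
  (lebesgue_rV R n).-integrable setT (EFin \o (fun x => expsq c x * h x)).
Proof.
move=> c0 mh h1; apply: le_integrable (integrable_expsq n c0) => //.
  by apply/measurable_EFinP/measurable_funM => //; exact: measurable_expsq.
by move=> x _ /=; rewrite lee_fin normrM ler_piMr.
Qed.

Lemma measurable_cosdot n (p : 'rV[R]_n) :
  measurable_fun setT (fun x : 'rV[R]_n => cos (dotv x p)).
Proof.
apply: (@measurableT_comp _ _ _ _ _ _ (@cos R)); last exact: measurable_dotv.
by apply: continuous_measurable_fun; exact: continuous_cos.
Qed.

Lemma measurable_sindot n (p : 'rV[R]_n) :
  measurable_fun setT (fun x : 'rV[R]_n => sin (dotv x p)).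
Proof.
apply: (@measurableT_comp _ _ _ _ _ _ (@sin R)); last exact: measurable_dotv.
by apply: continuous_measurable_fun; exact: continuous_sin.
Qed.

Lemma integrable_expsq_cos n c (p : 'rV[R]_n) : 0 < c ->
  (lebesgue_rV R n).-integrable setT (EFin \o (fun x => expsq c x * cos (dotv x p))).
Proof.
move=> c0; apply: integrable_expsq_bounded => //; first exact: measurable_cosdot.
by move=> x; exact: cos_max.
Qed.

Lemma integrable_expsq_sin n c (p : 'rV[R]_n) : 0 < c ->
  (lebesgue_rV R n).-integrable setT (EFin \o (fun x => expsq c x * sin (dotv x p))).
Proof.
move=> c0; apply: integrable_expsq_bounded => //; first exact: measurable_sindot.
by move=> x; exact: sin_max.
Qed.

(** Cosine and sine are treated together, because splitting off one coordinate by the addition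
    formulas mixes them. All terms containing a sine integral vanish. *)
Lemma integral_expsq_cis n c (p : 'rV[R]_n) : 0 < c ->
  \int[lebesgue_rV R n]_x (expsq c x * cos (dotv x p)) =
    Num.sqrt (pi / c) ^+ n * expsq (4 * c)^-1 p /\
  \int[lebesgue_rV R n]_x (expsq c x * sin (dotv x p)) = 0.
Proof.
move=> c0; elim: n p => [|n IH] p.
  have z0 (x : 'rV[R]_0) : expsq c x = 1 /\ dotv x p = 0.
    by rewrite /expsq /sqnv /dotv !big_ord0 mulr0 oppr0 expR0.
  split; rewrite /Rintegral lebesgue_rV0.
  - by rewrite /= (z0 _).1 (z0 _).2 cos0 mulr1 mul1r /expsq /sqnv /dotv big_ord0 mulr0 oppr0 expR0.
  - by apply/measurable_EFinP/measurable_funM; [exact: measurable_expsq|exact: measurable_cosdot].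
  - by rewrite /= (z0 _).1 (z0 _).2 sin0 mulr0.
  - by apply/measurable_EFinP/measurable_funM; [exact: measurable_expsq|exact: measurable_sindot].
pose q := (rV_uncons p).2; pose p0 := p ord0 ord0.
have [IHc IHs] := IH q.
pose e (x : R) := expR (- (c * x ^+ 2)).
have ic : (@lebesgue_measure R).-integrable setT (EFin \o (fun a => e a * cos (p0 * a))).
  exact: integrable_fgauss.
have isi : (@lebesgue_measure R).-integrable setT (EFin \o (fun a => e a * sin (p0 * a))).
  apply: integrable_gauss_bounded => //; first exact: measurable_sinM.
  by move=> x; rewrite sin_max.
have jc := integrable_expsq_cos q c0; have js := integrable_expsq_sin q c0.
split.
- rewrite (@eq_Rintegral _ _ _ _ _ (fun x : 'rV[R]_n.+1 => (e (x ord0 ord0) * cos (p0 * x ord0 ord0))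
    * (expsq c (rV_uncons x).2 * cos (dotv (rV_uncons x).2 q)) -
    (e (x ord0 ord0) * sin (p0 * x ord0 ord0))
    * (expsq c (rV_uncons x).2 * sin (dotv (rV_uncons x).2 q)))); last first.
    move=> x _; rewrite expsq_cons dotv_cons -/q cosD mulrBr -/(e _) [p0 * _]mulrC.
    by congr (_ - _); rewrite mulrACA.
  rewrite RintegralB//; [|exact: (integrable_rV_consM ic jc)|exact: (integrable_rV_consM isi js)].
  rewrite (Rintegral_rV_consM ic jc) (Rintegral_rV_consM isi js).
  rewrite IHc IHs mulr0 subr0 integral_fgauss// [in RHS]exprS expsq_cons -/q -/p0 mulrACA.
  by rewrite (mulrC (p0 ^+ 2)).
- rewrite (@eq_Rintegral _ _ _ _ _ (fun x : 'rV[R]_n.+1 => (e (x ord0 ord0) * sin (p0 * x ord0 ord0))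
    * (expsq c (rV_uncons x).2 * cos (dotv (rV_uncons x).2 q)) +
    (e (x ord0 ord0) * cos (p0 * x ord0 ord0))
    * (expsq c (rV_uncons x).2 * sin (dotv (rV_uncons x).2 q)))); last first.
    move=> x _; rewrite expsq_cons dotv_cons -/q sinD mulrDr -/(e _) [p0 * _]mulrC.
    by congr (_ + _); rewrite mulrACA.
  rewrite RintegralD//; [|exact: (integrable_rV_consM isi jc)|exact: (integrable_rV_consM ic js)].
  rewrite (Rintegral_rV_consM isi jc) (Rintegral_rV_consM ic js).
  by rewrite IHs mulr0 addr0 integral_sin_gauss// mul0r.
Qed.

End lebesgue_rV_gauss.

(** * The Weyl operator of a Gaussian symbol as an integral operator *)

Section weyl_gauss.
Context (R : realType) (n : nat).
Local Notation leb := (lebesgue_rV R n).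
Local Notation m := (lebesgue_m R n).
Local Notation gc := (gauss_const R n).

Lemma gauss_constE : gc = (Num.sqrt (2 * pi))^-1 ^+ n.
Proof.
have p0 : 0 <= (2 * pi : R) by rewrite mulr_ge0// pi_ge0.
rewrite /gauss_const powRN exprVn; congr (_^-1).
by rewrite (mulrC n%:R) powRrM powR12_sqrt// powR_mulrn ?sqrtr_ge0.
Qed.

Lemma gauss_const_gt0 : 0 < gc.
Proof. by rewrite powR_gt0// mulr_gt0// pi_gt0. Qed.

Let mE (A : set 'rV[R]_n) : measurable A -> m A = (\int[leb]_(x in A) (gc)%:E)%E.
Proof. by move=> mA; rewrite integral_cst. Qed.

Lemma integrable_lebesgue_m (f : 'rV[R]_n -> R) :
  leb.-integrable setT (EFin \o f) -> m.-integrable setT (EFin \o f).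
Proof.
move=> intf; have [/measurable_EFinP mf _] := integrableP _ _ _ intf.
apply: (@integrable_density _ _ _ leb m (cst gc)) => //.
- by move=> x; exact/ltW/gauss_const_gt0.
- by have := integrableZr measurableT gc intf; apply: eq_integrable.
Qed.

Lemma Rintegral_lebesgue_m (f : 'rV[R]_n -> R) :
  leb.-integrable setT (EFin \o f) -> \int[m]_x f x = gc * \int[leb]_x f x.
Proof.
move=> intf; have [/measurable_EFinP mf _] := integrableP _ _ _ intf.
rewrite {1}/Rintegral (@integral_density _ _ _ leb m (cst gc)) //.
- by rewrite -[LHS]/(\int[leb]_x (f x * gc)) RintegralZr// mulrC.
- by move=> x; exact/ltW/gauss_const_gt0.
Qed.

(** The integral of e^(-c |x|^2) with respect to [m]. *)
Definition gauss_mass (c : R) := gc * Num.sqrt (pi / c) ^+ n.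

Lemma integral_m_expsq_cos c (p : 'rV[R]_n) : 0 < c ->
  \int[m]_x (expsq c x * cos (dotv x p)) = gauss_mass c * expsq (4 * c)^-1 p.
Proof.
move=> c0; rewrite Rintegral_lebesgue_m; last exact: integrable_expsq_cos.
by rewrite (integral_expsq_cis p c0).1 mulrA.
Qed.

Lemma integral_m_expsq_sin c (p : 'rV[R]_n) : 0 < c ->
  \int[m]_x (expsq c x * sin (dotv x p)) = 0.
Proof.
move=> c0; rewrite Rintegral_lebesgue_m; last exact: integrable_expsq_sin.
by rewrite (integral_expsq_cis p c0).2 mulr0.
Qed.

Local Notation mm := (lebesgue_m R n \x lebesgue_m R n)%E.

(** The symbol is a product of a function of x and a function of xi, so the transform factorises
    after expanding the cosine or sine of the sum; only the product of two cosine integrals is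
    nonzero. *)
Lemma fourier_gauss_symbol s (w : 'rV[R]_n * 'rV[R]_n) : 0 < s ->
  fourier (gauss_symbol s) w =
  (gauss_mass s ^+ 2 * (expsq (4 * s)^-1 w.1 * expsq (4 * s)^-1 w.2))%:C%C.
Proof.
move=> s0; rewrite /fourier /cintegral.
have mc p := integrable_lebesgue_m (integrable_expsq_cos p s0).
have ms p := integrable_lebesgue_m (integrable_expsq_sin p s0).
have aE (z : 'rV[R]_n * 'rV[R]_n) :
    expR (- (s * (sqnv z.1 + sqnv z.2))) = expsq s z.1 * expsq s z.2.
  by rewrite /expsq -expRD mulrDr opprD.
have iM f g intf intg := @integrable_prod_mul _ _ _ _ R m m f g intf intg.
congr (_ +i* _)%C.
- rewrite (@eq_Rintegral _ _ _ _ _ (fun z : 'rV[R]_n * 'rV[R]_n =>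
     (expsq s z.1 * cos (dotv z.1 w.1)) * (expsq s z.2 * cos (dotv z.2 w.2)) -
     (expsq s z.1 * sin (dotv z.1 w.1)) * (expsq s z.2 * sin (dotv z.2 w.2)))); last first.
    move=> z _; rewrite /gauss_symbol /cis /= cosN mul0r subr0 cosD aE mulrBr.
    by congr (_ - _); rewrite mulrACA.
  rewrite RintegralB//; [|exact: (iM _ _ (mc w.1) (mc w.2))|exact: (iM _ _ (ms w.1) (ms w.2))].
  rewrite (Rintegral_prod_mul (mc w.1) (mc w.2)) (Rintegral_prod_mul (ms w.1) (ms w.2)).
  rewrite !integral_m_expsq_cos// !integral_m_expsq_sin// mul0r subr0.
  by rewrite mulrACA -expr2.
- rewrite (@eq_Rintegral _ _ _ _ _ (fun z : 'rV[R]_n * 'rV[R]_n =>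
     -1 * ((expsq s z.1 * sin (dotv z.1 w.1)) * (expsq s z.2 * cos (dotv z.2 w.2))) +
     -1 * ((expsq s z.1 * cos (dotv z.1 w.1)) * (expsq s z.2 * sin (dotv z.2 w.2))))); last first.
    move=> z _; rewrite /gauss_symbol /cis /= sinN mul0r addr0 sinD aE.
    by rewrite -mulrDr mulN1r mulrN mulrDr; congr (- (_ + _)); rewrite mulrACA.
  have i1 := iM _ _ (ms w.1) (mc w.2); have i2 := iM _ _ (mc w.1) (ms w.2).
  rewrite RintegralD//; [|exact: (integrableZl measurableT (-1) i1)|exact: (integrableZl measurableT (-1) i2)].
  rewrite !RintegralZl//.
  rewrite (Rintegral_prod_mul (ms w.1) (mc w.2)) (Rintegral_prod_mul (mc w.1) (ms w.2)).
  by rewrite !integral_m_expsq_sin// mul0r !mulr0 addr0.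
Qed.

Lemma measurable_dot_pair (y : 'rV[R]_n) :
  measurable_fun setT (fun w : 'rV[R]_n * 'rV[R]_n => dotv w.1 (y + 2^-1 *: w.2)).
Proof.
apply: measurable_sum => i; apply: measurable_funM.
  by apply: (measurableT_comp (measurable_rV_coord i)); exact: measurable_fst.
under eq_fun do rewrite !mxE.
apply: measurable_funD => //; apply: measurable_funM => //.
by apply: (measurableT_comp (measurable_rV_coord i)); exact: measurable_snd.
Qed.

Section inner.
Variables (b : R) (y : 'rV[R]_n) (h : 'rV[R]_n -> R).
Hypotheses (b0 : 0 < b)
  (ih : m.-integrable setT (EFin \o (fun v => expsq b v * h v))).

(** The Weyl integrand at w = (u, v) with a Gaussian transform, the phase u.y + u.v/2 being
    collected as u.(y + v/2). [tr] stands for cosine or sine. *)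
Let osc (tr : R -> R) (w : 'rV[R]_n * 'rV[R]_n) :=
  (expsq b w.1 * tr (dotv w.1 (y + 2^-1 *: w.2))) * (expsq b w.2 * h w.2).

Let integrable_osc (tr : R -> R) : continuous tr -> (forall x, `|tr x| <= 1) ->
  mm.-integrable setT (EFin \o osc tr).
Proof.
move=> ctr tr1; have mtr := continuous_measurable_fun ctr.
have ie := integrable_lebesgue_m (integrable_expsq n b0).
have := integrable_prod_mul ie ih; apply: le_integrable => //.
  apply/measurable_EFinP/measurable_funM; last first.
    have [/measurable_EFinP mh _] := integrableP _ _ _ ih.
    exact: (measurableT_comp mh measurable_snd).
  apply: measurable_funM; first exact: (measurableT_comp (@measurable_expsq R n b) measurable_fst).
  exact: (measurableT_comp mtr (measurable_dot_pair y)).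
move=> w _ /=; rewrite lee_fin !normrM -!mulrA ler_wpM2l// ler_piMl//.
Qed.

(** Fubini with u integrated first: for fixed v the inner integral is a Gaussian Fourier transform
    at y + v/2. *)
Let Rintegral_osc (tr : R -> R) (C : R) (F : 'rV[R]_n -> R) :
  continuous tr -> (forall x, `|tr x| <= 1) ->
  (forall p, leb.-integrable setT (EFin \o (fun x : 'rV[R]_n => expsq b x * tr (dotv x p)))) ->
  (forall p : 'rV[R]_n, \int[m]_x (expsq b x * tr (dotv x p)) = C * F p) ->
  \int[mm]_w osc tr w =
  \int[m]_v (C * F (y + 2^-1 *: v) * (expsq b v * h v)).
Proof.
move=> ctr tr1 itr FE; rewrite /Rintegral -(integral21_prod_meas1 (integrable_osc ctr tr1)).
congr fine; apply: eq_integral => v _; rewrite /fubini_G /= /osc /=.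
have it := integrable_lebesgue_m (itr (y + 2^-1 *: v)).
have /= := integrableZr measurableT (expsq b v * h v) it.
move=> iz; rewrite -FE -[LHS]fineK; last first.
  by apply: integrable_fin_num => //; move: iz; apply: eq_integrable.
congr EFin; rewrite -[LHS]/(\int[m]_x (expsq b x * tr (dotv x (y + 2^-1 *: v)) * (expsq b v * h v))).
by rewrite RintegralZr.
Qed.

Lemma Rintegral_osc_cos : \int[mm]_w osc cos w =
  \int[m]_v (gauss_mass b * expsq (4 * b)^-1 (y + 2^-1 *: v) * (expsq b v * h v)).
Proof.
apply: Rintegral_osc => [|x|p|p]; [exact: continuous_cos|exact: cos_max| |].
  exact: integrable_expsq_cos.
exact: integral_m_expsq_cos.
Qed.

Lemma Rintegral_osc_sin : \int[mm]_w osc sin w = 0.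
Proof.
rewrite (@Rintegral_osc sin 0 (fun=> 0)) => [||x|p|p].
- rewrite (@eq_Rintegral _ _ _ _ _ (fun=> 0)); first by rewrite Rintegral_cst// mul0r.
  by move=> v _; rewrite !mul0r.
- exact: continuous_sin.
- exact: sin_max.
- exact: integrable_expsq_sin.
- by rewrite mul0r integral_m_expsq_sin.
Qed.

Lemma integrable_osc_cos : mm.-integrable setT (EFin \o osc cos).
Proof. by apply: integrable_osc; [exact: continuous_cos|exact: cos_max]. Qed.

Lemma integrable_osc_sin : mm.-integrable setT (EFin \o osc sin).
Proof. by apply: integrable_osc; [exact: continuous_sin|exact: sin_max]. Qed.

End inner.

(** The Fourier transform of a Gaussian of rate s has rate b = 1/(4s). Integrating out u transforms
    it back at y + v/2 and restores rate s, since 1/(4b) = s. The constants are two masses from the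
    transform of the symbol and one from the integral in u. The resulting kernel is real, so real
    and imaginary parts of [f] do not mix. *)
Lemma weyl_gauss_symbol s (f : 'rV[R]_n -> R[i]) (y : 'rV[R]_n) : 0 < s ->
  let b := (4 * s)^-1 in
  m.-integrable setT (EFin \o (fun v => expsq b v * complex.Re (f (v + y)))) ->
  m.-integrable setT (EFin \o (fun v => expsq b v * complex.Im (f (v + y)))) ->
  weyl (gauss_symbol s) f y =
  (let P h := gauss_mass s ^+ 2 * gauss_mass b *
     \int[m]_v (expsq s (y + 2^-1 *: v) * (expsq b v * h (v + y))) in
   P (fun z => complex.Re (f z)) +i* P (fun z => complex.Im (f z)))%C.
Proof.
move=> s0 b iR iI /=; rewrite /weyl /cintegral.
have b0 : 0 < b by rewrite invr_gt0 mulr_gt0.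
have sE : (4 * b)^-1 = s by rewrite /b; field; rewrite gt_eqF.
pose K := gauss_mass s ^+ 2.
have thE (w : 'rV[R]_n * 'rV[R]_n) :
    dotv w.1 y + dotv w.1 w.2 / 2 = dotv w.1 (y + 2^-1 *: w.2).
  rewrite /dotv mulr_suml -big_split; apply: eq_bigr => i _ /=.
  by rewrite !mxE; ring.
have c1 := integrable_osc_cos y b0 iR; have c2 := integrable_osc_cos y b0 iI.
have s1 := integrable_osc_sin y b0 iR; have s2 := integrable_osc_sin y b0 iI.
have FE (w : 'rV[R]_n * 'rV[R]_n) : fourier (gauss_symbol s) w = (K * (expsq b w.1 * expsq b w.2))%:C%C.
  by rewrite fourier_gauss_symbol.
have mz (F : 'rV[R]_n * 'rV[R]_n -> R) := @integrableZl _ _ _ mm _ measurableT K (EFin \o F).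
have fin h : m.-integrable setT (EFin \o (fun v => expsq b v * h (v + y))) ->
    K * \int[m]_v (gauss_mass b * expsq (4 * b)^-1 (y + 2^-1 *: v) *
    (expsq b v * h (v + y))) = K * gauss_mass b *
     \int[m]_v (expsq s (y + 2^-1 *: v) * (expsq b v * h (v + y))).
  move=> ih; rewrite -mulrA sE -[in RHS]RintegralZl//.
    by congr (_ * _); apply: eq_Rintegral => v _; rewrite !mulrA.
  have [/measurable_EFinP mh _] := integrableP _ _ _ ih.
  apply: le_integrable ih => //.
    apply/measurable_EFinP/measurable_funM => //.
    apply: (measurableT_comp (@measurable_expsq R n s)).
    by under eq_fun do rewrite addrC; exact: measurable_rV_affine.
  move=> v _ /=; rewrite lee_fin normrM ler_piMl// ger0_norm ?expR_ge0//.
  rewrite /expsq -expR0 ler_expR oppr_le0 mulr_ge0// ?(ltW s0)//.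
  by rewrite sumr_ge0// => i _; rewrite -expr2 sqr_ge0.
have hR := fin (fun z => complex.Re (f z)) iR.
have hI := fin (fun z => complex.Im (f z)) iI.
rewrite /= in hR hI.
rewrite -hR -hI -(Rintegral_osc_cos y b0 iR) -(Rintegral_osc_cos y b0 iI).
congr (_ +i* _)%C.
- rewrite -[RHS]subr0 -[X in _ - X](mulr0 K) -(Rintegral_osc_sin y b0 iI).
  rewrite -!RintegralZl// -RintegralB//; [|exact: mz|exact: mz].
  apply: eq_Rintegral => w _; rewrite FE thE /cis; case: (f _) => u v /=.
  by rewrite !mul0r !subr0; ring.
- rewrite -[RHS]addr0 -[X in _ + X](mulr0 K) -(Rintegral_osc_sin y b0 iR).
  rewrite -!RintegralZl// -RintegralD//; [|exact: mz|exact: mz].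
  apply: eq_Rintegral => w _; rewrite FE thE /cis; case: (f _) => u v /=.
  by rewrite !mul0r !subr0 !addr0; ring.
Qed.

End weyl_gauss.

Section rV_affine.
Context (R : realType) (n : nat).
Local Notation leb := (lebesgue_rV R n).
Variables (c : R) (b : 'rV[R]_n) (f : 'rV[R]_n -> R).
Hypotheses (c0 : 0 < c) (intf : leb.-integrable setT (EFin \o f)).

Let mf : measurable_fun setT f.
Proof. by have [/measurable_EFinP] := integrableP _ _ _ intf. Qed.

Let mfa : measurable_fun setT (fun x : 'rV[R]_n => f (c *: x + b)).
Proof. by apply: (measurableT_comp mf); exact: measurable_rV_affine. Qed.

Lemma integrable_rV_affine :
  leb.-integrable setT (EFin \o (fun x : 'rV[R]_n => f (c *: x + b))).
Proof.
apply/integrableP; split; first exact/measurable_EFinP.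
have [_] := integrableP _ _ _ intf.
rewrite (ge0_integral_rV_affine b c0)//; last first.
  by apply: measurableT_comp => //; exact/measurable_EFinP.
set I := (X in (_ * X)%E) => cI.
have I0 : (0 <= I)%E by exact: integral_ge0.
rewrite ltey; apply/eqP => Iy; move: cI.
rewrite -[X in (_ * X)%E]/I [I]Iy gt0_muley ?ltxx// lte_fin exprn_gt0//.
Qed.

(** The nonnegative case applied to indicators shows that Lebesgue measure is [c ^+ n] times its
    image under the affine map; the factor is then treated as a constant density. *)
Lemma Rintegral_rV_affine :
  \int[leb]_x f x = c ^+ n * \int[leb]_x f (c *: x + b).
Proof.
have mphi := measurable_rV_affine c b.
have cn0 : 0 <= c ^+ n by rewrite exprn_ge0// ltW.
pose nu : {measure set 'rV[R]_n -> \bar R} :=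
  measure_function_pushforward__canonical__measure_function_Measure leb mphi.
have mE A : measurable A -> mscale (NngNum cn0) nu A = leb A.
  move=> mA; have -> : leb A = (\int[leb]_x (\1_A x)%:E)%E by rewrite integral_indic ?setIT.
  rewrite (ge0_integral_rV_affine b c0)//.
  - rewrite /mscale /= /nu /= /pushforward; congr (_ * _)%E.
    rewrite (_ : (fun x => _) = (EFin \o \1_((fun x : 'rV[R]_n => c *: x + b) @^-1` A)))//.
    rewrite integral_indic ?setIT// -[X in measurable X]setTI.
    exact: (measurable_rV_affine c b measurableT mA).
  - by apply/measurable_EFinP; exact: measurable_indic.
rewrite -RintegralZl//; last exact: integrable_rV_affine.
rewrite {1}/Rintegral (eq_measure_integral (mscale (NngNum cn0) nu)); last first.
  by move=> A mA _; exact/esym/mE.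
have ia := integrable_rV_affine.
rewrite -[LHS]/(\int[mscale (NngNum cn0) nu]_x f x) {1}/Rintegral.
rewrite (@integral_density _ _ _ nu _ (cst (c ^+ n))) //.
- congr fine; rewrite integral_pushforward//.
  + by apply: eq_integral => x _; rewrite /= mulrC.
  + by apply/measurable_EFinP/measurable_funM.
  + by have := integrableZr measurableT (c ^+ n) ia; apply: eq_integrable.
- by move=> A mA; rewrite /= integral_cst.
Qed.

End rV_affine.

(** * From the Weyl kernel to Mehler's kernel *)

Section weyl_mehler.
Context (R : realType) (n : nat).
Local Notation leb := (lebesgue_rV R n).
Local Notation m := (lebesgue_m R n).
Implicit Types (x z : 'rV[R]_n).

(** The Lebesgue density at [x] of the Gaussian law with mean r z and variance 1 - r^2 in each
    coordinate. *)
Definition ou_kernel (r : R) z x : R :=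
  (Num.sqrt (2 * pi * (1 - r ^+ 2)))^-1 ^+ n *
  expsq (2 * (1 - r ^+ 2))^-1 (r *: z - x).

Lemma sqnv_comb (a b : R) z x :
  sqnv (a *: z + b *: x) = a ^+ 2 * sqnv z + b ^+ 2 * sqnv x + 2 * a * b * dotv z x.
Proof.
rewrite /sqnv /dotv !mulr_sumr -!big_split; apply: eq_bigr => i _ /=.
by rewrite !mxE; ring.
Qed.

Lemma sqnv_ge0 x : 0 <= sqnv x.
Proof. by apply: sumr_ge0 => i _; rewrite -expr2 sqr_ge0. Qed.

Lemma expsq_gt0 c x : 0 < expsq c x.
Proof. exact: expR_gt0. Qed.

Lemma expsq_le1 c x : 0 <= c -> expsq c x <= 1.
Proof. by move=> c0; rewrite -expR0 ler_expR oppr_le0 mulr_ge0// sqnv_ge0. Qed.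

Lemma integrable_expsq_affine c k (b : 'rV[R]_n) : 0 < c -> 0 < k ->
  leb.-integrable setT (EFin \o (fun z => expsq c (k *: z + b))).
Proof.
by move=> c0 k0; apply: (@integrable_rV_affine _ _ k b _ k0); exact: integrable_expsq.
Qed.

(** A |B| <= A + B^2 for 0 <= A <= 1. This makes the Weyl integrand integrable when all that is
    known of [g] is that its square is integrable against a Gaussian. *)
Lemma integrable_expsqM (c c' k : R) (b : 'rV[R]_n) (g : 'rV[R]_n -> R) : 0 < c -> 0 < k ->
  measurable_fun setT g ->
  leb.-integrable setT (EFin \o (fun z => expsq (2 * c') z * g z ^+ 2)) ->
  leb.-integrable setT (EFin \o (fun z => expsq c (k *: z + b) * (expsq c' z * g z))).
Proof.
move=> c0 k0 mg g2.
have ie := integrable_expsq_affine b c0 k0.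
apply: le_integrable (integrableD measurableT ie g2) => //.
  apply/measurable_EFinP/measurable_funM.
    apply: (measurableT_comp (@measurable_expsq R n c)).
    exact: measurable_rV_affine.
  by apply: measurable_funM => //; exact: measurable_expsq.
move=> z _ /=; rewrite lee_fin.
have e0 := expsq_gt0 c (k *: z + b); have e1 := expsq_le1 (k *: z + b) (ltW c0).
have E : expsq (2 * c') z * g z ^+ 2 = (expsq c' z * g z) ^+ 2.
  by rewrite exprMn [in RHS]/expsq -expRM_natl; congr (expR _ * _); ring.
rewrite E; set A := expsq c _ in e0 e1 *; set B := _ * g z.
rewrite (@ger0_norm _ (A + B ^+ 2)) ?addr_ge0 ?sqr_ge0 ?ltW//.
rewrite normrM (ger0_norm (ltW e0)) -(real_normK (num_real B)).
have := sqr_ge0 (`|B| - A); rewrite sqrrB.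
move: (normr_ge0 B) => B0; nra.
Qed.

(** Everything is an n-th power of a one-dimensional identity, which rests on 1 - r^2 = (2/(1+s))^2
    s, because 2/(1+s) = 1 + r. The factor sqrt(2)^-n is the Jacobian of z = sqrt(2) v + x, and
    [gauss_const] the density of [m]. *)
Lemma gauss_weyl_const (s r : R) : 0 < r < 1 -> s = (1 - r) / (1 + r) ->
  (1 + s) ^+ n * gauss_mass n s ^+ 2 * gauss_mass n (4 * s)^-1 * gauss_const R n *
    (Num.sqrt 2 ^+ n)^-1 = (Num.sqrt (2 * pi * (1 - r ^+ 2)))^-1 ^+ n :> R.
Proof.
move=> /andP[r0 r1] sE; have p0 : 0 < (pi : R) := pi_gt0 R.
have r1p : 0 < 1 + r by lra.
have s0 : 0 < s by rewrite sE divr_gt0//; lra.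
have sg : 1 - r ^+ 2 = (2 / (1 + s)) ^+ 2 * s.
  by rewrite sE; field; apply/andP; split; rewrite gt_eqF//; lra.
rewrite /gauss_mass !gauss_constE -!exprVn -!exprMn exprAC -!exprMn; congr (_ ^+ n).
have s1 : 0 <= (1 + s)^-1 by rewrite invr_ge0; lra.
have q0 : 0 < Num.sqrt s by rewrite sqrtr_gt0.
have a0 : 0 < Num.sqrt (pi : R) by rewrite sqrtr_gt0.
have w0 : 0 < Num.sqrt (2 : R) by rewrite sqrtr_gt0.
have -> : Num.sqrt (pi / s) = Num.sqrt pi / Num.sqrt s.
  by rewrite sqrtrM ?(ltW p0)// sqrtrV// ltW.
have -> : Num.sqrt (2 * pi) = Num.sqrt 2 * Num.sqrt (pi : R) by rewrite sqrtrM.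
have -> : Num.sqrt (pi / (4 * s)^-1) = 2 * Num.sqrt pi * Num.sqrt s.
  rewrite invrK (_ : pi * _ = 2 ^+ 2 * pi * s); last by ring.
  by rewrite sqrtrM ?mulr_ge0 ?(ltW p0)// sqrtrM// sqrtr_sqr ger0_norm.
have -> : Num.sqrt (2 * pi * (1 - r ^+ 2)) =
    Num.sqrt 2 * Num.sqrt pi * (2 / (1 + s)) * Num.sqrt s.
  rewrite sg mulrA sqrtrM ?mulr_ge0 ?sqr_ge0 ?(ltW p0)//.
  by rewrite sqrtrM ?mulr_ge0 ?(ltW p0)// sqrtrM// sqrtr_sqr ger0_norm ?mulr_ge0.
have w2 : Num.sqrt 2 ^+ 2 = 2 :> R by rewrite sqr_sqrtr.
have w4 : Num.sqrt 2 ^+ 4 = 4 :> R by rewrite (exprM _ 2 2) w2; ring.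
rewrite (_ : (1 + s) * _ * _ * _ * _ = 2 * (1 + s) / (Num.sqrt 2 ^+ 4 * (Num.sqrt 2 * Num.sqrt pi * Num.sqrt s))).
  rewrite w4; field; rewrite !gt_eqF//; lra.
by field; rewrite !gt_eqF.
Qed.

(** The Mehler operator in adjoint form: the distribution with density [g] relative to gamma is
    transported by the kernel and divided by the Gaussian density again. By reversibility of the
    kernel this is the usual average of [g]. *)
Definition mehler_int (r : R) (g : 'rV[R]_n -> R) x : R :=
  (\int[leb]_z (ou_kernel r z x * g z * gauss_density z)) / gauss_density x.

Lemma gauss_density_gt0 x : 0 < gauss_density x.
Proof. by rewrite mulr_gt0 ?gauss_const_gt0 ?expR_gt0. Qed.

(** Comparison of the coefficients of |z|^2, |x|^2 and z.x. On the left, the factors come in order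
    from [Uinv], from e^(-s|y+v/2|^2), from the Gaussian in v, and from [U]. *)
Lemma weyl_exponent (s r : R) z x : 0 < r < 1 -> s = (1 - r) / (1 + r) ->
  expR (sqnv x / 4) * (expsq (s / 8) (z + x) * expsq (8 * s)^-1 (z - x) * expsq 4^-1 z) =
  expsq (2 * (1 - r ^+ 2))^-1 (r *: z - x) * gauss_density z / gauss_density x.
Proof.
move=> /andP[r0 r1] sE; rewrite /gauss_density.
have g0 := gauss_const_gt0 R n.
rewrite [_ / (_ * _)](_ : _ = expsq (2 * (1 - r ^+ 2))^-1 (r *: z - x) *
  (expR (- (sqnv z / 2)) / expR (- (sqnv x / 2)))); last first.
  by field; rewrite !gt_eqF ?expR_gt0.
rewrite -expRN /expsq -!expRD; congr expR.
have -> : sqnv (z + x) = sqnv z + sqnv x + 2 * dotv z x.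
  by have := sqnv_comb 1 1 z x; rewrite !scale1r => ->; ring.
have -> : sqnv (z - x) = sqnv z + sqnv x - 2 * dotv z x.
  by have := sqnv_comb 1 (-1) z x; rewrite scale1r scaleN1r => ->; ring.
have -> : sqnv (r *: z - x) = r ^+ 2 * sqnv z + sqnv x - 2 * r * dotv z x.
  by have := sqnv_comb r (-1) z x; rewrite scaleN1r => ->; ring.
rewrite sE; field.
have rr : 1 - r ^+ 2 = (1 - r) * (1 + r) by ring.
by rewrite rr mulf_eq0 negb_or !gt_eqF//; lra.
Qed.

Section core.
Variables (s r : R) (g : 'rV[R]_n -> R) (x : 'rV[R]_n).
Hypotheses (r01 : 0 < r < 1) (sE : s = (1 - r) / (1 + r)).
Hypotheses (mg : measurable_fun setT g)
  (g2 : leb.-integrable setT (EFin \o (fun z => expsq 2^-1 z * g z ^+ 2))).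
Let e := (Num.sqrt 2)^-1 : R.
Let b := (4 * s)^-1.
Let y := e *: x.
Let h u := 2 `^ (n%:R / 4) * expR (- (sqnv u / 2)) * g (Num.sqrt 2 *: u).

Let e0 : 0 < e. Proof. by rewrite invr_gt0 sqrtr_gt0. Qed.
Let q0 : 0 < Num.sqrt 2 :> R. Proof. by rewrite sqrtr_gt0. Qed.
Let eq1 : Num.sqrt 2 * e = 1. Proof. by rewrite mulfV// gt_eqF. Qed.
Let e2 : e ^+ 2 = 2^-1. Proof. by rewrite /e exprVn sqr_sqrtr. Qed.
Let s0 : 0 < s.
Proof. by case/andP : r01 => r0 r1; rewrite sE divr_gt0//; lra. Qed.

(** The Weyl integrand in the variable z = sqrt(2)(v + y) = sqrt(2) v + x, the point at which [U]
    evaluates its argument, up to a constant and before the factor e^(-s|y+v/2|^2). *)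
Let Phi z := expsq (8 * s)^-1 (z - x) * (expsq 4^-1 z * g z).

Let ePhi : leb.-integrable setT (EFin \o Phi).
Proof.
have s8 : 0 < (8 * s)^-1 by rewrite invr_gt0 mulr_gt0.
have E : 2 * 4^-1 = 2^-1 :> R by field.
have g2' := g2; rewrite -E in g2'.
have := integrable_expsqM (- x) s8 ltr01 mg g2'.
by apply: eq_integrable => // z _; rewrite /= scale1r.
Qed.

Let PhiE v : expsq b v * h (v + y) = 2 `^ (n%:R / 4) * Phi (Num.sqrt 2 *: v + x).
Proof.
have vy : Num.sqrt 2 *: (v + y) = Num.sqrt 2 *: v + x.
  by rewrite scalerDr scalerA eq1 scale1r.
have -> : v + y = e *: (Num.sqrt 2 *: v + x).
  by rewrite scalerDr scalerA mulrC eq1 scale1r.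
rewrite /h /Phi /b /expsq addrK scalerA eq1 scale1r !sqnvZ e2 sqr_sqrtr//.
set q := sqnv v; set q' := sqnv _.
have -> : (8 * s)^-1 * (2 * q) = (4 * s)^-1 * q by field; rewrite gt_eqF.
have -> : 2^-1 * q' / 2 = 4^-1 * q' by field.
by ring.
Qed.

Lemma integrable_weyl_core :
  m.-integrable setT (EFin \o (fun v => expsq b v * h (v + y))).
Proof.
apply: integrable_lebesgue_m.
have := integrableZl measurableT (2 `^ (n%:R / 4)) (integrable_rV_affine x q0 ePhi).
by apply: eq_integrable => // v _; rewrite /= PhiE.
Qed.

Lemma weyl_core : (1 + s) ^+ n * (2 `^ (- (n%:R / 4)) * expR (sqnv x / 4) *
  (gauss_mass n s ^+ 2 * gauss_mass n b *
     \int[m]_v (expsq s (y + 2^-1 *: v) * (expsq b v * h (v + y))))) =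
  mehler_int r g x.
Proof.
pose Psi z := expsq (s / 8) (z + x) * Phi z.
have iPsi : leb.-integrable setT (EFin \o Psi).
  apply: le_integrable ePhi => //.
    apply/measurable_EFinP/measurable_funM.
      apply: (measurableT_comp (@measurable_expsq R n _)).
      by have := measurable_rV_affine 1 x; under eq_fun do rewrite scale1r.
    by have [/measurable_EFinP] := integrableP _ _ _ ePhi.
  move=> z _ /=; rewrite lee_fin normrM ler_piMl// ger0_norm ?expR_ge0//.
  by rewrite expsq_le1// divr_ge0// ltW.
have iPsia := integrable_rV_affine x q0 iPsi.
have PsiE v : expsq s (y + 2^-1 *: v) * (expsq b v * h (v + y)) =
    2 `^ (n%:R / 4) * Psi (Num.sqrt 2 *: v + x).
  rewrite [X in _ * X]PhiE [LHS]mulrCA; congr (_ * _).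
  rewrite /Psi; congr (_ * _).
  (* With z = sqrt(2) v + x and y = x / sqrt(2), this point is (z + x) / (2 sqrt(2)), whence the
     rate s/8. *)
  have -> : y + 2^-1 *: v = (2^-1 * e) *: (Num.sqrt 2 *: v + x + x).
    rewrite !scalerDr !scalerA /y -addrA -scalerDl -mulrA (mulrC e) eq1 mulr1 addrC.
    by congr (_ *: _ + _); field.
  by rewrite /expsq sqnvZ exprMn e2; congr expR; field.
have -> : \int[m]_v (expsq s (y + 2^-1 *: v) * (expsq b v * h (v + y))) =
    \int[m]_v (2 `^ (n%:R / 4) * Psi (Num.sqrt 2 *: v + x)).
  by apply: eq_Rintegral => v _; rewrite PsiE.
rewrite RintegralZl//; last exact: integrable_lebesgue_m.
rewrite Rintegral_lebesgue_m//.
have -> : \int[leb]_v Psi (Num.sqrt 2 *: v + x) = (Num.sqrt 2 ^+ n)^-1 * \int[leb]_z Psi z.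
  by rewrite (Rintegral_rV_affine x q0 iPsi) mulrA mulVf ?mul1r// gt_eqF// exprn_gt0.
rewrite /mehler_int.
set C := Num.sqrt 2 ^+ n; set I := \int[leb]_z Psi z.
transitivity ((1 + s) ^+ n * gauss_mass n s ^+ 2 * gauss_mass n b * gauss_const R n * C^-1 *
  (2 `^ (- (n%:R / 4)) * 2 `^ (n%:R / 4)) * (expR (sqnv x / 4) * I)).
  by ring.
rewrite (gauss_weyl_const r01 sE) powRN mulVf ?gt_eqF// mulr1.
rewrite (@eq_Rintegral _ _ _ _ _ (fun z => gauss_density x *
    ((Num.sqrt (2 * pi * (1 - r ^+ 2)))^-1 ^+ n * expR (sqnv x / 4)) * Psi z)).
  rewrite RintegralZl// -/I; field.
  by rewrite gt_eqF// gauss_density_gt0.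
move=> z _; have dx0 := gauss_density_gt0 x.
have := weyl_exponent z x r01 sE; rewrite /ou_kernel /Psi /Phi.
move/(congr1 ( *%R^~ (gauss_density x))); rewrite divfK ?gt_eqF// => E.
transitivity ((Num.sqrt (2 * pi * (1 - r ^+ 2)))^-1 ^+ n * g z *
  (expsq (2 * (1 - r ^+ 2))^-1 (r *: z - x) * gauss_density z)); first by ring.
by rewrite -E; ring.
Qed.

End core.

Lemma gauss_weyl_mehler (r : R) (f : 'rV[R]_n -> R[i]) x : 0 < r < 1 ->
  let s := (1 - r) / (1 + r) in
  cmeasurable f ->
  leb.-integrable setT (EFin \o (fun z => expsq 2^-1 z * complex.Re (f z) ^+ 2)) ->
  leb.-integrable setT (EFin \o (fun z => expsq 2^-1 z * complex.Im (f z) ^+ 2)) ->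
  (((1 + s) ^+ n)%:C * gauss_weyl (gauss_symbol s) f x =
  mehler_int r (fun z => complex.Re (f z)) x +i*
  mehler_int r (fun z => complex.Im (f z)) x)%C.
Proof.
move=> r01 s [mR mI] iR iI.
have s0 : 0 < s by case/andP : r01 => r0 r1; rewrite /s divr_gt0//; lra.
have UR u : complex.Re (U f u) = 2 `^ (n%:R / 4) * expR (- (sqnv u / 2)) *
   complex.Re (f (Num.sqrt 2 *: u)).
  by rewrite /U; case: (f _) => p q /=; rewrite mul0r subr0.
have UI u : complex.Im (U f u) = 2 `^ (n%:R / 4) * expR (- (sqnv u / 2)) *
   complex.Im (f (Num.sqrt 2 *: u)).
  by rewrite /U; case: (f _) => p q /=; rewrite mul0r addr0.
have jR := integrable_weyl_core x r01 erefl mR iR.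
have jI := integrable_weyl_core x r01 erefl mI iI.
rewrite /gauss_weyl /= {1}/Uinv weyl_gauss_symbol//.
- rewrite -(weyl_core x r01 erefl mR iR) -(weyl_core x r01 erefl mI iI) -/s.
  apply/eqP; rewrite eq_complex /= !mul0r !subr0 !addr0.
  apply/andP; split; apply/eqP; congr (_ * (_ * (_ * _))); apply: eq_Rintegral => v _.
    by rewrite UR.
  by rewrite UI.
- by move: jR; apply: eq_integrable => // v _; rewrite /= UR.
- by move: jI; apply: eq_integrable => // v _; rewrite /= UI.
Qed.
End weyl_mehler.

(** * The transition density and its cutoffs *)

Section calculus.
Context (R : realType).
Implicit Types x t a r u y : R.

Lemma cvg_is_derive (V : normedModType R) (f : V -> R) (a v : V) (l : R) :
  h^-1 * (f (h *: v + a) - f a) @[h --> 0^'] --> l -> is_derive a v f l.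
Proof.
move=> fl; apply: DeriveDef; first by apply/cvg_ex; exists l.
exact: cvg_lim fl.
Qed.

Lemma is_derive_cvg (V : normedModType R) (f : V -> R) (a v : V) (l : R) :
  is_derive a v f l -> h^-1 * (f (h *: v + a) - f a) @[h --> 0^'] --> l.
Proof.
by move=> [/cvg_ex[l' fl'] <-]; rewrite /derive (cvg_lim _ fl').
Qed.

Definition pospow (k : nat) (x : R) : R := Num.max x 0 ^+ k.

Lemma pospow_ge0 k x : 0 <= pospow k x.
Proof. by rewrite exprn_ge0// le_max lexx orbT. Qed.

Lemma continuous_pospow k : continuous (pospow k).
Proof.
move=> x; apply: (@continuous_comp _ _ _ (fun x => Num.max x 0) (fun x => x ^+ k)); last first.
  exact: exprn_continuous.
by apply: (@continuous_max _ _ (id : R -> R) (cst 0)) => //; exact: cst_continuous.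
Qed.

(** Only the corner at 0 needs care: there the difference quotient of the positive part to the power
    k+2 is its power k+1, which tends to 0. *)
Lemma is_derive_pospow k x :
  is_derive x (1 : R) (pospow k.+2) (k.+2%:R * pospow k.+1 x).
Proof.
have [x0|x0|->] := ltgtP x 0.
- rewrite (_ : k.+2%:R * _ = 0); last first.
    by rewrite /pospow max_r ?expr0n ?mulr0// ltW.
  apply: (@near_eq_is_derive _ _ _ (cst 0)) => //.
  + near=> z; rewrite /pospow max_r ?expr0n//.
    by apply/ltW; near: z; exact: lt_nbhsl.
- rewrite (_ : pospow k.+1 x = x ^+ k.+1); last by rewrite /pospow max_l// ltW.
  apply: (@near_eq_is_derive R R^o R^o ((@GRing.exp R)^~ k.+2)) => //.
  + near=> z; rewrite /pospow max_l//.
    by apply/ltW; near: z; exact: lt_nbhsr.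
  + apply: DeriveDef; first exact: exprn_derivable.
    by rewrite exp_derive /GRing.scale /= mulr1.
- apply: cvg_is_derive; rewrite (_ : pospow k.+2 0 = 0); last first.
    by rewrite /pospow maxxx expr0n.
  rewrite (_ : _ * pospow k.+1 0 = pospow k.+1 0); last first.
    by rewrite /pospow maxxx expr0n mulr0.
  apply: (@cvg_trans _ (pospow k.+1 h @[h --> 0^'])).
    apply: near_eq_cvg; near=> h.
    have h0 : h != 0 by near: h; exact: nbhs_dnbhs_neq.
    rewrite subr0 addr0 [h *: _]mulr1 /pospow [_ ^+ k.+2]exprS mulrA.
    have [hp|hn] := leP 0 h; first by rewrite mulVf// mul1r.
    by rewrite expr0n !mulr0.
  by apply: cvg_within_filter; exact: continuous_pospow.
Unshelve. all: by end_near. Qed.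

(* A compactly supported C^2 cutoff with explicit derivatives; it tends to 1
   as a tends to 0. *)
Definition cut a t := pospow 3 (1 - (a * t) ^+ 2).
Definition dcut a t := - (6 * a ^+ 2 * t) * pospow 2 (1 - (a * t) ^+ 2).
Definition ddcut a t := 24 * a ^+ 4 * t ^+ 2 * pospow 1 (1 - (a * t) ^+ 2)
  - 6 * a ^+ 2 * pospow 2 (1 - (a * t) ^+ 2).

Lemma is_derive_onesq a t :
  is_derive t (1 : R) (fun t => 1 - (a * t) ^+ 2) (- (2 * a ^+ 2 * t)).
Proof. apply: is_derive_eq; rewrite /GRing.scale /=; ring. Qed.

Lemma is_derive_pospow_cut k a t :
  is_derive t (1 : R) (fun t => pospow k.+2 (1 - (a * t) ^+ 2))
   (- (2 * a ^+ 2 * t) * (k.+2%:R * pospow k.+1 (1 - (a * t) ^+ 2))).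
Proof.
have := @is_derive1_comp R (pospow k.+2) (fun t => 1 - (a * t) ^+ 2) t _ _
  (is_derive_pospow k (1 - (a * t) ^+ 2)) (is_derive_onesq a t).
by rewrite mulrC.
Qed.

Lemma is_derive_cut a t : is_derive t (1 : R) (cut a) (dcut a t).
Proof.
have h := is_derive_pospow_cut 1 a t.
by apply: is_derive_eq h _; rewrite /dcut; ring.
Qed.

Lemma is_derive_dcut a t : is_derive t (1 : R) (dcut a) (ddcut a t).
Proof.
have h := is_derive_pospow_cut 0 a t.
rewrite /dcut; apply: is_derive_eq; rewrite /GRing.scale /= /ddcut; ring.
Qed.

Lemma continuous_ddcut a : continuous (ddcut a).
Proof.
have cq : continuous (fun t : R => 1 - (a * t) ^+ 2).
  move=> t; apply/differentiable_continuous/derivable1_diffP.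
  by have [] := is_derive_onesq a t.
have cp k : continuous (fun t : R => pospow k (1 - (a * t) ^+ 2)).
  move=> t; apply: (continuous_comp (cq t)); exact: continuous_pospow.
move=> t; apply: cvgB; apply: cvgM; [|exact: cp| |exact: cp].
  apply: cvgM; first exact: cvg_cst.
  exact: exprn_continuous.
exact: cvg_cst.
Qed.

Lemma pospow_cut_le1 k a t : pospow k (1 - (a * t) ^+ 2) <= 1.
Proof.
rewrite exprn_ile1// ?le_max ?lexx ?orbT// ge_max ler01 andbT.
by rewrite gerBl sqr_ge0.
Qed.

(** Where the positive part does not vanish, (a t)^2 is at most 1. *)
Lemma pospow_cut_le k a t : (a * t) ^+ 2 * pospow k.+1 (1 - (a * t) ^+ 2) <= 1.
Proof.
have := sqr_ge0 (a * t); set q := (a * t) ^+ 2 => q0.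
have p1 := pospow_cut_le1 k.+1 a t; rewrite -/q in p1.
have p0 := pospow_ge0 k.+1 (1 - q).
have [q1|q1] := leP q 1; first by rewrite mulr_ile1.
by rewrite /pospow max_r ?expr0n ?mulr0// subr_le0 ltW.
Qed.

Lemma cut_ge0 a t : 0 <= cut a t. Proof. exact: pospow_ge0. Qed.

Lemma cut_le1 a t : cut a t <= 1. Proof. exact: pospow_cut_le1. Qed.

Lemma normr_dcut a t : `|dcut a t| <= 6 * `|a|.
Proof.
have p1 := pospow_cut_le1 2 a t; have p2 := pospow_cut_le 1 a t.
have p0 := pospow_ge0 2 (1 - (a * t) ^+ 2).
rewrite /dcut; set p := pospow _ _ in p0 p1 p2 *.
rewrite (_ : - _ * p = - (6 * a * (a * t * p))); last by ring.
rewrite normrN normrM normrM (@ger0_norm _ 6)// ler_piMr ?mulr_ge0//.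
rewrite ler_norml; nra.
Qed.

Lemma normr_ddcut a t : `|ddcut a t| <= 30 * a ^+ 2.
Proof.
have p1 := pospow_cut_le1 2 a t; have p2 := pospow_cut_le 0 a t.
have p0 := pospow_ge0 2 (1 - (a * t) ^+ 2).
have q0 := pospow_ge0 1 (1 - (a * t) ^+ 2).
rewrite /ddcut; set p := pospow 2 _ in p0 p1 *; set q := pospow 1 _ in q0 p2 *.
rewrite (_ : _ - _ = a ^+ 2 * (24 * ((a * t) ^+ 2 * q) - 6 * p)); last by ring.
rewrite normrM ger0_norm ?sqr_ge0// mulrC ler_wpM2r ?sqr_ge0//.
have w0 : 0 <= (a * t) ^+ 2 * q by rewrite mulr_ge0 ?sqr_ge0.
move: p2 w0; set w := _ * q => p2 w0.
by rewrite ler_norml; apply/andP; split; lra.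
Qed.

(** The factor t of the drift meets a^2 t in the derivative, and (a t)^2 <= 1 on the support. The
    bound does not shrink with [a], but uniform boundedness is what dominated convergence asks
    for. *)
Lemma normr_id_dcut a t : `|t * dcut a t| <= 6.
Proof.
have p1 := pospow_cut_le1 2 a t; have p2 := pospow_cut_le 1 a t.
have p0 := pospow_ge0 2 (1 - (a * t) ^+ 2).
rewrite /dcut; set p := pospow _ _ in p0 p1 p2 *.
rewrite (_ : t * _ = - (6 * ((a * t) ^+ 2 * p))); last by ring.
have w0 : 0 <= (a * t) ^+ 2 * p by rewrite mulr_ge0 ?sqr_ge0.
by rewrite normrN ger0_norm ?(mulr_ge0 _ w0)// -[leRHS]mulr1 ler_pM2l.
Qed.

Lemma cut_eq0 a t : 1 <= `|a * t| -> cut a t = 0.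
Proof.
move=> at1; rewrite /cut /pospow max_r ?expr0n// subr_le0.
by rewrite -[_ ^+ 2]real_normK ?num_real// exprn_ege1.
Qed.

(** The one-dimensional kernel with amplitude, rate and contraction left free, followed by its first
    two derivatives in [t]; bounds explicit in c and A can later be made uniform in time. *)
Definition gk c A r y t := c * expR (- (A * (r * t - y) ^+ 2)).
Definition dgk c A r y t := - (2 * A * r * (r * t - y)) * gk c A r y t.
Definition ddgk c A r y t :=
  (4 * A ^+ 2 * r ^+ 2 * (r * t - y) ^+ 2 - 2 * A * r ^+ 2) * gk c A r y t.

Lemma is_derive_gk c A r y t : is_derive t (1 : R) (gk c A r y) (dgk c A r y t).
Proof.
rewrite /gk; apply: is_derive_eq; rewrite /GRing.scale /= /dgk /gk; ring.
Qed.

Lemma is_derive_dgk c A r y t : is_derive t (1 : R) (dgk c A r y) (ddgk c A r y t).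
Proof.
have h := is_derive_gk c A r y t.
rewrite /dgk; apply: is_derive_eq; rewrite /GRing.scale /= /ddgk /dgk; ring.
Qed.

Lemma continuous_ddgk c A r y : continuous (ddgk c A r y).
Proof.
move=> t; have h := is_derive_gk c A r y t.
by apply: is_derive_continuous; rewrite /ddgk; apply: is_derive_eq.
Qed.

Lemma mulr_expRN_le1 (q : R) : 0 <= q -> q * expR (- q) <= 1.
Proof.
move=> q0; rewrite expRN ler_pdivrMr ?expR_gt0// mul1r.
by apply: le_trans (expR_ge1Dx q); rewrite lerDr.
Qed.

Section gk_bounds.
Variables (c A r y : R).
Hypotheses (c0 : 0 <= c) (A0 : 0 < A) (r01 : 0 <= r <= 1).
Let r0 : 0 <= r. Proof. by case/andP : r01. Qed.
Let r1 : r <= 1. Proof. by case/andP : r01. Qed.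
Let q t := r * t - y.
Let E t := expR (- (A * q t ^+ 2)).
Let E0 t : 0 <= E t. Proof. exact: expR_ge0. Qed.
Let E1 t : E t <= 1.
Proof. by rewrite -expR0 ler_expR oppr_le0 mulr_ge0 ?sqr_ge0// ltW. Qed.
Let qE t : A * q t ^+ 2 * E t <= 1.
Proof. by apply: mulr_expRN_le1; rewrite mulr_ge0 ?sqr_ge0// ltW. Qed.
Let normqE t : 2 * A * `|q t| * E t <= A + 1.
Proof.
have h := qE t; have h1 := E1 t; have h0 := E0 t.
apply: (@le_trans _ _ (A * (1 + q t ^+ 2) * E t)).
  rewrite ler_wpM2r// mulrAC (mulrC _ A) ler_pM2l//.
  have := sqr_ge0 (`|q t| - 1); rewrite sqrrB1 real_normK ?num_real//; lra.
by rewrite mulrDr mulr1 mulrDl lerD// ler_piMr// ltW.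
Qed.

Lemma gk_ge0 t : 0 <= gk c A r y t.
Proof. by rewrite mulr_ge0 ?expR_ge0. Qed.

Lemma gk_le t : gk c A r y t <= c.
Proof. by rewrite ler_piMr//; exact: E1. Qed.

Lemma normr_dgk t : `|dgk c A r y t| <= c * (A + 1).
Proof.
rewrite /dgk /gk -/(q t) -/(E t).
rewrite (_ : - _ * _ = - (c * r * (2 * A * q t * E t))); last by ring.
rewrite normrN normrM (@ger0_norm _ (c * r)) ?mulr_ge0//. rewrite -(mulrA c) ler_wpM2l//.
apply: (@le_trans _ _ `|2 * A * q t * E t|); first by rewrite ler_piMl.
rewrite !normrM (ger0_norm (E0 t)) (@ger0_norm _ 2)// (gtr0_norm A0).
exact: normqE.
Qed.

Lemma normr_ddgk t : `|ddgk c A r y t| <= c * (6 * A).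
Proof.
rewrite /ddgk /gk -/(q t) -/(E t).
rewrite (_ : _ * _ = c * (r ^+ 2 * (A * (4 * (A * q t ^+ 2 * E t) - 2 * E t)))); last by ring.
rewrite normrM (ger0_norm c0) ler_wpM2l// normrM ger0_norm ?sqr_ge0//.
have rr : r ^+ 2 <= 1 by rewrite exprn_ile1.
apply: (@le_trans _ _ `|A * (4 * (A * q t ^+ 2 * E t) - 2 * E t)|).
  by rewrite ler_piMl.
rewrite normrM gtr0_norm// mulrC ler_pM2r//.
have h : 0 <= A * q t ^+ 2 * E t by rewrite mulr_ge0 ?E0// mulr_ge0 ?sqr_ge0// ltW.
have h1 := qE t; have h2 := E1 t; have h3 := E0 t.
move: h h1 h2 h3; move: (A * q t ^+ 2 * E t) (E t) => w e h h1 h2 h3.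
by rewrite ler_norml; apply/andP; split; lra.
Qed.

(** Writing r t = (r t - y) + y turns the unbounded factor t into powers of r t - y, which the
    Gaussian absorbs; there is no division by [r]. *)
Lemma normr_id_dgk t : `|t * dgk c A r y t| <= c * (2 + `|y| * (A + 1)).
Proof.
rewrite /dgk /gk -/(q t) -/(E t).
rewrite (_ : t * _ = - (c * (2 * (A * q t ^+ 2 * E t) + y * (2 * A * q t * E t)))); last first.
  by rewrite /q; ring.
rewrite normrN normrM (ger0_norm c0) ler_wpM2l//.
have h : 0 <= A * q t ^+ 2 * E t by rewrite mulr_ge0 ?E0// mulr_ge0 ?sqr_ge0// ltW.
apply: (le_trans (ler_normD _ _)); apply: lerD.
  by rewrite normrM (ger0_norm h) ger0_norm// -[leRHS]mulr1 ler_wpM2l.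
rewrite normrM ler_wpM2l//.
rewrite !normrM (ger0_norm (E0 t)) (@ger0_norm _ 2)// (gtr0_norm A0).
exact: normqE.
Qed.

End gk_bounds.

Definition ou_sigma u : R := 1 - expR (- u) ^+ 2.
Definition ou_norm u : R := (Num.sqrt (2 * pi * ou_sigma u))^-1.
Definition ou_rate u : R := (2 * ou_sigma u)^-1.

Lemma ou_sigma_gt0 u : 0 < u -> 0 < ou_sigma u.
Proof.
by move=> u0; rewrite subr_gt0 exprn_ilt1 ?expR_ge0// -expR0 ltr_expR oppr_lt0.
Qed.

Lemma is_derive_ou_sigma u : is_derive u (1 : R) ou_sigma (2 * expR (- u) ^+ 2).
Proof. rewrite /ou_sigma; apply: is_derive_eq; rewrite /GRing.scale /=; ring. Qed.

Lemma is_derive_ou_norm u : 0 < u ->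
  is_derive u (1 : R) ou_norm (- (expR (- u) ^+ 2 / ou_sigma u) * ou_norm u).
Proof.
move=> u0; have s0 := ou_sigma_gt0 u0; have h := is_derive_ou_sigma u.
have p0 : 0 < 2 * pi * ou_sigma u by rewrite !mulr_gt0// pi_gt0.
have h1 : is_derive u (1 : R) (fun u => 2 * pi * ou_sigma u) (2 * pi * (2 * expR (- u) ^+ 2)).
  by apply: is_derive_eq; rewrite /GRing.scale /=; ring.
have h2 := @is_derive1_comp R Num.sqrt (fun u => 2 * pi * ou_sigma u) u _ _
  (is_derive1_sqrt p0) h1.
have sq0 : (Num.sqrt \o (fun u => 2 * pi * ou_sigma u)) u != 0.
  by rewrite /= gt_eqF// sqrtr_gt0.
have h3 := is_deriveV sq0 h2; apply: is_derive_eq h3 _.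
rewrite /= /ou_norm /GRing.scale /=.
rewrite /= in sq0; set S := Num.sqrt _ in sq0 *.
(* Expressing the variance through the square root S makes the identity rational in S. *)
have sE : ou_sigma u = S ^+ 2 / (2 * pi).
  by rewrite sqr_sqrtr ?ltW// mulrC mulKf// gt_eqF// mulr_gt0// pi_gt0.
rewrite [in RHS]sE.
have : (pi : R) != 0 by rewrite gt_eqF// pi_gt0.
clearbody S; move: (pi : R) => p p_neq0; field.
by rewrite sq0.
Qed.

(* ou1 u y t is the density at y of the Gaussian law with mean e^-u t and
   variance 1 - e^-2u; ou1_gen is both its u-derivative and minus the
   one-dimensional Ornstein-Uhlenbeck operator applied to it in t. *)
Definition ou1 u y t := gk (ou_norm u) (ou_rate u) (expR (- u)) y t.
Definition ou1_gen u y t := ddgk (ou_norm u) (ou_rate u) (expR (- u)) y t -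
  t * dgk (ou_norm u) (ou_rate u) (expR (- u)) y t.

Lemma is_derive_ou1 u y t : 0 < u ->
  is_derive u (1 : R) (fun u => ou1 u y t) (ou1_gen u y t).
Proof.
move=> u0; have s0 := ou_sigma_gt0 u0; have h := is_derive_ou_sigma u.
have h1 := is_derive_ou_norm u0.
have s2 : 2 * ou_sigma u != 0 by rewrite gt_eqF// mulr_gt0.
have h2 : is_derive u (1 : R) (fun u => 2 * ou_sigma u) (2 * (2 * expR (- u) ^+ 2)).
  by apply: is_derive_eq; rewrite /GRing.scale /=; ring.
have h3 : is_derive u (1 : R) ou_rate _ :=
  @is_deriveV R (fun u => 2 * ou_sigma u) u _ 1 s2 h2.
rewrite /ou1 /gk; apply: is_derive_eq; rewrite /GRing.scale /=.
rewrite /ou1_gen /ddgk /dgk /gk /ou_rate; field.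
by rewrite gt_eqF.
Qed.

(** The variance increases with u, so for u >= tau the amplitude and the rate are largest at tau,
    while the contraction e^-u stays below 1. *)
Lemma ou1_bounds tau y : 0 < tau -> exists B, [/\ 1 <= B,
  forall u t, tau <= u -> 0 <= ou1 u y t <= B &
  forall u t, tau <= u -> `|ou1_gen u y t| <= B].
Proof.
move=> t0; have s0 := ou_sigma_gt0 t0.
have sle u : tau <= u -> ou_sigma tau <= ou_sigma u.
  move=> tu; rewrite lerD2l lerN2 ler_pXn2r// ?nnegrE ?expR_ge0//.
  by rewrite ler_expR lerN2.
have p0 : 0 < 2 * (pi : R) by rewrite mulr_gt0// pi_gt0.
have cle u : tau <= u -> 0 <= ou_norm u <= ou_norm tau.
  move=> tu; have su := lt_le_trans s0 (sle _ tu).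
  rewrite invr_ge0 sqrtr_ge0 /= lef_pV2 ?posrE ?sqrtr_gt0 ?(mulr_gt0 p0)//.
  by rewrite ler_sqrt ?ler_pM2l ?sle// ltW// mulr_gt0.
have Ale u : tau <= u -> 0 < ou_rate u <= ou_rate tau.
  move=> tu; have su := lt_le_trans s0 (sle _ tu).
  by rewrite invr_gt0 mulr_gt0//= lef_pV2 ?posrE ?mulr_gt0// ler_pM2l// sle.
have r01 u : tau <= u -> 0 <= expR (- u) <= 1.
  move=> tu; rewrite expR_ge0 /= -expR0 ler_expR oppr_le0.
  by rewrite (le_trans (ltW t0)).
have c0 := cle _ (lexx tau); have A0 := Ale _ (lexx tau).
pose c := ou_norm tau; pose A := ou_rate tau.
have [cp _] := andP c0; have [Ap _] := andP A0.
pose B2 := c * (6 * A) + c * (2 + `|y| * (A + 1)).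
have B20 : 0 <= B2.
  rewrite addr_ge0// mulr_ge0// ?mulr_ge0 ?(ltW Ap)//.
  by rewrite addr_ge0// mulr_ge0// addr_ge0// ltW.
exists (1 + c + B2); split.
- by rewrite -addrA lerDl addr_ge0.
- move=> u t tu; have /andP[cu cu'] := cle _ tu; have /andP[Au Au'] := Ale _ tu.
  rewrite gk_ge0//=; apply: (le_trans (gk_le _ _ cu Au _)).
  by apply: (le_trans cu'); rewrite -/c; lra.
- move=> u t tu; have /andP[cu cu'] := cle _ tu; have /andP[Au Au'] := Ale _ tu.
  have ru := r01 _ tu.
  apply: (@le_trans _ _ B2); last by rewrite lerDr addr_ge0.
  apply: (le_trans (ler_normB _ _)); apply: lerD.
    apply: (le_trans (normr_ddgk _ cu Au ru _)).
    by apply: ler_pM => //; [rewrite mulr_ge0// ltW|rewrite ler_pM2l].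
apply: (le_trans (normr_id_dgk _ _ cu Au _)).
  apply: ler_pM => //; first by rewrite addr_ge0// mulr_ge0// addr_ge0// ltW.
  by rewrite lerD2l ler_wpM2l// lerD2r.
Qed.

End calculus.

(** * Products of one-variable functions *)

Section prodf.
Context (R : realType) (n : nat).
Implicit Types (P Q : 'I_n -> R -> R) (x : 'rV[R]_n).

Definition prodf P x : R := \prod_i P i (x ord0 i).

(** Replacing one factor keeps the class of products closed under partial derivatives. *)
Definition upd P (i : 'I_n) (g : R -> R) : 'I_n -> R -> R :=
  fun j => if j == i then g else P j.

Lemma prodf_upd P i g x :
  prodf (upd P i g) x = g (x ord0 i) * \prod_(j | j != i) P j (x ord0 j).
Proof.
rewrite /prodf (bigD1 i)//= /upd eqxx; congr (_ * _).
by apply: eq_bigr => j /negbTE ->.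
Qed.

Lemma prodfD1 P i x : prodf P x = P i (x ord0 i) * \prod_(j | j != i) P j (x ord0 j).
Proof. by rewrite /prodf (bigD1 i). Qed.

Lemma continuous_prodf P : (forall i, continuous (P i)) -> continuous (prodf P).
Proof.
move=> cP; apply: continuous_big => [|i _].
  exact: mul_continuous.
move=> x; apply: (@continuous_comp _ _ _ (fun x : 'rV[R]_n => x ord0 i) (P i)).
  exact: coord_continuous.
exact: cP.
Qed.

Lemma is_derive_prodf P i g x : is_derive (x ord0 i) (1 : R) (P i) (g (x ord0 i)) ->
  is_derive x (delta_mx ord0 i) (prodf P) (prodf (upd P i g) x).
Proof.
move=> dP; apply: cvg_is_derive; rewrite prodf_upd.
have h := cvgM (is_derive_cvg dP) (cvg_cst (\prod_(j | j != i) P j (x ord0 j))).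
apply: (cvg_trans _ (h _ _)); apply: near_eq_cvg; near=> k.
rewrite !(prodfD1 _ i).
rewrite (_ : \prod_(j | j != i) P j ((k *: delta_mx ord0 i + x) ord0 j) =
    \prod_(j | j != i) P j (x ord0 j)); last first.
  by apply: eq_bigr => j ji; rewrite !mxE eqxx (negbTE ji) mulr0 add0r.
rewrite !mxE !eqxx /= mulr1.
by rewrite -mulrBl mulrA [_ *: _]mulr1.
Unshelve. all: by end_near. Qed.

Lemma partial_prodf P i g : (forall t, is_derive t (1 : R) (P i) (g t)) ->
  partial i (prodf P) = prodf (upd P i g).
Proof.
move=> dP; apply/funext => x; rewrite /partial.
by have [] := is_derive_prodf (dP (x ord0 i)).
Qed.

Lemma C1_prodf P Q : (forall i, continuous (P i)) -> (forall i, continuous (Q i)) ->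
  (forall i t, is_derive t (1 : R) (P i) (Q i t)) -> C1 (prodf P).
Proof.
move=> cP cQ dP; split; first exact: continuous_prodf.
move=> i; split; first by move=> x; have [] := is_derive_prodf (dP i (x ord0 i)).
rewrite (partial_prodf (dP i)); apply: continuous_prodf => j.
by rewrite /upd; case: ifP.
Qed.

Section C2.
Variables (P dP ddP : 'I_n -> R -> R).
Hypothesis dPE : forall i t, is_derive t (1 : R) (P i) (dP i t).
Hypothesis ddPE : forall i t, is_derive t (1 : R) (dP i) (ddP i t).
Hypothesis cddP : forall i, continuous (ddP i).

Let cP i : continuous (P i).
Proof. by move=> t; exact: is_derive_continuous (dPE i t). Qed.

Let cdP i : continuous (dP i).
Proof. by move=> t; exact: is_derive_continuous (ddPE i t). Qed.

Lemma C2_prodf : C2 (prodf P).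
Proof.
split; first exact: C1_prodf.
move=> i; rewrite (partial_prodf (dPE i)).
apply: (@C1_prodf _ (upd dP i (ddP i))) => j; rewrite /upd; case: ifP => // /eqP ->.
Qed.

(** The operator is a sum of one-dimensional operators, each acting on a single factor. *)
Lemma OUr_prodf x : OUr (prodf P) x =
  \sum_i prodf (upd P i (fun t => - ddP i t + t * dP i t)) x.
Proof.
rewrite /OUr -sumrN -big_split; apply: eq_bigr => i _ /=.
have E : partial i (prodf (upd P i (dP i))) =
    prodf (upd (upd P i (dP i)) i (ddP i)).
  by apply: partial_prodf => t; rewrite /upd eqxx; exact: ddPE.
rewrite (partial_prodf (dPE i)) E.
rewrite !prodf_upd mulrDl mulNr mulrA; congr (- (_ * _) + _).
by apply: eq_bigr => j /negbTE ji; rewrite /upd ji.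
Qed.

End C2.

Lemma C1_cst0 : C1 (fun _ : 'rV[R]_n => 0 : R).
Proof.
split; first exact: cst_continuous.
have E i : partial i (fun _ : 'rV[R]_n => 0 : R) = fun=> 0.
  by apply/funext => x; rewrite /partial derive_cst.
move=> i; split; first by move=> x; exact: derivable_cst.
by rewrite E; exact: cst_continuous.
Qed.

Lemma C2_cst0 : C2 (fun _ : 'rV[R]_n => 0 : R).
Proof.
split; first exact: C1_cst0.
move=> i; rewrite (_ : partial i _ = fun=> 0); first exact: C1_cst0.
by apply/funext => x; rewrite /partial derive_cst.
Qed.

(** The points where [g] is nonzero lie in a closed cube, which is compact and contains their
    closure. *)
Lemma C2c_real (g : 'rV[R]_n -> R) (M : R) : C2 g ->
  (forall x i, M < `|x ord0 i| -> g x = 0) -> C2c (fun x => (g x)%:C%C).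
Proof.
move=> g2 gM; split; [exact: g2|exact: C2_cst0|].
pose K := [set x : 'rV[R]_n | forall i, `[- M, M]%classic (x ord0 i)].
have cK : compact K by apply: (@rV_compact R n (fun=> `[- M, M]%classic)) => i; exact: segment_compact.
apply: (subclosed_compact _ cK); first exact: closed_closure.
have clK : closed K by apply: compact_closed => //; exact: norm_hausdorff.
rewrite [X in _ `<=` X](closure_id K).1//; apply: closure_subset => x /= gx i.
rewrite /= in_itv /= -ler_norml leNgt; apply/negP => /gM g0.
by move: gx; rewrite g0 eqxx.
Qed.

End prodf.

(** * Cutoffs of a one-dimensional density, with uniform bounds *)

Section cutoff_product.
Context (R : realType).
Variables (p dp ddp : R -> R) (B : R).
Hypothesis dpE : forall t, is_derive t (1 : R) p (dp t).
Hypothesis ddpE : forall t, is_derive t (1 : R) dp (ddp t).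
Hypothesis cddp : continuous ddp.
Hypothesis pB : forall t, `|p t| <= B.
Hypothesis dpB : forall t, `|dp t| <= B.
Hypothesis genB : forall t, `|- ddp t + t * dp t| <= B.
Implicit Types a t : R.

Definition cp a t := cut a t * p t.
Definition dcp a t := dcut a t * p t + cut a t * dp t.
Definition ddcp a t := ddcut a t * p t + 2 * dcut a t * dp t + cut a t * ddp t.
Definition gencp a t := - ddcp a t + t * dcp a t.

Lemma is_derive_cp a t : is_derive t (1 : R) (cp a) (dcp a t).
Proof.
have h := is_derive_cut a t.
rewrite /cp; apply: is_derive_eq; rewrite /GRing.scale /= /dcp; ring.
Qed.

Lemma is_derive_dcp a t : is_derive t (1 : R) (dcp a) (ddcp a t).
Proof.
have h := is_derive_cut a t; have h' := is_derive_dcut a t.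
rewrite /dcp; apply: is_derive_eq; rewrite /GRing.scale /= /ddcp; ring.
Qed.

Lemma continuous_ddcp a : continuous (ddcp a).
Proof.
have c1 : continuous (cut a) by move=> t; exact: is_derive_continuous (is_derive_cut a t).
have c2 : continuous (dcut a) by move=> t; exact: is_derive_continuous (is_derive_dcut a t).
have c3 : continuous p by move=> t; exact: is_derive_continuous (dpE t).
have c4 : continuous dp by move=> t; exact: is_derive_continuous (ddpE t).
move=> t; apply: cvgD; last by apply: cvgM; [exact: c1|exact: cddp].
apply: cvgD; first by apply: cvgM; [exact: continuous_ddcut|exact: c3].
by apply: cvgM; [apply: cvgM; [exact: cvg_cst|exact: c2]|exact: c4].
Qed.

(** Leibniz's rule. In the first term the operator falls on [p]; the others carry derivatives of the
    cutoff and vanish pointwise as [a] tends to 0. *)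
Lemma gencpE a t : gencp a t = cut a t * (- ddp t + t * dp t) - ddcut a t * p t
  - 2 * dcut a t * dp t + t * dcut a t * p t.
Proof. rewrite /gencp /ddcp /dcp; ring. Qed.

Let B0 : 0 <= B. Proof. exact: le_trans (normr_ge0 _) (pB 0). Qed.

Lemma cp_le a t : `|cp a t| <= B.
Proof.
rewrite normrM (ger0_norm (cut_ge0 _ _)).
apply: le_trans (pB t); rewrite ler_piMl//; exact: cut_le1.
Qed.

Lemma gencp_le a t : `|a| <= 1 -> `|gencp a t| <= 49 * B.
Proof.
(* 49 = 1 + 30 + 2 . 6 + 6, one summand for each term of [gencpE]. *)
move=> a1; rewrite gencpE (_ : 49 * B = (B + 30 * B + 2 * 6 * B) + 6 * B); last by ring.
have a2 : a ^+ 2 <= 1 by rewrite -real_normK ?num_real// exprn_ile1.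
apply: (le_trans (ler_normD _ _)); apply: lerD; last first.
  by rewrite normrM ler_pM//; exact: normr_id_dcut.
apply: (le_trans (ler_normB _ _)); apply: lerD; last first.
  rewrite normrM ler_pM// normrM ger0_norm// ler_pM2l//.
  by apply: le_trans (normr_dcut a t) _; rewrite ler_piMr.
apply: (le_trans (ler_normB _ _)); apply: lerD.
  rewrite normrM (ger0_norm (cut_ge0 _ _)).
  apply: le_trans (genB t); rewrite ler_piMl//; exact: cut_le1.
rewrite normrM ler_pM//.
by apply: le_trans (normr_ddcut a t) _; rewrite ler_piMr.
Qed.

Let a_ (N : nat) : R := N.+1%:R^-1.

Let cvg_a : a_ N @[N --> \oo] --> (0 : R).
Proof. exact: cvg_harmonic. Qed.

Let cvg_cut t : cut (a_ N) t @[N --> \oo] --> (1 : R).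
Proof.
have cc : {for 0, continuous (fun a : R => cut a t)}.
  apply: continuous_comp; last exact: continuous_pospow.
  apply: is_derive_continuous; apply: is_derive_eq.
have -> : 1 = cut 0 t by rewrite /cut mul0r expr0n subr0 /pospow max_l// expr1n.
exact: (cvg_comp _ _ cvg_a cc).
Qed.

Let cvg_dcut t : dcut (a_ N) t @[N --> \oo] --> (0 : R).
Proof.
apply: norm_cvg0; apply: (@squeeze_cvgr _ _ _ _ (cst 0) (fun N => 6 * `|a_ N|)).
- by apply: nearW => N; rewrite normr_ge0 normr_dcut.
- exact: cvg_cst.
- rewrite -(mulr0 6); apply: cvgM; first exact: cvg_cst.
  by rewrite -(normr0 R); apply: cvg_norm; exact: cvg_a.
Qed.

Let cvg_ddcut t : ddcut (a_ N) t @[N --> \oo] --> (0 : R).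
Proof.
apply: norm_cvg0; apply: (@squeeze_cvgr _ _ _ _ (cst 0) (fun N => 30 * (a_ N * a_ N))).
- by apply: nearW => N; rewrite normr_ge0 -expr2 normr_ddcut.
- exact: cvg_cst.
- rewrite -(mulr0 30); apply: cvgM; first exact: cvg_cst.
  by rewrite -(mulr0 0); apply: cvgM; exact: cvg_a.
Qed.

Lemma cvg_cp t : cp (a_ N) t @[N --> \oo] --> p t.
Proof. by rewrite -(mul1r (p t)); exact: (cvgM (cvg_cut t) (cvg_cst (p t))). Qed.

Lemma cvg_gencp t : gencp (a_ N) t @[N --> \oo] --> - ddp t + t * dp t.
Proof.
under eq_fun do rewrite gencpE.
have := cvgD (cvgB (cvgB (cvgM (cvg_cut t) (cvg_cst (- ddp t + t * dp t)))
    (cvgM (cvg_ddcut t) (cvg_cst (p t))))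
    (cvgM (cvgM (cvg_cst (2 : R)) (cvg_dcut t)) (cvg_cst (dp t))))
  (cvgM (cvgM (cvg_cst t) (cvg_dcut t)) (cvg_cst (p t))).
by rewrite mul1r !mulr0 !mul0r !subr0 addr0; apply.
Qed.

End cutoff_product.

Section bounded_integrals.
Context d (T : measurableType d) (R : realType) (mu : {measure set T -> \bar R}).

Lemma integrable_boundedM (g h : T -> R) (C : R) :
  mu.-integrable setT (EFin \o g) -> measurable_fun setT h ->
  (forall x, `|h x| <= C) ->
  mu.-integrable setT (EFin \o (fun x => g x * h x)).
Proof.
move=> ig mh hC; have [/measurable_EFinP mg _] := integrableP _ _ _ ig.
have := integrableZl measurableT C ig; apply: le_integrable => //.
  by apply/measurable_EFinP/measurable_funM.
move=> x _ /=; rewrite lee_fin !normrM mulrC ler_wpM2r//.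
by apply: le_trans (hC x) _; exact: ler_norm.
Qed.

(** Dominated convergence with dominating function C |g|. Measurability and boundedness of the limit
    are returned too, so that they need no separate proof for each limit. *)
Lemma Rintegral_bounded_cvg (g : T -> R) (F : nat -> T -> R) (f : T -> R) (C : R) :
  mu.-integrable setT (EFin \o g) -> (forall n, measurable_fun setT (F n)) ->
  (forall n x, `|F n x| <= C) -> (forall x, F n x @[n --> \oo] --> f x) ->
  (measurable_fun setT f /\ forall x, `|f x| <= C) /\
  \int[mu]_x (g x * F n x) @[n --> \oo] --> \int[mu]_x (g x * f x).
Proof.
move=> ig mF FC Ff; have [/measurable_EFinP mg _] := integrableP _ _ _ ig.
have mf : measurable_fun setT f.
  apply/measurable_EFinP; apply: (@emeasurable_fun_cvg _ _ _ _ (fun n x => (F n x)%:E)).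
    by move=> n; exact/measurable_EFinP.
  by move=> x _; apply: cvg_EFin; [exact: nearW|exact: Ff].
have fC x : `|f x| <= C.
  have : `|F n x| @[n --> \oo] --> `|f x| by apply: cvg_norm; exact: Ff.
  move/(cvg_lim (@Rhausdorff R)) => <-; apply: limr_le.
    by apply/cvg_ex; exists `|f x|; apply: cvg_norm; exact: Ff.
  by apply: nearW => n; exact: FC.
split => //.
have igf := integrable_boundedM ig mf fC.
have iC := integrableZl measurableT C ig.
have [] := @dominated_convergence _ _ _ mu setT measurableT
  (fun n x => (g x * F n x)%:E) (fun x => (g x * f x)%:E)
  (fun x => `|C%:E * (g x)%:E|%E).
- by move=> n; apply/measurable_EFinP/measurable_funM.
- by apply/measurable_EFinP/measurable_funM.
- apply: aeW => x _; apply: cvg_EFin; first exact: nearW.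
  by apply: cvgM; [exact: cvg_cst|exact: Ff].
- exact: integrable_abse iC.
- apply: aeW => x n _; rewrite /= lee_fin !normrM mulrC ler_wpM2r//.
  by apply: le_trans (FC n x) _; exact: ler_norm.
move=> _ _; rewrite -(fineK (integrable_fin_num measurableT igf)).
by move/fine_cvgP => [_].
Qed.

End bounded_integrals.

(** * Square-integrable functions for the Gaussian measure *)

Section gaussian_space.
Context (R : realType) (n : nat).
Local Notation gam := (gaussian_measure R n).
Local Notation leb := (lebesgue_rV R n).

Lemma gauss_densityE (x : 'rV[R]_n) : gauss_density x = gauss_const R n * expsq 2^-1 x.
Proof. by rewrite /gauss_density /expsq mulrC (mulrC _ 2^-1) mulrC. Qed.

Lemma integrable_gauss_density : leb.-integrable setT (EFin \o @gauss_density R n).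
Proof.
have h : 0 < 2^-1 :> R by rewrite invr_gt0.
have := integrableZl measurableT (gauss_const R n) (integrable_expsq n h).
by apply: eq_integrable => // x _; rewrite /= gauss_densityE.
Qed.

Lemma gamma_lty : (gam setT < +oo)%E.
Proof.
have [_] := integrableP _ _ _ integrable_gauss_density.
rewrite /gaussian_measure; under eq_integral do rewrite /= ger0_norm ?gauss_density_ge0//.
by [].
Qed.

Lemma integrable_gamma_cst (c : R) : gam.-integrable setT (EFin \o (fun=> c)).
Proof.
apply/integrableP; split; first exact/measurable_EFinP.
rewrite /= integral_cst//; apply: lte_mul_pinfty => //.
exact: gamma_lty.
Qed.

Lemma gammaE (A : set 'rV[R]_n) : measurable A ->
  gam A = (\int[leb]_(x in A) (gauss_density x)%:E)%E.
Proof. by []. Qed.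

Lemma Rintegral_gamma (f : 'rV[R]_n -> R) : measurable_fun setT f ->
  \int[gam]_x f x = \int[leb]_x (f x * gauss_density x).
Proof.
move=> mf; rewrite /Rintegral (@integral_density _ _ _ leb gam (@gauss_density R n))//.
- exact: gauss_density_ge0.
- exact: measurable_gauss_density.
Qed.

Lemma integrable_gamma_leb (f : 'rV[R]_n -> R) : gam.-integrable setT (EFin \o f) ->
  leb.-integrable setT (EFin \o (fun x => f x * gauss_density x)).
Proof.
move=> /integrableP[/measurable_EFinP mf foo]; apply/integrableP; split.
  by apply/measurable_EFinP/measurable_funM => //; exact: measurable_gauss_density.
move: foo; rewrite (@ge0_integral_density _ _ _ leb gam (@gauss_density R n))//.
- suff -> : (\int[leb]_x `|(EFin \o (fun x => f x * gauss_density x)%R) x| =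
      \int[leb]_x (`|(EFin \o f) x| * (gauss_density x)%:E))%E by [].
  by apply: eq_integral => x _; rewrite /= normrM (ger0_norm (gauss_density_ge0 _)).
- exact: gauss_density_ge0.
- exact: measurable_gauss_density.
- by apply: measurableT_comp => //; exact/measurable_EFinP.
Qed.

Implicit Types f g : 'rV[R]_n -> R[i].

Definition rsq f (x : 'rV[R]_n) : R := complex.Re (f x) ^+ 2 + complex.Im (f x) ^+ 2.

Lemma rsq_ge0 f x : 0 <= rsq f x. Proof. by rewrite addr_ge0 ?sqr_ge0. Qed.

Lemma measurable_rsq f : cmeasurable f -> measurable_fun setT (rsq f).
Proof. by move=> [mr mi]; apply: measurable_funD; exact: measurable_funX. Qed.

Lemma L2P f : L2 gam f <-> cmeasurable f /\ gam.-integrable setT (EFin \o rsq f).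
Proof.
split=> -[mf] h; split => //.
  apply/integrableP; split; first by apply/measurable_EFinP; exact: measurable_rsq.
  by under eq_integral do rewrite /= ger0_norm ?rsq_ge0//.
have [_] := integrableP _ _ _ h.
by under eq_integral do rewrite /= ger0_norm ?rsq_ge0//.
Qed.

(** |z| <= e + z^2/e by completing the square. The free parameter lets [pairing_le] do the work of
    the Cauchy-Schwarz inequality. *)
Lemma normr_le_rsq f x e : 0 < e -> `|complex.Re (f x)| <= e + e^-1 * rsq f x /\
  `|complex.Im (f x)| <= e + e^-1 * rsq f x.
Proof.
move=> e0.
have h (z : R) : `|z| <= e + e^-1 * z ^+ 2.
  rewrite -(ler_pM2l e0) mulrDr mulrA mulfV ?gt_eqF// mul1r.
  have := sqr_ge0 (`|z| - e); rewrite sqrrB real_normK ?num_real//.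
  have := normr_ge0 z; nra.
split; apply: le_trans (h _) _; rewrite lerD2l ler_wpM2l ?invr_ge0 ?(ltW e0)//.
  by rewrite lerDl sqr_ge0.
by rewrite lerDr sqr_ge0.
Qed.

Lemma integrable_L2 f : L2 gam f ->
  gam.-integrable setT (EFin \o (fun x => complex.Re (f x))) /\
  gam.-integrable setT (EFin \o (fun x => complex.Im (f x))).
Proof.
move=> /L2P[[mr mi] isq].
have i1 := integrableD measurableT (integrable_gamma_cst 1) isq.
split; apply: le_integrable i1 => //.
- exact/measurable_EFinP.
- move=> x _ /=; rewrite lee_fin [leRHS]ger0_norm ?(addr_ge0 ler01 (rsq_ge0 _ _))//.
  by have [+ _] := normr_le_rsq f x ltr01; rewrite invr1 mul1r.
- exact/measurable_EFinP.
- move=> x _ /=; rewrite lee_fin [leRHS]ger0_norm ?(addr_ge0 ler01 (rsq_ge0 _ _))//.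
  by have [_] := normr_le_rsq f x ltr01; rewrite invr1 mul1r.
Qed.

Lemma integrable_L2_expsq f : L2 gam f ->
  leb.-integrable setT (EFin \o (fun z => expsq 2^-1 z * complex.Re (f z) ^+ 2)) /\
  leb.-integrable setT (EFin \o (fun z => expsq 2^-1 z * complex.Im (f z) ^+ 2)).
Proof.
move=> /L2P[[mr mi] /integrable_gamma_leb isq].
have gc0 := gauss_const_gt0 R n.
have i1 := integrableZl measurableT (gauss_const R n)^-1 isq.
have E x : (gauss_const R n)^-1 * (rsq f x * gauss_density x) = rsq f x * expsq 2^-1 x.
  by rewrite gauss_densityE mulrCA mulKf ?gt_eqF.
have e0 (x : 'rV[R]_n) := expsq_gt0 2^-1 x.
split; apply: le_integrable i1 => //.
- by apply/measurable_EFinP/measurable_funM; [exact: measurable_expsq|exact: measurable_funX].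
- move=> x _ /=; rewrite lee_fin E mulrC !ger0_norm ?(mulr_ge0 (sqr_ge0 _) (ltW (e0 _))) ?(mulr_ge0 (rsq_ge0 _ _) (ltW (e0 _)))//.
  by rewrite ler_wpM2r ?(ltW (e0 _))// lerDl sqr_ge0.
- by apply/measurable_EFinP/measurable_funM; [exact: measurable_expsq|exact: measurable_funX].
- move=> x _ /=; rewrite lee_fin E mulrC !ger0_norm ?(mulr_ge0 (sqr_ge0 _) (ltW (e0 _))) ?(mulr_ge0 (rsq_ge0 _ _) (ltW (e0 _)))//.
  by rewrite ler_wpM2r ?(ltW (e0 _))// lerDr sqr_ge0.
Qed.

End gaussian_space.

(** * The backward equation in weak form *)

Section ou_weak.
Context (R : realType) (n : nat).
Local Notation gam := (gaussian_measure R n).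

Lemma measurable_prodf (P : 'I_n -> R -> R) : (forall i, continuous (P i)) ->
  measurable_fun setT (prodf P).
Proof.
move=> cP; apply: measurable_prod => i _.
apply: (measurableT_comp _ (measurable_rV_coord i)).
by apply: continuous_measurable_fun; exact: cP.
Qed.

Lemma normr_prodf (P : 'I_n -> R -> R) (B : R) x :
  (forall i t, `|P i t| <= B) -> `|prodf P x| <= B ^+ n.
Proof.
move=> PB; rewrite /prodf normr_prod -[in leRHS](card_ord n) -prodr_const.
by apply: ler_prod => i _; rewrite normr_ge0 PB.
Qed.

Lemma cvg_prodf (P : nat -> 'I_n -> R -> R) (Q : 'I_n -> R -> R) x :
  (forall i t, P N i t @[N --> \oo] --> Q i t) ->
  prodf (P N) x @[N --> \oo] --> prodf Q x.
Proof.
move=> PQ; apply: cvg_big => [|i _]; first exact: mul_continuous.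
exact: PQ.
Qed.

Definition ou_factor u (y : 'rV[R]_n) (i : 'I_n) : R -> R := ou1 u (y ord0 i).

Definition ou_pdf u y x : R := prodf (ou_factor u y) x.

(** The derivative of [ou_pdf] in u, and also, by [OUr_prodf], minus the Ornstein-Uhlenbeck operator
    applied to it in x. *)
Definition ou_pdf_deriv u y x : R :=
  \sum_i prodf (upd (ou_factor u y) i (ou1_gen u (y ord0 i))) x.

Section weak.
Variables (L : opgraph 'rV[R]_n R) (hL : OU_realisation L).
Variables (h k : 'rV[R]_n -> R[i]) (Lhk : L h k).

(** Self-adjointness tested against [g], on which [L] is the differential operator. As [g] is real,
    taking real parts of the inner products leaves only the real parts of [h] and [k]. *)
Lemma OU_test (g : 'rV[R]_n -> R) : C2c (fun x => (g x)%:C%C) ->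
  \int[gam]_x (complex.Re (k x) * g x) = \int[gam]_x (complex.Re (h x) * OUr g x).
Proof.
case: hL => LC [_ _ Lad] _ /LC /Lad [_ _ /(_ _ _ Lhk)].
have ReE (f1 f2 : 'rV[R]_n -> R[i]) : complex.Re (inner gam f1 f2) =
    \int[gam]_x (complex.Re (f1 x * conjc (f2 x))) by [].
move=> /(congr1 (@complex.Re R)); rewrite !ReE.
have re0 (z w : R[i]) : complex.Re (z * conjc w) =
    complex.Re z * complex.Re w + complex.Im z * complex.Im w.
  by case: z w => [a b] [c d] /=; rewrite mulrN opprK.
have OU0 x : OUr (fun _ : 'rV[R]_n => 0) x = 0 :> R.
  have E i : partial i (fun _ : 'rV[R]_n => 0 : R) = fun=> 0.
    by apply/funext => z; rewrite /partial derive_cst.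
  rewrite /OUr big1 ?oppr0 ?add0r => [|i _]; last by rewrite !E.
  by rewrite big1// => i _; rewrite E mulr0.
move=> H; transitivity (\int[gam]_x complex.Re (k x * conjc (g x)%:C%C)).
  by apply: eq_Rintegral => x _; rewrite re0 /= mulr0 addr0.
rewrite H; apply: eq_Rintegral => x _; rewrite re0.
by rewrite [complex.Im (OU _ _)]OU0 mulr0 addr0.
Qed.

(** The density is not compactly supported in x, so [OU_test] is applied to its products with
    cutoffs of parameter 1/(N+1) in every coordinate. The operator applied to these stays bounded
    uniformly in N, and [h], [k] are integrable, so both sides converge. *)
Lemma ou_weak u y : 0 < u -> L2 gam h -> L2 gam k ->
  \int[gam]_x (complex.Re (k x) * ou_pdf u y x) =
  - \int[gam]_x (complex.Re (h x) * ou_pdf_deriv u y x).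
Proof.
move=> u0 h2 k2.
have [ih _] := integrable_L2 h2; have [ik _] := integrable_L2 k2.
pose c := ou_norm u; pose A := ou_rate u; pose r := expR (- u).
pose p (i : 'I_n) : R -> R := gk c A r (y ord0 i).
pose dp (i : 'I_n) : R -> R := dgk c A r (y ord0 i).
pose ddp (i : 'I_n) : R -> R := ddgk c A r (y ord0 i).
have c0 : 0 <= c by rewrite invr_ge0 sqrtr_ge0.
have A0 : 0 < A by rewrite invr_gt0 mulr_gt0// ou_sigma_gt0.
have r01 : 0 <= r <= 1 by rewrite expR_ge0 /= -expR0 ler_expR oppr_le0 ltW.
pose Bi i := 1 + c + c * (A + 1) + (c * (6 * A) + c * (2 + `|y ord0 i| * (A + 1))).
pose B := \sum_i Bi i + 1.
have a0 : 0 <= c * (A + 1) by rewrite mulr_ge0// addr_ge0// ltW.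
have a1 : 0 <= c * (6 * A) by rewrite mulr_ge0// mulr_ge0// ltW.
have a2 i : 0 <= c * (2 + `|y ord0 i| * (A + 1)).
  by rewrite mulr_ge0// addr_ge0// mulr_ge0// addr_ge0// ltW.
have Bi0 i : 0 <= Bi i.
  by have := a2 i; rewrite /Bi; move: (c * (2 + _)) => z; lra.
have BiB i : Bi i <= B.
  by rewrite /B (bigD1 i)//= -addrA lerDl addr_ge0// sumr_ge0.
have B1 : 1 <= B by rewrite lerDr sumr_ge0.
have pB i t : `|p i t| <= B.
  rewrite ger0_norm; last exact: gk_ge0.
  apply: (le_trans (gk_le _ _ c0 A0 _)); apply: le_trans (BiB i).
  by have := a2 i; rewrite /Bi; move: (c * (2 + _)) => z; lra.
have dpB i t : `|dp i t| <= B.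
  apply: (le_trans (normr_dgk _ c0 A0 r01 _)); apply: le_trans (BiB i).
  by have := a2 i; rewrite /Bi; move: (c * (2 + _)) => z; lra.
have genB i t : `|- ddp i t + t * dp i t| <= B.
  apply: (@le_trans _ _ (c * (6 * A) + c * (2 + `|y ord0 i| * (A + 1)))).
    apply: (le_trans (ler_normD _ _)); rewrite normrN; apply: lerD.
      exact: normr_ddgk.
    exact: normr_id_dgk.
  by apply: le_trans (BiB i); rewrite /Bi; move: (c * (2 + _)) => z; lra.
pose a_ (N : nat) : R := N.+1%:R^-1.
have a_1 N : `|a_ N| <= 1.
  by rewrite ger0_norm ?invr_ge0// invf_le1// ler1n.
pose P N i := cp (p i) (a_ N); pose dP N i := dcp (p i) (dp i) (a_ N).
pose ddP N i := ddcp (p i) (dp i) (ddp i) (a_ N).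
pose gP N i := gencp (p i) (dp i) (ddp i) (a_ N).
have p1 i t : is_derive t (1 : R) (p i) (dp i t) by exact: is_derive_gk.
have p2 i t : is_derive t (1 : R) (dp i) (ddp i t) by exact: is_derive_dgk.
have p3 i : continuous (ddp i) by exact: continuous_ddgk.
have dPE N i t : is_derive t (1 : R) (P N i) (dP N i t) := is_derive_cp (p1 i) (a_ N) t.
have ddPE N i t : is_derive t (1 : R) (dP N i) (ddP N i t) :=
  is_derive_dcp (p1 i) (p2 i) (a_ N) t.
have cddP N i : continuous (ddP N i) := continuous_ddcp (p1 i) (p2 i) (p3 i) (a := a_ N).
have cP N i : continuous (P N i).
  by move=> t; exact: is_derive_continuous (dPE N i t).
have cgP N i : continuous (gP N i).
  have cd : continuous (dP N i) by move=> t; exact: is_derive_continuous (ddPE N i t).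
  move=> t; apply: cvgD; first by apply: cvgN; exact: cddP.
  by apply: cvgM; [exact: cvg_id|exact: cd].
have C2P N : C2c (fun x => (prodf (P N) x)%:C%C).
  apply: (@C2c_real _ _ _ N.+1%:R); first exact: (@C2_prodf _ _ _ (dP N) (ddP N)).
  move=> x i Mx; rewrite (prodfD1 _ i) /P /cp cut_eq0 ?mul0r//.
  rewrite normrM ger0_norm ?invr_ge0// ler_pdivlMl ?ltr0n// mulr1.
  exact: ltW.
have key N : \int[gam]_x (complex.Re (k x) * prodf (P N) x) =
    \int[gam]_x (complex.Re (h x) * \sum_i prodf (upd (P N) i (gP N i)) x).
  rewrite (OU_test (C2P N)); apply: eq_Rintegral => x _; congr (_ * _).
  exact: (@OUr_prodf _ _ _ (dP N) (ddP N)).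
have [|||_ lim1] := @Rintegral_bounded_cvg _ _ _ gam _ (fun N => prodf (P N))
  (ou_pdf u y) (B ^+ n) ik.
- by move=> N; exact: measurable_prodf.
- by move=> N x; apply: normr_prodf => i t; exact: cp_le.
- by move=> x; apply: cvg_prodf => i t; exact: cvg_cp.
have B49 : B <= 49 * B by lra.
have [|||[mG bG] lim2] := @Rintegral_bounded_cvg _ _ _ gam _
  (fun N x => \sum_i prodf (upd (P N) i (gP N i)) x)
  (fun x => - ou_pdf_deriv u y x) (\sum_(i < n) (49 * B) ^+ n) ih.
- move=> N; apply: measurable_sum => i; apply: measurable_prodf => j.
  by rewrite /upd; case: ifP.
- move=> N x; apply: (le_trans (ler_norm_sum _ _ _)); apply: ler_sum => i _.
  apply: normr_prodf => j t; rewrite /upd; case: ifP => _.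
    exact: gencp_le.
  by apply: le_trans B49; exact: cp_le.
- move=> x; rewrite /ou_pdf_deriv -sumrN; apply: cvg_big => [|i _].
    exact: add_continuous.
  under eq_fun do rewrite prodf_upd; rewrite prodf_upd -mulNr.
  apply: cvgM; last by apply: cvg_big => [|j _]; [exact: mul_continuous|exact: cvg_cp].
  have := @cvg_gencp _ (p i) (dp i) (ddp i) (x ord0 i).
  by rewrite (_ : - ddp i _ + _ = - ou1_gen u (y ord0 i) (x ord0 i))// /ou1_gen opprB addrC.
have E : \int[gam]_x (complex.Re (k x) * ou_pdf u y x) =
    \int[gam]_x (complex.Re (h x) * - ou_pdf_deriv u y x).
  apply: (cvg_unique _ lim1); first exact: Rhausdorff.
  by apply: cvg_trans lim2; apply: near_eq_cvg; apply: nearW => N; rewrite /= key.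
rewrite E -[RHS]mulN1r -RintegralZl//.
  by apply: eq_Rintegral => x _; rewrite mulrN mulN1r.
have iG := integrable_boundedM ih mG bG.
have := integrableZl measurableT (-1) iG; apply: eq_integrable => // x _.
by rewrite /comp -EFinM; congr EFin; ring.
Qed.

End weak.

End ou_weak.

(** For each e, consider the largest s up to which |phi u - phi 0| <= (e/t) u. Left continuity gives
    the bound at the supremum, and the right derivative pushes it further, so the supremum is t;
    then e tends to 0. *)
Lemma right_derivative0_cst (R : realType) (phi : R -> R) (t : R) : 0 < t ->
  (forall s, 0 < s <= t -> phi (s - h) @[h --> 0^'+] --> phi s) ->
  (forall s, 0 <= s < t -> (phi (s + h) - phi s) / h @[h --> 0^'+] --> (0 : R)) ->
  phi t = phi 0.
Proof.
move=> t0 lc rd; apply/eqP; rewrite -subr_eq0 -normr_le0; apply/ler_addgt0Pr => e e0.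
rewrite add0r.
have et0 : 0 < e / t by rewrite divr_gt0.
set d := e / t in et0.
pose A := [set s : R | 0 <= s <= t /\ forall u, 0 <= u <= s -> `|phi u - phi 0| <= d * u].
have A0 : A 0.
  split=> [|u]; first by rewrite lexx ltW.
  by rewrite -eq_le => /eqP <-; rewrite subrr normr0 mulr0.
have hA : has_sup A by split; [exists 0|exists t => s [/andP[]]].
have S0 : 0 <= sup A by apply: ub_le_sup => //; case: hA.
have St : sup A <= t by apply: ge_sup; [exists 0|move=> s [/andP[]]].
have below u : 0 <= u < sup A -> `|phi u - phi 0| <= d * u.
  move=> /andP[u0 uS]; have e1 : 0 < sup A - u by rewrite subr_gt0.
  have [s [_ As] us] := sup_adherent e1 hA.
  by apply: As; rewrite u0 /=; move: us; rewrite opprB addrC subrK => /ltW.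
have AS : `|phi (sup A) - phi 0| <= d * sup A.
  move: S0; rewrite le_eqVlt => /predU1P[<-|S0].
    by rewrite subrr normr0 mulr0.
  have h1 : `|phi (sup A - h) - phi 0| @[h --> 0^'+] --> `|phi (sup A) - phi 0|.
    by apply: cvg_norm; apply: cvgB; [apply: lc; rewrite S0|exact: cvg_cst].
  rewrite -(cvg_lim (@Rhausdorff R) h1); apply: limr_le.
    by apply/cvg_ex; eexists; exact: h1.
  near=> h; have h0 : 0 < h by near: h; exact: nbhs_right_gt.
  have hS : h < sup A by near: h; exact: nbhs_right_lt.
  apply: le_trans (below _ _) _; first by rewrite subr_ge0 (ltW hS) gtrBl.
  by rewrite ler_pM2l// gerBl ltW.
suff -> : t = sup A by apply: le_trans AS _; rewrite /d -mulrA ler_piMr ?(ltW e0)// mulrC ler_pdivrMr// mul1r.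
apply/eqP; rewrite eq_le St andbT leNgt; apply/negP => tS.
have := rd (sup A); rewrite S0 tS => /(_ isT) /cvgrPdist_le /(_ _ et0) [r /= r0 Hr].
(* The extension stays in [0, t] and inside the radius where the difference quotient is at most
   d. *)
pose r' := Num.min (r / 2) (t - sup A).
have r'0 : 0 < r' by rewrite lt_min divr_gt0//= subr_gt0.
suff : A (sup A + r').
  by move/(ub_le_sup (proj2 hA)); rewrite leNgt ltrDl r'0.
split.
  rewrite addr_ge0// ?(ltW r'0)//=.
  by rewrite -lerBrDl ge_min lexx orbT.
move=> u /andP[u0 ur].
have [uS|uS] := leP u (sup A).
  by move: uS; rewrite le_eqVlt => /predU1P[->//|uS]; apply: below; rewrite u0.
pose h := u - sup A.
have h0 : 0 < h by rewrite subr_gt0.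
have uE : u = sup A + h by rewrite /h addrC subrK.
have hr : h < r.
  apply: (@le_lt_trans _ _ r'); first by rewrite lerBlDl.
  rewrite gt_min ltr_pdivrMr// ltr_pMr// ltr1n.
  by [].
have : `|(phi (sup A + h) - phi (sup A)) / h| <= d.
  have := Hr h; rewrite /= sub0r normrN (gtr0_norm h0) => /(_ hr h0).
  by rewrite sub0r normrN.
rewrite normrM normfV (gtr0_norm h0) ler_pdivrMr// -uE => H.
rewrite (_ : phi u - phi 0 = (phi u - phi (sup A)) + (phi (sup A) - phi 0)); last by rewrite addrA subrK.
apply: (le_trans (ler_normD _ _)); rewrite [in leRHS]uE mulrDr addrC.
exact: lerD.
Unshelve. all: by end_near. Qed.

(** * The semigroup paired with the transition density *)

Section L2_algebra.
Context d (T : measurableType d) (R : realType) (mu : {measure set T -> \bar R}).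
Implicit Types f g : T -> R[i].

Lemma cmeasurable_lin (a : R[i]) f g : cmeasurable f -> cmeasurable g ->
  cmeasurable (fun x => a * f x + g x).
Proof.
case: a => a b [fr fi] [gr gi]; split.
- rewrite (_ : (fun x => _) = (fun x => (a * complex.Re (f x) - b * complex.Im (f x)) + complex.Re (g x))).
    by apply: measurable_funD => //; apply: measurable_funB; exact: measurable_funM.
  by apply/funext => x; case: (f x) (g x) => [? ?] [? ?].
- rewrite (_ : (fun x => _) = (fun x => (a * complex.Im (f x) + b * complex.Re (f x)) + complex.Im (g x))).
    by apply: measurable_funD => //; apply: measurable_funD; exact: measurable_funM.
  by apply/funext => x; case: (f x) (g x) => [? ?] [? ?] /=.
Qed.

Lemma measurable_csq f : cmeasurable f ->
  measurable_fun setT (fun x => (complex.Re (f x) ^+ 2 + complex.Im (f x) ^+ 2)%:E).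
Proof.
by move=> [mr mi]; apply/measurable_EFinP; apply: measurable_funD; exact: measurable_funX.
Qed.

Definition csq (z : R[i]) : R := complex.Re z ^+ 2 + complex.Im z ^+ 2.

Lemma csq_ge0 z : 0 <= csq z. Proof. by rewrite addr_ge0 ?sqr_ge0. Qed.

Lemma csqM a z : csq (a * z) = csq a * csq z.
Proof. by case: a z => [a b] [c e]; rewrite /csq /=; ring. Qed.

Lemma csqD a z : csq (a + z) <= 2 * csq a + 2 * csq z.
Proof.
case: a z => [a b] [c e]; rewrite /csq /=.
have := sqr_ge0 (a - c); have := sqr_ge0 (b - e); rewrite !sqrrB !sqrrD; lra.
Qed.

Lemma sqnorm_ge0 f : (0 <= sqnorm mu f)%E.
Proof. by apply: integral_ge0 => x _; rewrite lee_fin csq_ge0. Qed.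

(** The substitute for the triangle inequality at the level of squared norms. *)
Lemma sqnorm_lin (a : R[i]) f g : cmeasurable f -> cmeasurable g ->
  (sqnorm mu (fun x => (a * f x + g x)%R) <=
   (2 * csq a)%:E * sqnorm mu f + 2%:E * sqnorm mu g)%E.
Proof.
move=> mf mg; have mfg := cmeasurable_lin a mf mg.
have c2 : 0 <= 2 * csq a by rewrite mulr_ge0// csq_ge0.
rewrite -!ge0_integralZl ?lee_fin//; [|exact: measurable_csq|
  by move=> x _; rewrite lee_fin csq_ge0|exact: measurable_csq|by move=> x _; rewrite lee_fin csq_ge0].
rewrite -ge0_integralD//; last 4 first.
- by move=> x _; rewrite mule_ge0 ?lee_fin ?csq_ge0.
- by apply: measurable_funeM; exact: measurable_csq.
- by move=> x _; rewrite mule_ge0 ?lee_fin ?csq_ge0.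
- by apply: measurable_funeM; exact: measurable_csq.
apply: ge0_le_integral => //.
- by move=> x _; rewrite lee_fin csq_ge0.
- exact: measurable_csq.
- by apply: emeasurable_funD; apply: measurable_funeM; exact: measurable_csq.
- move=> x _; rewrite -!EFinM -EFinD lee_fin.
  apply: le_trans (csqD _ _) _; rewrite csqM mulrA; exact: lexx.
Qed.

Lemma L2_lin (a : R[i]) f g : L2 mu f -> L2 mu g -> L2 mu (fun x => a * f x + g x).
Proof.
move=> [mf nf] [mg ng]; split; first exact: cmeasurable_lin.
apply: le_lt_trans (sqnorm_lin a mf mg) _; apply: lte_add_pinfty.
  by apply: lte_mul_pinfty => //; rewrite lee_fin mulr_ge0// csq_ge0.
exact: lte_mul_pinfty.
Qed.

Lemma L2_0 : L2 mu (fun=> 0).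
Proof.
split; first by split => /=; exact: measurable_cst.
rewrite /sqnorm /= integral0_eq// => x _.
by rewrite expr0n addr0.
Qed.

Lemma L2_ext f g : f =1 g -> L2 mu f -> L2 mu g.
Proof. by move=> /funext ->. Qed.

Lemma L2B f g : L2 mu f -> L2 mu g -> L2 mu (fun x => f x - g x).
Proof.
move=> hf hg; apply: (@L2_ext (fun x => -1 * g x + f x)).
  by move=> x; rewrite mulN1r addrC.
exact: L2_lin.
Qed.

Lemma L2Z (a : R[i]) f : L2 mu f -> L2 mu (fun x => a * f x).
Proof.
move=> hf; apply: (@L2_ext (fun x => a * f x + 0)); first by move=> x; rewrite addr0.
exact: (L2_lin a hf L2_0).
Qed.

Lemma eqL2_sqnorm f g : cmeasurable f -> cmeasurable g -> eqL2 mu f g ->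
  sqnorm mu f = sqnorm mu g.
Proof.
move=> mf mg fg; apply: ae_eq_integral => //; try exact: measurable_csq.
by apply: filterS fg => x -> _.
Qed.

End L2_algebra.

(** * Locally uniform bounds for the semigroup *)

Section local_bound.
Context d (T : measurableType d) (R : realType) (mu : {measure set T -> \bar R}).
Variable E : R -> (T -> R[i]) -> (T -> R[i]).
Hypothesis C0E : C0_semigroup mu E.
Local Notation L2 := (L2 mu).
Local Notation sqnorm := (sqnorm mu).

(** Squared norms are compared, so [M] bounds the square of the operator norm. *)
Definition opbound (M t : R) := forall f, L2 f -> (sqnorm (E t f) <= M%:E * sqnorm f)%E.

Lemma opboundW M M' t : M <= M' -> opbound M t -> opbound M' t.
Proof.
move=> MM' h f Lf; apply: le_trans (h f Lf) _.
by rewrite lee_wpmul2r ?sqnorm_ge0.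
Qed.

(** An integer bound, so that the sets of times with a given bound form a countable family for
    Baire's theorem. *)
Lemma opbound_ex t : 0 <= t -> exists n : nat, opbound n%:R t.
Proof.
move=> t0; case: C0E => /(_ _ t0)[_ _ _ [M h]] _ _ _.
exists (Num.bound `|M|); apply: opboundW h.
by apply: le_trans (ler_norm _) _; apply/ltW/archi_boundP.
Qed.

Lemma opboundM M M' s t : 0 <= M -> 0 <= s -> 0 <= t ->
  opbound M s -> opbound M' t -> opbound (M * M') (s + t).
Proof.
move=> M0 s0 t0 hs ht f Lf; case: C0E => bE _ /(_ s t f s0 t0 Lf) sg _.
have [L2s _ _ _] := bE _ s0; have [L2t _ _ _] := bE _ t0.
have [L2st _ _ _] := bE _ (addr_ge0 s0 t0).
have Lt := L2t _ Lf.
rewrite (eqL2_sqnorm (proj1 (L2st _ Lf)) (proj1 (L2s _ Lt)) sg).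
apply: le_trans (hs _ Lt) _; rewrite EFinM -muleA.
by apply: lee_wpmul2l; [rewrite lee_fin|exact: ht].
Qed.

Lemma cvge0_near_lt (F : set_system R) (u : R -> \bar R) e : Filter F -> 0 < e ->
  u h @[h --> F] --> 0%E -> \forall h \near F, (u h < e%:E)%E.
Proof.
by move=> FF e0 cv; apply: (cv _ (@nbhs_open_ereal_lt R 0 (fun=> e) e0)).
Qed.

(** By the semigroup law this is strong continuity at 0, applied to E t f. *)
Lemma sqnorm_shift0 t f : 0 <= t -> L2 f ->
  sqnorm (fun x => E (t + h) f x - E t f x)%R @[h --> 0^'+] --> 0%E.
Proof.
move=> t0 Lf; case: C0E => bE _ sg cv.
have [L2t _ _ _] := bE _ t0; have Lt := L2t _ Lf.
apply: cvg_trans (cv _ Lt); apply: near_eq_cvg; near=> h.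
have h0 : 0 < h by near: h; exact: nbhs_right_gt.
have [L2h _ _ _] := bE _ (ltW h0); have [L2th _ _ _] := bE _ (addr_ge0 t0 (ltW h0)).
have sgh := sg h t f (ltW h0) t0 Lf.
apply: eqL2_sqnorm.
- exact: (proj1 (L2B (L2h _ Lt) Lt)).
- exact: (proj1 (L2B (L2th _ Lf) Lt)).
- by rewrite addrC; apply: filterS sgh => x ->.
Unshelve. all: by end_near. Qed.

(* Strong continuity at 0 is the only continuity available: a bound passes to
   limits of times from the right (at the price of a factor 2), which is enough
   for the Baire category argument of opbound_interval. *)
Lemma opbound_right M t : 0 <= M -> 0 <= t ->
  (forall e, 0 < e -> exists2 h, 0 < h < e & opbound M (t + h)) -> opbound (2 * M) t.
Proof.
move=> M0 t0 H f Lf; case: (C0E) => bE _ _ _.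
have [L2t _ _ _] := bE _ t0; have Lt := L2t _ Lf.
have cv := sqnorm_shift0 t0 Lf.
have nf : sqnorm f \is a fin_num by rewrite ge0_fin_numE ?sqnorm_ge0//; case: Lf.
have Mf : (M%:E * sqnorm f)%E \is a fin_num by rewrite fin_numM.
rewrite EFinM -muleA; apply/lee_addgt0Pr => e e0.
have e2 : 0 < e / 2 by rewrite divr_gt0.
have [r /= r0 Hr] := cvge0_near_lt _ e2 cv.
have [h /andP[h0 hr] hb] := H r r0.
have h0' : 0 <= t + h by rewrite addr_ge0// ltW.
have [L2th _ _ _] := bE _ h0'; have Lth := L2th _ Lf.
have := Hr h; rewrite /= sub0r normrN (gtr0_norm h0) => /(_ hr h0) /ltW Hh.
have -> : E t f = (fun x => -1 * (E (t + h) f x - E t f x) + E (t + h) f x).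
  by apply/funext => x; rewrite mulN1r opprB subrK.
apply: le_trans (sqnorm_lin _ _ (proj1 (L2B Lth Lt)) (proj1 Lth)) _.
rewrite addeC; apply: leeD.
  by rewrite lee_wpmul2l// ; exact: hb.
have -> : csq (-1 : R[i]) = 1 by rewrite /csq /= oppr0 expr0n addr0 sqrrN expr1n.
rewrite mulr1 (_ : e%:E = 2%:E * (e / 2)%:E)%E; last by rewrite -EFinM mulrC divfK.
by rewrite lee_wpmul2l.
Qed.

(** The sets [B m] cover ]0, e[, so by Baire some closure contains an open set. Every time in that
    open set is a limit from the right of times in [B m], and [opbound_right] transfers the
    bound. *)
Lemma opbound_interval e : 0 < e -> exists M a b,
  [/\ 0 <= M, 0 < a < b, b < e & forall t, a < t < b -> opbound M t].
Proof.
move=> e0; pose B (m : nat) : set R := [set t | 0 < t < e /\ opbound m%:R t].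
have [m nd] : exists m, ~ dense (~` closure (B m)).
  apply/not_existsP => H.
  have : dense (\bigcap_m ~` closure (B m)).
    apply: (@Baire R R) => m; split; first exact/closed_openC/closed_closure.
    by apply: contrapT => nd; exact: (H m nd).
  move=> /(_ `]0, e[%classic) [||t [/= t0e tB]].
  - by exists (e / 2); rewrite /= in_itv /=; apply/andP; split; lra.
  - exact: interval_open.
  - move: t0e; rewrite in_itv /=.
    move=> t0e; have [t0 _] := andP t0e; have [m hm] := opbound_ex (ltW t0).
    by apply: (tB m) => //; apply: subset_closure.
have [W [W0 [oW Odis]]] : exists W : set R, W !=set0 /\ open W /\ W `&` ~` closure (B m) = set0.
  move: nd; rewrite /dense => /existsNP[W /not_implyP[W0 /not_implyP[oW]]].
  by move/set0P/negP; rewrite negbK => /eqP OO; exists W.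
have OB : W `<=` closure (B m).
  by move=> x Ox; apply: contrapT => nx; have : (W `&` ~` closure (B m)) x by []; rewrite Odis.
have [x Ox] := W0; have : nbhs x W by exact: open_nbhs_nbhs.
move=> /(OB x Ox) [z [[/andP[z0 ze] _] zW]].
have : nbhs z (W `&` `]0, e[%classic).
  by apply: filterI; [exact: open_nbhs_nbhs|apply: near_in_itvoo; rewrite in_itv /= z0].
move=> /nbhs_ballP [r /= r0 Hr].
have inO t : `|z - t| < r -> W t /\ 0 < t < e.
  by move=> tr; have [|Ot] := Hr t; [exact: tr|rewrite /= in_itv /=].
exists (2 * m%:R), z, (z + r / 2); split.
- by rewrite mulr_ge0.
- by rewrite z0 ltrDl divr_gt0.
- have [|_ /andP[]//] := inO (z + r / 2).
  by rewrite opprD addrA subrr sub0r normrN gtr0_norm ?divr_gt0// ltr_pdivrMr// ltr_pMr// ltr1n.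
- move=> t /andP[zt tzr]; have t0 : 0 < t by exact: lt_trans zt.
  apply: opbound_right => //; first exact: ltW.
  move=> e' e'0; pose e2 := Num.min e' (r / 2).
  have e20 : 0 < e2 by rewrite lt_min e'0 divr_gt0.
  have e2r : e2 <= r / 2 by rewrite ge_min lexx orbT.
  have e2e : e2 <= e' by rewrite ge_min lexx.
  (* [c] lies in the open set just to the right of t; being in the closure of [B m], it has points
     of [B m] near it, hence in ]t, t + e'[. *)
  clearbody e2; pose c := t + e2 / 2.
  have [Wc _] : W c /\ 0 < c < e.
    by apply: inO; rewrite distrC gtr0_norm /c; lra.
  have : nbhs c `]t, (t + e')[%classic.
    by apply: near_in_itvoo; rewrite in_itv /= /c; apply/andP; split; lra.
  move=> /(OB c Wc) [s [[_ hs]]]; rewrite /= in_itv /= => /andP[ts st].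
  exists (s - t); last by rewrite addrC subrK.
  by rewrite subr_gt0 ts /= ltrBlDl.
Qed.

(** Some interval ]a, b[ below t has a uniform bound. With c its midpoint, t - h = (t - c) + (c -
    h): one fixed operator follows operators with times in ]a, b[. *)
Lemma opbound_near t : 0 < t -> exists M r, [/\ 0 <= M, 0 < r &
  forall h, 0 <= h < r -> h < t -> opbound M (t - h)].
Proof.
move=> t0; have [M [a [b [M0 /andP[a0 ab] bt hM]]]] := opbound_interval t0.
pose c := (a + b) / 2.
have ct : 0 <= t - c by rewrite /c; lra.
have [m hm] := opbound_ex ct.
exists (m%:R * M), ((b - a) / 2); split.
- exact: mulr_ge0.
- by rewrite divr_gt0// subr_gt0.
- move=> h /andP[h0 hr] ht.
  rewrite (_ : t - h = (t - c) + (c - h)); last by ring.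
  apply: opboundM => //; first by rewrite /c; lra.
  by apply: hM; rewrite /c; apply/andP; split; lra.
Qed.

End local_bound.

(** * Time regularity of the transition density *)

Section ou_pdf_time.
Context (R : realType).

Lemma is_derive_prod_ord (n : nat) (F dF : 'I_n -> R -> R) (u : R) :
  (forall i, is_derive u (1 : R) (F i) (dF i u)) ->
  is_derive u (1 : R) (fun u => \prod_i F i u)
    (\sum_i \prod_j (if j == i then dF i u else F j u)).
Proof.
elim: n F dF => [|n IH] F dF dFE.
  rewrite big_ord0; under eq_fun do rewrite big_ord0.
  exact: is_derive_cst.
under eq_fun do rewrite big_ord_recl.
have h0 := dFE ord0.
have h1 := IH (fun i => F (lift ord0 i)) (fun i => dF (lift ord0 i))
  (fun i => dFE (lift ord0 i)).
have h2 := is_deriveM h0 h1.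
apply: is_derive_eq h2 _; rewrite big_ord_recl /GRing.scale /= addrC; congr (_ + _).
  rewrite big_ord_recl eqxx mulrC; congr (_ * _).
rewrite mulr_sumr; apply: eq_bigr => i _; rewrite big_ord_recl /=; congr (_ * _).
Qed.

Context (n : nat).
Implicit Types x y : 'rV[R]_n.

Lemma is_derive_ou_pdf (u : R) y x : 0 < u ->
  is_derive u (1 : R) (fun u => ou_pdf u y x) (ou_pdf_deriv u y x).
Proof.
move=> u0; have h (i : 'I_n) := is_derive_ou1 (y ord0 i) (x ord0 i) u0.
have := @is_derive_prod_ord n (fun i u => ou1 u (y ord0 i) (x ord0 i))
  (fun i u => ou1_gen u (y ord0 i) (x ord0 i)) u h.
move=> H; apply: is_derive_eq H _.
apply: eq_bigr => i _; apply: eq_bigr => j _; rewrite /upd.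
by case: eqP => [->|].
Qed.

Lemma ou_pdf_bounds (tau : R) y : 0 < tau -> exists C : R, [/\ 0 <= C,
  forall u x, tau <= u -> `|ou_pdf u y x| <= C &
  forall u x, tau <= u -> `|ou_pdf_deriv u y x| <= C].
Proof.
move=> t0; have /choice [B HB] (i : 'I_n) : exists B, [/\ 1 <= B,
  forall u t, tau <= u -> 0 <= ou1 u (y ord0 i) t <= B &
  forall u t, tau <= u -> `|ou1_gen u (y ord0 i) t| <= B] := ou1_bounds _ t0.
have Bi i : B i <= \sum_j B j.
  rewrite (bigD1 i)//= lerDl sumr_ge0// => j _; have [? _ _] := HB j; lra.
(* The sum dominates each [B j] because all of them are at least 1, hence nonnegative. *)
pose M := \sum_j B j.
have f1 u : tau <= u -> forall i t, `|ou_factor u y i t| <= M.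
  move=> tu i t; have [_ h _] := HB i; have /andP[p0 p1] := h u t tu.
  by rewrite ger0_norm//; apply: le_trans (Bi i).
have g1 u : tau <= u -> forall i t, `|ou1_gen u (y ord0 i) t| <= M.
  move=> tu i t; have [_ _ h] := HB i.
  by apply: le_trans (h u t tu) (Bi i).
have M0 : 0 <= M by apply: sumr_ge0 => j _; have [? _ _] := HB j; lra.
exists (M ^+ n + \sum_(i < n) M ^+ n); split.
- by rewrite addr_ge0 ?sumr_ge0// => *; rewrite exprn_ge0.
- move=> u x tu; apply: (@le_trans _ _ (M ^+ n)); first exact: normr_prodf (f1 _ tu).
  by rewrite lerDl sumr_ge0// => *; rewrite exprn_ge0.
- move=> u x tu; apply: (@le_trans _ _ (\sum_(i < n) M ^+ n)); last first.
    by rewrite lerDr exprn_ge0.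
  apply: (le_trans (ler_norm_sum _ _ _)); apply: ler_sum => i _.
  apply: normr_prodf => j t; rewrite /upd; case: ifP => _; last exact: f1.
  exact: g1.
Qed.

(** The mean value theorem; the Lipschitz bound dominates the difference quotients in time. *)
Lemma ou_pdf_lipschitz (tau : R) y : 0 < tau -> exists C : R, [/\ 0 <= C,
  forall u x, tau <= u -> `|ou_pdf u y x| <= C,
  forall u x, tau <= u -> `|ou_pdf_deriv u y x| <= C &
  forall u v x, tau <= u -> u <= v -> `|ou_pdf v y x - ou_pdf u y x| <= C * (v - u)].
Proof.
move=> t0; have [C [C0 h1 h2]] := ou_pdf_bounds y t0.
exists C; split=> // u v x tu uv.
have der z : u <= z -> is_derive z (1 : R) (fun u => ou_pdf u y x) (ou_pdf_deriv z y x).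
  by move=> uz; apply: is_derive_ou_pdf; exact: lt_le_trans t0 (le_trans tu uz).
have [||c cuv ->] := @MVT_segment R (fun u => ou_pdf u y x)
  (fun u => ou_pdf_deriv u y x) u v uv.
- by move=> z; rewrite in_itv /= => /andP[/ltW uz _]; exact: der.
- apply: derivable_within_continuous => z; rewrite in_itv /= => /andP[uz _].
  by have [] := der _ uz.
rewrite normrM (@ger0_norm _ (v - u)) ?subr_ge0// ler_wpM2r ?subr_ge0//.
by apply: h2; move: cuv; rewrite in_itv /= => /andP[uc _]; exact: le_trans tu uc.
Qed.

Lemma measurable_ou_pdf u y : measurable_fun setT (ou_pdf u y).
Proof.
apply: measurable_prodf => i t; exact: is_derive_continuous (is_derive_gk _ _ _ _ _).
Qed.

End ou_pdf_time.

Section pairing.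
Context (R : realType) (n : nat).
Local Notation gam := (gaussian_measure R n).
Implicit Types f g : 'rV[R]_n -> R[i].

(** Integrating C (e + |f|^2/e), with squared norm at most e^2, gives C e (gamma(1) + 1). *)
Lemma pairing_le f (v : 'rV[R]_n -> R) (C e : R) : L2 gam f ->
  measurable_fun setT v -> (forall x, `|v x| <= C) -> 0 <= C -> 0 < e ->
  (sqnorm gam f <= (e ^+ 2)%:E)%E ->
  `|\int[gam]_x (complex.Re (f x) * v x)| <= C * e * (fine (gam setT) + 1).
Proof.
move=> Lf mv vC C0 e0 fe.
have [ir _] := integrable_L2 Lf; have iv := integrable_boundedM ir mv vC.
have [_ isq] := (L2P f).1 Lf.
apply: (le_trans (le_normr_Rintegral measurableT iv)).
have ib : gam.-integrable setT (EFin \o (fun x => C * (e + e^-1 * rsq f x))).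
  have i2 := integrableD measurableT (integrable_gamma_cst n e) (integrableZl measurableT e^-1 isq).
  have := integrableZl measurableT C i2; apply: eq_integrable => // x _.
apply: (@le_trans _ _ (\int[gam]_x (C * (e + e^-1 * rsq f x)))).
  apply: le_Rintegral => //.
    by have := integrable_abse iv; apply: eq_integrable.
  move=> x _; rewrite normrM mulrC ler_pM//.
  by have [] := normr_le_rsq f x e0.
have i1 := integrable_gamma_cst n e.
have i2 := integrableZl measurableT e^-1 isq.
have i3 : gam.-integrable setT (EFin \o (fun x => e + e^-1 * rsq f x)).
  exact: (integrableD measurableT i1 i2).
rewrite RintegralZl// -mulrA ler_wpM2l//.
rewrite RintegralD// RintegralZl// Rintegral_cst// mulrDr mulr1 lerD2l.
rewrite ler_pdivrMl// -expr2 -lee_fin /Rintegral fineK; first exact: fe.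
exact: (integrable_fin_num measurableT isq).
Qed.

(** The bounded factor may move with k, as it does when both the orbit and the density depend on the
    time step. *)
Lemma pairing_cvg0 (D : nat -> 'rV[R]_n -> R[i]) (v : nat -> 'rV[R]_n -> R) (C : R) :
  (forall k, L2 gam (D k)) -> (forall k, measurable_fun setT (v k)) ->
  (forall k x, `|v k x| <= C) -> sqnorm gam (D k) @[k --> \oo] --> 0%E ->
  \int[gam]_x (complex.Re (D k x) * v k x) @[k --> \oo] --> (0 : R).
Proof.
move=> LD mv vC D0.
have C0 : 0 <= C := le_trans (normr_ge0 _) (vC 0%N 0).
have m0 : 0 <= fine (gam setT) by rewrite fine_ge0.
apply/cvgrPdist_le => e e0.
(* [C + 1] instead of [C], which may be 0. *)
pose e' := e / ((C + 1) * (fine (gam setT) + 1)).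
have c1 : 0 < (C + 1) * (fine (gam setT) + 1) by rewrite mulr_gt0//; lra.
have e'0 : 0 < e' by rewrite divr_gt0.
have : nbhs 0%E [set z | z < (e' ^+ 2)%:E]%E.
  by apply: (@nbhs_open_ereal_lt R 0 (fun=> e' ^+ 2)); rewrite exprn_gt0.
move=> /D0 /= near_lt; near=> k.
rewrite sub0r normrN.
apply: (@le_trans _ _ (C * e' * (fine (gam setT) + 1))).
  apply: pairing_le => //; apply/ltW; near: k; exact: near_lt.
rewrite mulrAC /e' mulrA ler_pdivrMr// mulrC ler_wpM2l ?(ltW e0)//.
by rewrite ler_wpM2r//; lra.
Unshelve. all: by end_near. Qed.

End pairing.

(** Reduces right limits to sequences in ]0, r[, to which dominated convergence applies; a general
    sequence is truncated at r/2, which it eventually stays below. *)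
Lemma cvg_at_right0_seq (R : realType) (f : R -> R) (l r : R) : 0 < r ->
  (forall u : nat -> R, (forall k, 0 < u k < r) -> u k @[k --> \oo] --> 0 ->
    f (u k) @[k --> \oo] --> l) ->
  f h @[h --> 0^'+] --> l.
Proof.
move=> r0 H; apply/cvg_at_rightP => u [u0 cu].
have r2 : 0 < r / 2 by rewrite divr_gt0.
have near_u : \forall k \near \oo, u k < r / 2 by exact: (cvgr_lt _ cu).
have E : \forall k \near \oo, Num.min (u k) (r / 2) = u k.
  by apply: filterS near_u => k uk; rewrite min_l// ltW.
have H1 k : 0 < Num.min (u k) (r / 2) < r.
  by rewrite lt_min u0 r2 /= gt_min orbC ltr_pdivrMr// ltr_pMr// ltr1n.
have H2 : Num.min (u k) (r / 2) @[k --> \oo] --> 0.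
  by apply: cvg_trans cu; apply: near_eq_cvg; apply: filterS E => k ->.
have H3 := H (fun k => Num.min (u k) (r / 2)) H1 H2.
by apply: cvg_trans H3; apply: near_eq_cvg; apply: filterS E => k ->.
Qed.

(** * Constancy of the pairing between orbit and density *)

Section duhamel.
Context (R : realType) (n : nat).
Local Notation gam := (gaussian_measure R n).
Variables (L : opgraph 'rV[R]_n R) (hL : OU_realisation L).
Variable E : R -> ('rV[R]_n -> R[i]) -> ('rV[R]_n -> R[i]).
Hypothesis hE : semigroup_generated_by gam (oppg L) E.
Implicit Types f g : 'rV[R]_n -> R[i].

Let C0E : C0_semigroup gam E := proj1 hE.

Let L2E t f : 0 <= t -> L2 gam f -> L2 gam (E t f).
Proof. by move=> t0; case: C0E => /(_ _ t0)[H _ _ _] _ _ _; exact: H. Qed.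

Let linE t (a : R[i]) f g : 0 <= t -> L2 gam f -> L2 gam g ->
  eqL2 gam (E t (fun x => a * f x + g x)) (fun x => a * E t f x + E t g x).
Proof. by move=> t0; case: C0E => /(_ _ t0)[_ _ H _] _ _ _; exact: H. Qed.

(** The error of the forward difference quotient of the orbit of [f] at time s, with E s g as the
    expected derivative. *)
Definition quotient (s h : R) f g : 'rV[R]_n -> R[i] :=
  fun x => (h^-1)%:C%C * (E (s + h) f x - E s f x) - E s g x.

Lemma L2_quotient s h f g : 0 <= s -> 0 < h -> L2 gam f -> L2 gam g ->
  L2 gam (quotient s h f g).
Proof.
move=> s0 h0 Lf Lg; apply: L2B; last exact: L2E.
by apply/L2Z/L2B; apply: L2E => //; rewrite addr_ge0// ltW.
Qed.

(** Almost everywhere the error at time s is E s applied to the error at time 0, and E s is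
    bounded. *)
Lemma generator_quotient s f g : 0 <= s -> generator gam E f g ->
  sqnorm gam (quotient s h f g) @[h --> 0^'+] --> 0%E.
Proof.
move=> s0 [Lf Lg cv]; have [M hM] := opbound_ex C0E s0.
pose u h : 'rV[R]_n -> R[i] := fun x => (h^-1)%:C%C * (E h f x - f x) - g x.
apply: (@squeeze_cvge _ _ _ _ (cst 0%E) _ (fun h => M%:R%:E * sqnorm gam (u h))%E).
- near=> h; have h0 : 0 < h by near: h; exact: nbhs_right_gt.
  rewrite sqnorm_ge0/=.
  have Lh := L2E (ltW h0) Lf.
  have Lu : L2 gam (u h) by apply: L2B => //; apply/L2Z/L2B.
  have Ls := L2E s0 Lu.
  set a : R[i] := (h^-1)%:C%C.
  (* Linearity has the form a f + g, so u h is built from three nested combinations of that form. *)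
  have L1 : L2 gam (fun x => (- a - 1) * f x + f x) by exact: L2_lin.
  have L3 : L2 gam (fun x => a * E h f x + ((- a - 1) * f x + f x)) by exact: L2_lin.
  have uE : u h = (fun x => -1 * g x + (a * E h f x + ((- a - 1) * f x + f x))).
    by apply/funext => x; rewrite /u -/a; ring.
  have e1 := linE (- a - 1) s0 Lf Lf.
  have e2 := linE a s0 Lh L1.
  have e3 := linE (-1) s0 Lg L3.
  have e4 : eqL2 gam (E (s + h) f) (E s (E h f)).
    by case: C0E => _ _ + _; apply => //; exact: ltW.
  have eq : eqL2 gam (E s (u h)) (quotient s h f g).
    rewrite uE; apply: filterS2 (filterI e1 e2) (filterI e3 e4) => x [q1 q2] [q3 q4].
    by rewrite q3 q2 q1 /quotient q4 -/a; ring.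
  have Lq := L2_quotient s0 h0 Lf Lg.
  by rewrite -(eqL2_sqnorm (proj1 Ls) (proj1 Lq) eq); exact: hM.
- exact: cvg_cst.
- by rewrite -[X in _ --> X](mule0 M%:R%:E); apply: cvgeZl.
Unshelve. all: by end_near. Qed.

(** Invariance of the domain: E (s + h) f is also E h (E s f), so the error of [generator_quotient]
    is the one defining the generator at E s f. *)
Lemma generator_semigroup s f g : 0 <= s -> generator gam E f g ->
  generator gam E (E s f) (E s g).
Proof.
move=> s0 fg; have [Lf Lg _] := fg.
split; [exact: L2E|exact: L2E|].
have := generator_quotient s0 fg; apply: cvg_trans; apply: near_eq_cvg.
near=> h; have h0 : 0 < h by near: h; exact: nbhs_right_gt.
have e4 : eqL2 gam (E (h + s) f) (E h (E s f)).
  by case: C0E => _ _ + _; apply => //; exact: ltW.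
have Ls := L2E s0 Lf; have Lsh := L2E (ltW h0) Ls.
apply: eqL2_sqnorm.
- by have [] := L2_quotient s0 h0 Lf Lg.
- by apply: (proj1 (L2B (L2Z _ (L2B Lsh Ls)) (L2E s0 Lg))).
- by rewrite /quotient (addrC s); apply: filterS e4 => x ->.
Unshelve. all: by end_near. Qed.

Lemma L_generator h k : L h k <-> generator gam E h (fun x => - k x).
Proof.
have [_ gE] := hE; rewrite gE /oppg (_ : (fun x => - - k x) = k)//.
by apply/funext => x; rewrite opprK.
Qed.

Lemma generator_ou_weak f g (u : R) y : 0 < u -> generator gam E f g ->
  \int[gam]_x (complex.Re (g x) * ou_pdf u y x) =
  \int[gam]_x (complex.Re (f x) * ou_pdf_deriv u y x).
Proof.
move=> u0 fg; have [Lf Lg _] := fg.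
have Lfg : L f (fun x => - g x).
  by apply/L_generator; rewrite (_ : (fun x => - - g x) = g)//; apply/funext => x; rewrite opprK.
have LNg : L2 gam (fun x => - g x).
  by apply: L2_ext (L2Z (-1) Lg) => x; rewrite mulN1r.
have := ou_weak hL Lfg y u0 Lf LNg.
have ReN z : complex.Re (- z) = - complex.Re z :> R by case: z.
have [C [_ vC _]] := ou_pdf_bounds y u0.
have [ig _] := integrable_L2 Lg.
have igv := integrable_boundedM ig (measurable_ou_pdf u y) (fun x => vC u x (lexx u)).
have -> : \int[gam]_x (complex.Re (- g x) * ou_pdf u y x) =
    - \int[gam]_x (complex.Re (g x) * ou_pdf u y x).
  rewrite -[RHS]mulN1r -RintegralZl//; apply: eq_Rintegral => x _.
  by rewrite ReN mulN1r mulNr.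
by move/oppr_inj.
Qed.

Lemma seq_at_right (u : nat -> R) : (forall k, 0 < u k) ->
  u k @[k --> \oo] --> 0 -> u k @[k --> \oo] --> (0 : R)^'+.
Proof.
move=> u0 cu P [r /= r0 Hr]; move/cvgr0_norm_lt : (cu) => /(_ _ r0).
by apply: filterS => k ukr; apply: Hr => //=; rewrite sub0r normrN.
Qed.

Lemma seq_dnbhs (u : nat -> R) : (forall k, u k != 0) ->
  u k @[k --> \oo] --> 0 -> u k @[k --> \oo] --> (0 : R)^'.
Proof.
move=> u0 cu P [r /= r0 Hr]; move/cvgr0_norm_lt : (cu) => /(_ _ r0).
by apply: filterS => k ukr; apply: Hr => //=; rewrite sub0r normrN.
Qed.

Section phi.
Variables (tau t : R) (y : 'rV[R]_n) (f g : 'rV[R]_n -> R[i]).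
Hypotheses (tau0 : 0 < tau) (t0 : 0 < t) (fg : generator gam E f g).
Let c := t + tau.
Let v (u : R) := @ou_pdf R n u y.
Let w (u : R) := @ou_pdf_deriv R n u y.
Let phi (s : R) := \int[gam]_x (complex.Re (E s f x) * v (c - s) x).

Let Lf : L2 gam f. Proof. by case: fg. Qed.
Let Lg : L2 gam g. Proof. by case: fg. Qed.
Let mv u : measurable_fun setT (v u). Proof. exact: measurable_ou_pdf. Qed.

Let ReB (z1 z2 : R[i]) : complex.Re (z1 - z2) = complex.Re z1 - complex.Re z2.
Proof. by case: z1 z2 => [? ?] [? ?]. Qed.

Let cvg_v (s : R) (u : nat -> R) x : s <= t -> u k @[k --> \oo] --> 0 ->
  v (c - s + u k) x @[k --> \oo] --> v (c - s) x.
Proof.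
move=> st cu; have cs0 : 0 < c - s by rewrite /c; have := tau0; lra.
have cont := is_derive_continuous (is_derive_ou_pdf y x cs0).
have cu' : c - s + u k @[k --> \oo] --> c - s.
  by rewrite -[X in _ --> X]addr0; apply: cvgD => //; exact: cvg_cst.
exact: (cvg_comp _ _ cu' cont).
Qed.

(** The increment splits into a change of the orbit and a change of the density. The former is E (s
    - h) applied to f - E h f, hence small by strong continuity at 0 and the uniform bound of
    [opbound_near]. *)
Let phi_left (s : R) : 0 < s <= t -> phi (s - h) @[h --> 0^'+] --> phi s.
Proof.
move=> /andP[s0 st]; have [C [C0 vC _ _]] := ou_pdf_lipschitz y tau0.
have [M [r [M0 r0 hM]]] := opbound_near C0E s0.
have m0 : 0 < Num.min r s by rewrite lt_min r0 s0.
apply: (cvg_at_right0_seq m0) => u u0r cu.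
have up k : [/\ 0 < u k, u k < r & u k < s].
  by have /andP[? ] := u0r k; rewrite lt_min => /andP[].
have vCk (k : nat) x : `|v (c - s + u k) x| <= C.
  have [uk _ _] := up k; apply: vC; rewrite /c; lra.
have Ls k : L2 gam (E (s - u k) f).
  by have [_ _ us] := up k; apply: L2E => //; rewrite subr_ge0 ltW.
have Lss : L2 gam (E s f) := L2E (ltW s0) Lf.
have [isf _] := integrable_L2 Lss.
pose D k : 'rV[R]_n -> R[i] := fun x => E (s - u k) f x - E s f x.
have up0 k : 0 < u k by have [] := up k.
have LD k : L2 gam (D k) by exact: L2B.
have D0 : sqnorm gam (D k) @[k --> \oo] --> 0%E.
  have cvu := seq_at_right up0 cu.
  have [_ _ sg /(_ _ Lf) cE] := C0E.
  have c0 := cvg_comp _ _ cvu cE.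
  apply: (@squeeze_cvge _ _ _ _ (cst 0%E) _
    (fun k => M%:E * sqnorm gam (fun x => E (u k) f x - f x)%R)%E).
  - apply: nearW => k; rewrite sqnorm_ge0 /=.
    have [uk ur us] := up k; have su0 : 0 <= s - u k by rewrite subr_ge0 ltW.
    have Lu := L2E (ltW uk) Lf.
    pose p : 'rV[R]_n -> R[i] := fun x => -1 * E (u k) f x + f x.
    have Lp : L2 gam p by exact: L2_lin.
    have e1 := linE (-1) su0 Lu Lf.
    have e2 := sg (s - u k) (u k) f su0 (ltW uk) Lf; rewrite subrK in e2.
    have e3 : eqL2 gam (E (s - u k) p) (D k).
      apply: filterS2 e1 e2 => x q1 q2.
      by rewrite q1 /D q2; ring.
    rewrite -(eqL2_sqnorm (proj1 (L2E su0 Lp)) (proj1 (LD k)) e3).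
    have -> : sqnorm gam (fun x => E (u k) f x - f x) = sqnorm gam p.
      apply: eq_integral => x _; rewrite /p; case: (E _ _ _) (f x) => [a b] [a' b'] /=.
      by congr EFin; ring.
    by apply: hM => //; rewrite (ltW uk) ur.
  - exact: cvg_cst.
  - by rewrite -[X in _ --> X](mule0 M%:E); apply: cvgeZl.
have l1 := pairing_cvg0 LD (fun k => mv (c - s + u k)) vCk D0.
have [_ l2] := @Rintegral_bounded_cvg _ _ _ gam _ (fun k => v (c - s + u k)) (v (c - s)) C
  isf (fun k => mv _) vCk (fun x => @cvg_v _ _ x st cu).
have l12 := cvgD l1 l2; rewrite add0r in l12.
apply: (cvg_trans _ (l12 _)); apply: near_eq_cvg.
apply: nearW => k; rewrite !fctE /phi /=.
have [iD _] := integrable_L2 (LD k).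
rewrite (_ : c - (s - u k) = c - s + u k); last by rewrite opprB addrCA addrC.
rewrite -RintegralD//; [|exact: (integrable_boundedM iD (mv _) (vCk k))
  |exact: (integrable_boundedM isf (mv _) (vCk k))].
by apply: eq_Rintegral => x _; rewrite /D ReB -mulrDl subrK.
Qed.

(** The difference quotient is the pairing of the orbit error with the density, plus that of E s g
    with the density, plus that of E s f with the time quotient of the density. The first tends to
    0, and the limits of the other two cancel. *)
Let phi_right (s : R) : 0 <= s < t -> (phi (s + h) - phi s) / h @[h --> 0^'+] --> (0 : R).
Proof.
move=> /andP[s0 st]; have [C [C0 vC wC lC]] := ou_pdf_lipschitz y tau0.
have ts0 : 0 < t - s by rewrite subr_gt0.
apply: (cvg_at_right0_seq ts0) => u ur cu.
have u0 k : 0 < u k by have /andP[] := ur k.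
have ut k : tau <= c - s - u k by have /andP[_] := ur k; rewrite /c; lra.
have cs0 : 0 < c - s by rewrite /c; have := tau0; lra.
have vCk (k : nat) x : `|v (c - s - u k) x| <= C by exact: vC.
have Lsf : L2 gam (E s f) := L2E s0 Lf.
have Lsg : L2 gam (E s g) := L2E s0 Lg.
have [isf _] := integrable_L2 Lsf; have [isg _] := integrable_L2 Lsg.
pose Q k := quotient s (u k) f g.
have LQ k : L2 gam (Q k) by exact: L2_quotient.
have Q0 : sqnorm gam (Q k) @[k --> \oo] --> 0%E.
  exact: (cvg_comp _ _ (seq_at_right u0 cu) (generator_quotient s0 fg)).
have Nu : - u k @[k --> \oo] --> 0 by rewrite -oppr0; exact: cvgN.
have l1 := pairing_cvg0 LQ (fun k => mv (c - s - u k)) vCk Q0.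
have [_ l2] := @Rintegral_bounded_cvg _ _ _ gam _ (fun k => v (c - s - u k)) (v (c - s)) C
  isg (fun k => mv _) vCk (fun x => @cvg_v _ _ x (ltW st) Nu).
pose q k x := (v (c - s - u k) x - v (c - s) x) / u k.
have mq k : measurable_fun setT (q k).
  by apply: measurable_funM => //; exact: measurable_funB.
have qC k x : `|q k x| <= C.
  rewrite normrM normfV (gtr0_norm (u0 k)) ler_pdivrMr// distrC.
  have uE : (c - s) - (c - s - u k) = u k by rewrite opprB addrC subrK.
  have := lC _ (c - s) x (ut k); rewrite uE; apply.
  by rewrite gerBl ltW.
have q_lim x : q k x @[k --> \oo] --> - w (c - s) x.
  have cvd := is_derive_cvg (is_derive_ou_pdf y x cs0).
  have Nud : - u k @[k --> \oo] --> (0 : R)^'.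
    by apply: seq_dnbhs => // k; rewrite oppr_eq0 gt_eqF.
  have cN := cvgN (cvg_comp _ _ Nud cvd); apply: (cvg_trans _ (cN _)); apply: near_eq_cvg.
  apply: nearW => k; rewrite !fctE /q /= invrN mulNr opprK [_ *: _]mulr1 mulrC.
  by rewrite (addrC (- u k)).
have [_ l3] := @Rintegral_bounded_cvg _ _ _ gam _ q (fun x => - w (c - s) x) C isf mq qC q_lim.
(* The cancellation is the weak backward equation for E s f, which stays in the domain of the
   generator. *)
have z : 0 = 0 + \int[gam]_x (complex.Re (E s g x) * v (c - s) x) +
    \int[gam]_x (complex.Re (E s f x) * - w (c - s) x).
  rewrite add0r (generator_ou_weak y cs0 (generator_semigroup s0 fg)).
  have iw : gam.-integrable setT (EFin \o (fun x => complex.Re (E s f x) * w (c - s) x)).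
    have [[mw wb] _] := @Rintegral_bounded_cvg _ _ _ gam _ q (fun x => - w (c - s) x) C isf mq qC q_lim.
    have := integrableZl measurableT (-1) (integrable_boundedM isf mw wb).
    by apply: eq_integrable => // x _; rewrite /comp -EFinM; congr EFin; ring.
  have -> : \int[gam]_x (complex.Re (E s f x) * - w (c - s) x) =
      -1 * \int[gam]_x (complex.Re (E s f x) * w (c - s) x).
    by rewrite -RintegralZl//; apply: eq_Rintegral => x _; ring.
  by rewrite mulN1r subrr.
have l123 := cvgD (cvgD l1 l2) l3; rewrite -z in l123.
apply: (cvg_trans _ (l123 _ _)); apply: near_eq_cvg.
apply: nearW => k; rewrite !fctE /phi /=.
have Lsu : L2 gam (E (s + u k) f) by apply: L2E => //; rewrite addr_ge0// ltW.
have [isu _] := integrable_L2 Lsu; have [iQ _] := integrable_L2 (LQ k).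
have vC0 x : `|v (c - s) x| <= C by apply: vC; rewrite /c; lra.
have i1 := integrable_boundedM isu (mv _) (vCk k).
have i2 := integrable_boundedM isf (mv _) vC0.
have i3 := integrable_boundedM iQ (mv _) (vCk k).
have i4 := integrable_boundedM isg (mv _) (vCk k).
have i5 := integrable_boundedM isf (mq k) (qC k).
have cE : c - (s + u k) = c - s - u k by rewrite opprD addrA.
rewrite cE -(RintegralB measurableT i1 i2) -(RintegralD measurableT i3 i4).
rewrite -(RintegralD measurableT (integrableD measurableT i3 i4) i5).
rewrite -(RintegralZr _ measurableT (integrableB measurableT i1 i2)).
apply: eq_Rintegral => x _; rewrite /Q /quotient ReB /q.
have -> (a : R) (p : R[i]) : complex.Re (a%:C%C * p) = a * complex.Re p.
  by case: p => p p' /=; rewrite mul0r subr0.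
rewrite ReB; ring.
Qed.

Lemma duhamel_generator : \int[gam]_x (complex.Re (E t f x) * ou_pdf tau y x) =
  \int[gam]_x (complex.Re (f x) * ou_pdf (t + tau) y x).
Proof.
have ct : c - t = tau by rewrite /c addrC addKr.
have := right_derivative0_cst t0 phi_left phi_right.
rewrite /phi ct subr0 => ->.
have [_ E0 _ _] := C0E.
have [[mf _] _] := Lf; have [[mEf _] _] := L2E (lexx 0) Lf.
congr fine; apply: ae_eq_integral => //.
- by apply/measurable_EFinP; apply: measurable_funM => //; exact: measurable_ou_pdf.
- by apply/measurable_EFinP; apply: measurable_funM => //; exact: measurable_ou_pdf.
- by apply: filterS (E0 _ Lf) => x -> _.
Qed.

End phi.

(** Density of the domain: elements h_k of it approximate [f], and E t is bounded, so the pairings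
    of both differences with the bounded densities tend to 0. *)
Lemma duhamel (tau t : R) y f : 0 < tau -> 0 < t -> L2 gam f ->
  \int[gam]_x (complex.Re (E t f x) * ou_pdf tau y x) =
  \int[gam]_x (complex.Re (f x) * ou_pdf (t + tau) y x).
Proof.
move=> tau0 t0 Lf.
have [C [C0 vC _ _]] := ou_pdf_lipschitz y tau0.
have [M hM] := opbound_ex C0E (ltW t0).
have [_ [LL dense _] _] := hL.
have /choice [h Hh] (k : nat) : exists h, (exists k', L h k') /\
    (sqnorm gam (fun x => f x - h x)%R < (k.+1%:R^-1)%:E)%E.
  have [|h [k' [Lk fh]]] := dense f (k.+1%:R^-1) Lf; first by rewrite invr_gt0.
  by exists h; split => //; exists k'.
have Lh k : L2 gam (h k) by have [[k' /LL[]]] := Hh k.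
have fh0 : sqnorm gam (fun x => f x - h k x) @[k --> \oo] --> 0%E.
  apply: (@squeeze_cvge _ _ _ _ (cst 0%E) _ (fun k => (k.+1%:R^-1)%:E)).
  - by apply: nearW => k; rewrite sqnorm_ge0 ltW//; have [] := Hh k.
  - exact: cvg_cst.
  - by apply: cvg_EFin; [exact: nearW|exact: cvg_harmonic].
have Lfh k : L2 gam (fun x => f x - h k x) by exact: L2B.
have Efh0 : sqnorm gam (fun x => E t f x - E t (h k) x) @[k --> \oo] --> 0%E.
  apply: (@squeeze_cvge _ _ _ _ (cst 0%E) _
    (fun k => M%:R%:E * sqnorm gam (fun x => f x - h k x)%R)%E).
  - apply: nearW => k; rewrite sqnorm_ge0 /=.
    pose p : 'rV[R]_n -> R[i] := fun x => -1 * h k x + f x.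
    have pE : p = (fun x => f x - h k x) by apply/funext => x; rewrite /p mulN1r addrC.
    have e1 := linE (-1) (ltW t0) (Lh k) Lf; rewrite -/p pE in e1.
    have e2 : eqL2 gam (E t (fun x => f x - h k x)) (fun x => E t f x - E t (h k) x).
      by apply: filterS e1 => x ->; rewrite mulN1r addrC.
    have LE1 := L2E (ltW t0) (Lfh k).
    have LE2 := L2B (L2E (ltW t0) Lf) (L2E (ltW t0) (Lh k)).
    by rewrite -(eqL2_sqnorm (proj1 LE1) (proj1 LE2) e2); exact: hM.
  - exact: cvg_cst.
  - by rewrite -[X in _ --> X](mule0 M%:R%:E); apply: cvgeZl.
have tt : tau <= t + tau by rewrite lerDr ltW.
have v1 (k : nat) x : `|ou_pdf tau y x| <= C by exact: vC.
have v2 (k : nat) x : `|ou_pdf (t + tau) y x| <= C by exact: vC.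
have l1 := pairing_cvg0 (fun k => L2B (L2E (ltW t0) Lf) (L2E (ltW t0) (Lh k)))
  (fun=> measurable_ou_pdf tau y) v1 Efh0.
have l2 := pairing_cvg0 Lfh (fun=> measurable_ou_pdf (t + tau) y) v2 fh0.
have [iE _] := integrable_L2 (L2E (ltW t0) Lf); have [if_ _] := integrable_L2 Lf.
have jE := integrable_boundedM iE (measurable_ou_pdf tau y) (v1 0%N).
have jf := integrable_boundedM if_ (measurable_ou_pdf (t + tau) y) (v2 0%N).
set I := \int[gam]_x _; set J := \int[gam]_x _.
have ReB (z1 z2 : R[i]) : complex.Re (z1 - z2) = complex.Re z1 - complex.Re z2.
  by case: z1 z2 => [? ?] [? ?].
(* The identity for h_k makes its contributions cancel, leaving the constant I - J, which must
   therefore be 0. *)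
have eq k : \int[gam]_x (complex.Re (E t f x - E t (h k) x) * ou_pdf tau y x) =
    (I - J) + \int[gam]_x (complex.Re (f x - h k x) * ou_pdf (t + tau) y x).
  have [iEh _] := integrable_L2 (L2E (ltW t0) (Lh k)); have [ih _] := integrable_L2 (Lh k).
  have jEh := integrable_boundedM iEh (measurable_ou_pdf tau y) (v1 0%N).
  have jh := integrable_boundedM ih (measurable_ou_pdf (t + tau) y) (v2 0%N).
  have [[k' Lk] _] := Hh k.
  have -> : \int[gam]_x (complex.Re (E t f x - E t (h k) x) * ou_pdf tau y x) =
      I - \int[gam]_x (complex.Re (h k x) * ou_pdf (t + tau) y x).
    rewrite -(duhamel_generator y tau0 t0 ((L_generator _ _).1 Lk)).
    rewrite -(RintegralB measurableT jE jEh); apply: eq_Rintegral => x _.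
    by rewrite ReB mulrBl.
  have -> : \int[gam]_x (complex.Re (f x - h k x) * ou_pdf (t + tau) y x) =
      J - \int[gam]_x (complex.Re (h k x) * ou_pdf (t + tau) y x).
    rewrite -(RintegralB measurableT jf jh); apply: eq_Rintegral => x _.
    by rewrite ReB mulrBl.
  by rewrite addrA subrK.
have l3 : \int[gam]_x (complex.Re (E t f x - E t (h k) x) * ou_pdf tau y x)
    @[k --> \oo] --> I - J.
  have l4 := cvgD (cvg_cst (I - J)) l2; rewrite addr0 in l4.
  by apply: (cvg_trans _ (l4 _ _)); apply: near_eq_cvg; apply: nearW => k; rewrite eq.
by apply/eqP; rewrite -subr_eq0; apply/eqP/(cvg_unique (@Rhausdorff R) l3 l1).
Qed.

End duhamel.

(** * Small times: recovering a function from its box averages *)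

Section ou1_mass.
Context (R : realType).
Local Notation mu := (@lebesgue_measure R).
Implicit Types (u x s : R) (B : set R).

Lemma ou1E u s x :
  ou1 u s x = ou_norm u * expR (- (ou_rate u * (s - expR (- u) * x) ^+ 2)).
Proof. by rewrite /ou1 /gk -[(s - _) ^+ 2]sqrrN opprB. Qed.

Lemma ou1_ge0 u s x : 0 <= ou1 u s x.
Proof. by rewrite ou1E mulr_ge0 ?expR_ge0// invr_ge0 sqrtr_ge0. Qed.

Lemma measurable_ou1 u x : measurable_fun setT (fun s => ou1 u s x).
Proof.
rewrite (_ : (fun s => _) = fun s => ou_norm u *
  expR (- (ou_rate u * (s - expR (- u) * x) ^+ 2))); last by apply/funext => s; exact: ou1E.
by apply: measurable_funM => //; exact: measurable_gaussc.
Qed.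

Lemma integrable_ou1 u x : 0 < u -> mu.-integrable setT (EFin \o (fun s => ou1 u s x)).
Proof.
move=> u0; have A0 : 0 < ou_rate u by rewrite invr_gt0 mulr_gt0// ou_sigma_gt0.
have := integrableZl measurableT (ou_norm u) (integrable_gaussc (expR (- u) * x) A0).
by apply: eq_integrable => // s _; rewrite /= ou1E.
Qed.

Lemma integral_ou1 u x : 0 < u -> (\int[mu]_s (ou1 u s x)%:E = 1)%E.
Proof.
move=> u0; have s0 := ou_sigma_gt0 u0.
have A0 : 0 < ou_rate u by rewrite invr_gt0 mulr_gt0.
under eq_integral do rewrite ou1E EFinM.
rewrite ge0_integralZl//=; first last.
- by rewrite lee_fin invr_ge0 sqrtr_ge0.
- by apply/measurable_EFinP; exact: measurable_gaussc.
rewrite integral_gaussc// -EFinM /ou_norm /ou_rate invrK mulrCA mulrA.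
by rewrite mulVf// gt_eqF// sqrtr_gt0 !mulr_gt0// pi_gt0.
Qed.

(** The probability of moving from [x] into [B] in time [u]. *)
Definition ou1_mass u B x : R := \int[mu]_s (\1_B s * ou1 u s x).

Lemma normr_indic (T : Type) (A : set T) (z : T) : `|\1_A z : R| <= 1.
Proof. by rewrite indicE; case: (_ \in _); rewrite ?normr1 ?normr0. Qed.

Lemma integrable_ou1_indic u B x : 0 < u -> measurable B ->
  mu.-integrable setT (EFin \o (fun s => \1_B s * ou1 u s x)).
Proof.
move=> u0 mB; have mi : measurable_fun setT (\1_B : R -> R) by exact: measurable_indic.
have := integrable_boundedM (integrable_ou1 x u0) mi (fun s => normr_indic B s).
by apply: eq_integrable => // s _; rewrite /= mulrC.
Qed.

Lemma ou1_mass_ge0 u B x : 0 <= ou1_mass u B x.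
Proof. by apply: Rintegral_ge0 => s _; rewrite mulr_ge0 ?ou1_ge0. Qed.

Lemma ou1_massC u B x : 0 < u -> measurable B ->
  ou1_mass u (~` B) x = 1 - ou1_mass u B x.
Proof.
move=> u0 mB; have mC := measurableC mB.
rewrite -[1]/(fine 1%E) -(integral_ou1 x u0) -[fine _]/(\int[mu]_s (ou1 u s x)).
rewrite /ou1_mass -RintegralB//; try exact: integrable_ou1; last first.
  exact: integrable_ou1_indic.
by apply: eq_Rintegral => s _; rewrite !indicE in_setC; case: (_ \in _); rewrite /=; ring.
Qed.

Lemma ou1_mass_le1 u B x : 0 < u -> measurable B -> ou1_mass u B x <= 1.
Proof.
by move=> u0 mB; rewrite -subr_ge0 -ou1_massC// ou1_mass_ge0.
Qed.

(* q e^-q <= 1 trades half of the Gaussian decay for a factor that vanishes with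
   the variance. *)
Lemma ou1_tail u s x d : 0 < u -> 0 < d -> d <= `|s - expR (- u) * x| ->
  ou1 u s x <= 4 * ou_sigma u / d ^+ 2 * (ou_norm u *
    expR (- (ou_rate u / 2 * (s - expR (- u) * x) ^+ 2))).
Proof.
move=> u0 d0 dw; have s0 := ou_sigma_gt0 u0.
rewrite ou1E; set w := s - _ in dw *; set A := ou_rate u.
have A0 : 0 < A by rewrite invr_gt0 mulr_gt0.
rewrite [leRHS]mulrCA; apply: ler_wpM2l; first by rewrite invr_ge0 sqrtr_ge0.
have q0 : 0 <= A / 2 * w ^+ 2 by rewrite mulr_ge0 ?sqr_ge0// divr_ge0// ltW.
rewrite (_ : A * w ^+ 2 = A / 2 * w ^+ 2 + A / 2 * w ^+ 2); last by rewrite -mulrDl -splitr.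
rewrite opprD expRD; apply: ler_wpM2r; first exact: expR_ge0.
have dw2 : d ^+ 2 <= w ^+ 2.
  by rewrite -(real_normK (num_real w)) ler_pXn2r// ?nnegrE// ltW.
have h := mulr_expRN_le1 q0.
have Ad : A / 2 * d ^+ 2 <= A / 2 * w ^+ 2 by rewrite ler_wpM2l// divr_ge0// ltW.
rewrite (_ : 4 * ou_sigma u / d ^+ 2 = (A / 2 * d ^+ 2)^-1); last first.
  by rewrite /A /ou_rate; move: (ou_sigma u) s0 => z z0; field; rewrite !gt_eqF.
have p0 : 0 < A / 2 * d ^+ 2 by rewrite mulr_gt0 ?divr_gt0 ?exprn_gt0.
rewrite -[leRHS]mul1r ler_pdivlMr// mulrC; apply: le_trans h.
by rewrite ler_wpM2r ?expR_ge0.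
Qed.

(** [ou1_tail] integrated: halving the rate multiplies the mass of the Gaussian by sqrt(2). *)
Lemma ou1_mass_far u B x d : 0 < u -> measurable B -> 0 < d ->
  (forall s, B s -> d <= `|s - expR (- u) * x|) ->
  ou1_mass u B x <= 4 * ou_sigma u / d ^+ 2 * Num.sqrt 2.
Proof.
move=> u0 mB d0 Bd; have s0 := ou_sigma_gt0 u0.
have A0 : 0 < ou_rate u / 2 by rewrite divr_gt0// invr_gt0 mulr_gt0.
have ig := integrable_gaussc (expR (- u) * x) A0.
have i1 := integrableZl measurableT (ou_norm u) ig.
have i2 := integrableZl measurableT (4 * ou_sigma u / d ^+ 2) i1.
have -> : Num.sqrt 2 = \int[mu]_s (ou_norm u *
    expR (- (ou_rate u / 2 * (s - expR (- u) * x) ^+ 2))).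
  rewrite RintegralZl// /Rintegral integral_gaussc//= /ou_norm /ou_rate.
  rewrite (_ : pi / _ = 2 * (2 * pi * ou_sigma u)); last by field; rewrite gt_eqF.
  rewrite [X in _ * X]sqrtrM// mulrCA mulVf ?mulr1// gt_eqF// sqrtr_gt0 !mulr_gt0//.
  exact: pi_gt0.
rewrite -RintegralZl//; last first.
rewrite /ou1_mass; apply: le_Rintegral => //.
- exact: integrable_ou1_indic.
- move=> s _; rewrite indicE; case: (boolP (s \in B)) => sB.
    by rewrite mul1r; apply: ou1_tail => //; apply/Bd/set_mem.
  rewrite mul0r !mulr_ge0 ?expR_ge0 ?invr_ge0 ?sqrtr_ge0 ?exprn_ge0 ?(ltW s0) ?(ltW d0)//.
Qed.

Definition shrink (k : nat) : R := k.+1%:R^-1.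

Lemma shrink_gt0 k : 0 < shrink k. Proof. by rewrite invr_gt0. Qed.

Lemma cvg_expRN_shrink : expR (- shrink k) @[k --> \oo] --> (1 : R).
Proof.
rewrite -expR0 -[0]oppr0; apply: (cvg_comp (fun k => - shrink k) (@expR R)).
  by apply: cvgN; exact: cvg_harmonic.
exact: continuous_expR.
Qed.

Lemma cvg_ou1_mass_far B x d : measurable B -> 0 < d ->
  (forall s, B s -> d <= `|s - x|) -> ou1_mass (shrink k) B x @[k --> \oo] --> 0.
Proof.
move=> mB d0 Bd.
have d2 : 0 < d / 2 by rewrite divr_gt0.
apply: (@squeeze_cvgr _ _ _ _ (cst 0)
  (fun k => 4 * ou_sigma (shrink k) / (d / 2) ^+ 2 * Num.sqrt 2)).
(* The law is centred at e^-u x rather than at x; for small u the two differ by less than d/2, so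
   [B] is still d/2 away from the mean. *)
- have cx : expR (- shrink k) * x @[k --> \oo] --> x.
    by rewrite -[X in _ --> X]mul1r; apply: cvgM; [exact: cvg_expRN_shrink|exact: cvg_cst].
  have {}cx : \forall k \near \oo, `|x - expR (- shrink k) * x| < d / 2.
    by move/cvgrPdist_lt : cx; apply.
  apply: filterS cx => k xk; rewrite ou1_mass_ge0/=.
  apply: ou1_mass_far => //; first exact: shrink_gt0.
  move=> s /Bd; have := ler_distD (expR (- shrink k) * x) s x.
  by rewrite (distrC (expR _ * x) x); lra.
- exact: cvg_cst.
- rewrite [X in _ --> X](_ : 0 = 4 * (1 - 1 ^+ 2) / (d / 2) ^+ 2 * Num.sqrt 2); last first.
    by rewrite expr1n subrr mulr0 !mul0r.
  apply: cvgM; last exact: cvg_cst.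
  apply: cvgM; last exact: cvg_cst.
  apply: cvgM; first exact: cvg_cst.
  apply: cvgB; first exact: cvg_cst.
  by apply: (cvg_comp _ (fun z => z ^+ 2) cvg_expRN_shrink); exact: exprn_continuous.
Qed.

(** Off the endpoints, [x] is at positive distance d from whichever of the interval and its
    complement does not contain it; that set loses its mass, and the total mass is 1. *)
Lemma cvg_ou1_mass a b x : x != a -> x != b ->
  ou1_mass (shrink k) `]a, b[ x @[k --> \oo] --> (\1_(`]a, b[%classic) x : R).
Proof.
move=> xa xb; have m1 : measurable (`]a, b[%classic : set R) by exact: measurable_itv.
have m2 := measurableC m1.
pose d := Num.min `|x - a| `|x - b|.
have d0 : 0 < d by rewrite lt_min !normr_gt0 !subr_eq0 xa xb.
have [da db] : d <= `|x - a| /\ d <= `|x - b| by rewrite !ge_min !lexx orbT.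
rewrite indicE; have [|/negP] := boolP (x \in `]a, b[%classic).
  rewrite inE /= in_itv /= => /andP[ax bx].
  have far s : (~` `]a, b[%classic) s -> d <= `|s - x|.
    rewrite /= in_itv /= => /negP; rewrite negb_and -!leNgt => /orP[sa|bs].
      rewrite distrC (@ger0_norm _ (x - s)); last lra.
      by move: da; rewrite (@ger0_norm _ (x - a)); lra.
    rewrite (@ger0_norm _ (s - x)); last lra.
    by move: db; rewrite (@ler0_norm _ (x - b)); lra.
  have h := cvg_ou1_mass_far m2 d0 far.
  have h1 := cvgB (cvg_cst (1 : R)) h; rewrite subr0 in h1.
  apply: (cvg_trans _ (h1 _ _)); apply: near_eq_cvg; apply: nearW => k.
  by rewrite !fctE ou1_massC ?shrink_gt0// opprB addrC subrK.
rewrite inE /= in_itv /= => /negP; rewrite negb_and -!leNgt => H.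
apply: cvg_ou1_mass_far d0 _ => // s; rewrite /= in_itv /= => /andP[as_ sb].
case/orP : H => [xla|xgb].
  rewrite (@ger0_norm _ (s - x)); last lra.
  by move: da; rewrite (@ler0_norm _ (x - a)); lra.
rewrite distrC (@ger0_norm _ (x - s)); last lra.
by move: db; rewrite (@ger0_norm _ (x - b)); lra.
Qed.

End ou1_mass.

(** * Open boxes determine integrals *)

Section boxes.
Context (R : realType) (n : nat).

Definition obox (a b : 'I_n -> R) : set 'rV[R]_n :=
  [set x | forall i, a i < x ord0 i < b i].

Lemma measurable_obox a b : measurable (obox a b).
Proof.
rewrite (_ : obox a b = \bigcap_(i in [set: 'I_n])
    ((fun x : 'rV[R]_n => x ord0 i) @^-1` `]a i, b i[%classic)).
  apply: fin_bigcap_measurable => // i _; rewrite -[X in measurable X]setTI.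
  by apply: measurable_rV_coord => //; exact: measurable_itv.
apply/seteqP; split => x /= xab i; last by have := xab i I; rewrite /= in_itv.
by move=> _; rewrite /= in_itv /=; exact: xab.
Qed.

Definition oboxes : set (set 'rV[R]_n) := [set A | exists a b, A = obox a b].

Lemma setI_closed_oboxes : setI_closed oboxes.
Proof.
move=> _ _ [a [b ->]] [a' [b' ->]].
exists (fun i => Num.max (a i) (a' i)), (fun i => Num.min (b i) (b' i)).
apply/seteqP; split => x /=.
  move=> [x1 x2] i; have /andP[p q] := x1 i; have /andP[p' q'] := x2 i.
  by rewrite gt_max lt_min p p' q q'.
move=> xab; split => i; have := xab i; rewrite gt_max lt_min => /andP[/andP[p p'] /andP[q q']].
  by rewrite p q.
by rewrite p' q'.
Qed.

Lemma obox_cover (x : 'rV[R]_n) : exists N : nat, forall j, - N%:R < x ord0 j < N%:R.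
Proof.
exists (Num.bound (\sum_j `|x ord0 j|)) => j; rewrite -ltr_norml.
apply: le_lt_trans (archi_boundP (sumr_ge0 _ (fun i _ => normr_ge0 _))).
by rewrite (bigD1 j)//= lerDl sumr_ge0.
Qed.

(** A half-space x_i > r is the countable union of boxes whose other sides are ]-N,
    N[ and whose i-th side is ]r, N[. *)
Lemma measurable_oboxesE : @measurable _ 'rV[R]_n = <<s oboxes >>.
Proof.
apply/seteqP; split; last first.
  apply: smallest_sub; first exact: sigma_algebra_measurable.
  by move=> _ [a [b ->]]; exact: measurable_obox.
apply: smallest_sub; first exact: smallest_sigma_algebra.
move=> A; rewrite -bigcup_seq => -[i _ [B mB <-]].
pose f : g_sigma_algebraType oboxes -> R := fun x : 'rV[R]_n => x ord0 i.
suff mf : measurable_fun setT f by exact: (mf measurableT B mB).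
apply: (measurability _ (RGenOInfty.measurableE R)) => //.
move=> _ [_ [r ->] <-]; rewrite setTI.
pose a (N : nat) (j : 'I_n) : R := if j == i then r else - N%:R.
rewrite (_ : f @^-1` _ = \bigcup_N obox (a N) (fun=> N%:R)).
  by apply: bigcup_measurable => N _; apply: sub_sigma_algebra; exists (a N), (fun=> N%:R).
apply/seteqP; split => x.
  rewrite /f /= in_itv /= andbT => rx.
  have [N HN] := obox_cover x; exists N => // j; have /andP[p q] := HN j.
  by rewrite q andbT /a; case: eqP => [->|].
by move=> [N _ /(_ i)]; rewrite /a eqxx /f /= in_itv /= andbT => /andP[].
Qed.

Context (mu : {measure set 'rV[R]_n -> \bar R}).

(** Dynkin's argument on a generating family closed under intersection. The whole space, needed for
    complements, is reached by growing boxes and dominated convergence. *)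
Lemma integral_oboxes_eq0 (Q : 'rV[R]_n -> R) :
  mu.-integrable setT (EFin \o Q) ->
  (forall a b, \int[mu]_(x in obox a b) Q x = 0) ->
  forall A, measurable A -> \int[mu]_(x in A) Q x = 0.
Proof.
move=> iQ Q0.
have iQA A : measurable A -> mu.-integrable A (EFin \o Q).
  by move=> mA; apply: integrableS iQ.
have QT : \int[mu]_x Q x = 0.
  pose F N : 'rV[R]_n -> R := \1_(obox (fun=> - N%:R) (fun=> N%:R)).
  have [|||_ cv] := @Rintegral_bounded_cvg _ _ _ mu Q F (cst 1) 1 iQ.
  - by move=> N; apply: measurable_indic; exact: measurable_obox.
  - by move=> N x; rewrite /F indicE; case: (_ \in _); rewrite ?normr1 ?normr0.
  - move=> x; apply: cvg_near_cst; have [N HN] := obox_cover x.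
    near=> k; rewrite /F indicE mem_set//= => j.
    have /andP[p q] := HN j; have Nk : N%:R <= k%:R :> R.
      by rewrite ler_nat; near: k; exact: nbhs_infty_ge.
    by rewrite (lt_le_trans q Nk) (le_lt_trans _ p)// lerN2.
  have FE N : \int[mu]_x (Q x * F N x) = 0.
    rewrite -[RHS](Q0 (fun=> - N%:R) (fun=> N%:R)) [RHS]Rintegral_mkcond.
    apply: eq_Rintegral => x _; rewrite /F patchE indicE.
    by case: ifP => _; rewrite ?mulr1 ?mulr0.
  rewrite (eq_Rintegral _ (g := fun x => Q x * cst 1 x)); last by move=> x _; rewrite mulr1.
  apply: (cvg_unique _ cv); first exact: Rhausdorff.
  by apply: cvg_near_cst; apply: nearW => N; exact: FE.
move=> A; rewrite measurable_oboxesE.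
apply: (@dynkin_induction _ _ oboxes (fun A => \int[mu]_(x in A) Q x = 0)).
- exact: measurable_oboxesE.
- exact: setI_closed_oboxes.
- exact: QT.
- by move=> _ [a [b ->]]; exact: Q0.
- move=> S mS S0; have : \int[mu]_(x in S `|` ~` S) Q x = 0 by rewrite setUv.
  rewrite Rintegral_setU//; last by apply/disj_setPS; rewrite setICr.
  + by rewrite S0 add0r.
  + exact: measurableC.
  + by rewrite setUv.
- move=> F mF tF F0; rewrite /Rintegral.
  rewrite integral_bigcup//; last by apply: iQA; exact: bigcup_measurable.
  rewrite eseries0// => k _ _; have := F0 k; rewrite /Rintegral.
  have := integrable_fin_num (mF k) (iQA _ (mF k)).
  by move=> h1 h2; rewrite -[LHS]fineK// h2.
Unshelve. all: by end_near. Qed.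

End boxes.

(** * Short-time limits of the transition density in several variables *)

Section ou_pdf_mass.
Context (R : realType) (n : nat).
Local Notation leb := (lebesgue_rV R n).
Implicit Types (u : R) (x y : 'rV[R]_n) (a b : 'I_n -> R).

Lemma ou_pdf_ge0 u y x : 0 <= ou_pdf u y x.
Proof. by apply: prodr_ge0 => i _; exact: ou1_ge0. Qed.

Lemma measurable_ou_pdf2 u :
  measurable_fun setT (fun z : 'rV[R]_n * 'rV[R]_n => ou_pdf u z.1 z.2).
Proof.
apply: measurable_prod => i _; rewrite /ou_factor.
under eq_fun do rewrite ou1E.
apply: measurable_funM => //; apply: measurableT_comp => //.
apply: measurableT_comp => //; apply: measurable_funM => //.
apply: measurable_funX; apply: measurable_funB.
  exact: (measurableT_comp (measurable_rV_coord i)).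
apply: measurable_funM => //.
exact: (measurableT_comp (measurable_rV_coord i)).
Qed.

Lemma measurable_ou_pdf_y u x : measurable_fun setT (fun y => ou_pdf u y x).
Proof. exact: (measurableT_comp (@measurable_ou_pdf2 u) (pair2_measurable x)). Qed.

Lemma integral_ou_pdf u x : 0 < u -> (\int[leb]_y (ou_pdf u y x)%:E = 1)%E.
Proof.
move=> u0; rewrite /ou_pdf /prodf /ou_factor.
rewrite (@ge0_integral_rV_prod R n (fun i s => ou1 u s (x ord0 i))).
- by rewrite big1// => i _; exact: integral_ou1.
- by move=> i; exact: measurable_ou1.
- by move=> i s; exact: ou1_ge0.
Qed.

Lemma indic_obox a b y :
  \1_(obox a b) y = \prod_i \1_(`]a i, b i[%classic) (y ord0 i) :> R.
Proof.
rewrite indicE; case: (boolP (y \in obox a b)) => [/set_mem yab|/negP yab].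
  rewrite big1// => i _; rewrite indicE mem_set//= in_itv /=; exact: yab.
have [i yi] : exists i, ~ (a i < y ord0 i < b i).
  by apply/existsNP => h; apply: yab; exact/mem_set.
by rewrite (bigD1 i)//= indicE memNset ?mul0r//= in_itv.
Qed.

Definition box_mass u a b x : R := \prod_i ou1_mass u `]a i, b i[ (x ord0 i).

Lemma integral_box_mass u a b x : 0 < u ->
  \int[leb]_y (\1_(obox a b) y * ou_pdf u y x) = box_mass u a b x.
Proof.
move=> u0; rewrite /Rintegral.
under eq_integral do rewrite indic_obox -big_split/=.
rewrite (@ge0_integral_rV_prod R n
  (fun i s => \1_(`]a i, b i[%classic) s * ou1 u s (x ord0 i))).
- rewrite (eq_bigr (fun i => (ou1_mass u `]a i, b i[ (x ord0 i))%:E)).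
    by rewrite prodEFin.
  move=> i _; rewrite fineK//; apply: integrable_fin_num => //.
  by apply: integrable_ou1_indic => //; exact: measurable_itv.
- move=> i; apply: measurable_funM; last exact: measurable_ou1.
  by apply: measurable_indic; exact: measurable_itv.
- by move=> i s; rewrite mulr_ge0 ?ou1_ge0// indicE.
Qed.

Lemma box_mass01 u a b x : 0 < u -> `|box_mass u a b x| <= 1.
Proof.
move=> u0; rewrite normr_prod prodr_ile1// => i _; rewrite normr_ge0/=.
rewrite ger0_norm ?ou1_mass_ge0// ou1_mass_le1//; exact: measurable_itv.
Qed.

(** A hyperplane is a product set with one side reduced to a point. *)
Lemma lebesgue_hyperplane (i : 'I_n) (c : R) :
  measurable [set x : 'rV[R]_n | x ord0 i = c] /\ leb [set x | x ord0 i = c] = 0%E.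
Proof.
split.
  rewrite -[X in measurable X]setTI.
  exact: (measurable_rV_coord i measurableT (measurable_set1 c)).
pose A j : set R := if j == i then [set c] else setT.
transitivity (leb [set x : 'rV[R]_n | forall j, A j (x ord0 j)]).
  congr (leb _); apply/seteqP; split=> x /=; last by move=> /(_ i); rewrite /A eqxx.
  by move=> xi j; rewrite /A; case: eqP => [->|].
rewrite lebesgue_rV_box; last by move=> j; rewrite /A; case: ifP.
by rewrite (bigD1 i)//= /A eqxx lebesgue_measure_set1 mul0e.
Qed.

Lemma ae_off_faces a b :
  {ae leb, forall x, forall i, x ord0 i != a i /\ x ord0 i != b i}.
Proof.
have h i c : {ae leb, forall x : 'rV[R]_n, x ord0 i != c}.
  have [mH H0] := lebesgue_hyperplane i c.
  by eexists; split; [exact: mH|exact: H0|move=> x /= /negP/negPn/eqP].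
have H i : {ae leb, forall x : 'rV[R]_n, x ord0 i != a i /\ x ord0 i != b i}.
  by apply: filterS2 (h i (a i)) (h i (b i)) => x.
exact: filter_forall H.
Qed.

Lemma cvg_box_mass a b x : (forall i, x ord0 i != a i /\ x ord0 i != b i) ->
  box_mass (shrink R k) a b x @[k --> \oo] --> (\1_(obox a b) x : R).
Proof.
move=> xF; rewrite indic_obox; apply: cvg_big => [|i _]; first exact: mul_continuous.
by have [] := xF i; exact: cvg_ou1_mass.
Qed.

(** Written as an integral in y of a jointly measurable kernel, so that Tonelli applies. *)
Lemma measurable_box_mass u a b : 0 < u -> measurable_fun setT (box_mass u a b).
Proof.
move=> u0; rewrite (_ : box_mass u a b = fun x =>
    fine (\int[leb]_y (\1_(obox a b) y * ou_pdf u y x)%:E)); last first.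
  by apply/funext => x; rewrite -integral_box_mass.
apply: measurableT_comp => //.
have mK : measurable_fun setT (fun z : 'rV[R]_n * 'rV[R]_n =>
    (\1_(obox a b) z.1 * ou_pdf u z.1 z.2)%:E).
  apply/measurable_EFinP/measurable_funM; last exact: measurable_ou_pdf2.
  apply: (measurableT_comp _ measurable_fst).
  by apply: measurable_indic; exact: measurable_obox.
apply: (@measurable_fun_fubini_tonelli_G _ _ _ _ _ leb _ mK) => z.
by rewrite lee_fin mulr_ge0 ?ou_pdf_ge0// indicE.
Qed.

(** Masses of boxes are at most 1 and converge off the faces, a null set. *)
Lemma cvg_integral_box_mass a b (G : 'rV[R]_n -> R) :
  leb.-integrable setT (EFin \o G) ->
  \int[leb]_x (G x * box_mass (shrink R k) a b x) @[k --> \oo] -->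
  \int[leb]_x (G x * \1_(obox a b) x).
Proof.
move=> iG.
have [/measurable_EFinP mG _] := integrableP _ _ _ iG.
have m1 : measurable_fun setT (fun x => G x * \1_(obox a b) x).
  by apply: measurable_funM => //; apply: measurable_indic; exact: measurable_obox.
have i1 : leb.-integrable setT (EFin \o (fun x => G x * \1_(obox a b) x)).
  apply: integrable_boundedM iG _ (fun x => normr_indic R _ x).
  by apply: measurable_indic; exact: measurable_obox.
have [] := @dominated_convergence _ _ _ leb setT measurableT
  (fun k x => (G x * box_mass (shrink R k) a b x)%:E)
  (fun x => (G x * \1_(obox a b) x)%:E) (fun x => `|(G x)%:E|%E).
- move=> k; apply/measurable_EFinP/measurable_funM => //; by apply: measurable_box_mass; exact: shrink_gt0.
- exact/measurable_EFinP.
- apply: filterS (ae_off_faces a b) => x xF _; apply: cvg_EFin; first exact: nearW.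
  by apply: cvgM; [exact: cvg_cst|exact: cvg_box_mass].
- exact: integrable_abse iG.
- apply: aeW => x k _; rewrite /= lee_fin normrM ler_piMr// box_mass01// shrink_gt0//.
move=> _ _; rewrite -(fineK (integrable_fin_num measurableT i1)).
by move/fine_cvgP => [_].
Qed.

Variables (G : 'rV[R]_n -> R) (iG : leb.-integrable setT (EFin \o G)).

Let mG : measurable_fun setT G.
Proof. by have [/measurable_EFinP] := integrableP _ _ _ iG. Qed.

(** Integrating in y first, where the kernel is a probability density, leaves the integral of
    |G|. *)
Lemma integrable_ou_pdf2 u : 0 < u -> (leb \x leb)%E.-integrable setT
  (EFin \o (fun z : 'rV[R]_n * 'rV[R]_n => G z.2 * ou_pdf u z.1 z.2)).
Proof.
move=> u0; apply/integrable21ltyP.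
  apply/measurable_EFinP/measurable_funM; last exact: measurable_ou_pdf2.
  exact: (measurableT_comp mG measurable_snd).
have [_] := integrableP _ _ _ iG; rewrite [X in (X < _)%E -> _](_ : _ =
  \int[leb]_y \int[leb]_x `|(EFin \o (fun z => (G z.2 * ou_pdf u z.1 z.2)%R)) (x, y)|)%E//.
apply: eq_integral => x _.
rewrite (eq_integral (fun y => `|(G x)%:E| * (ou_pdf u y x)%:E)%E); last first.
  by move=> y _; rewrite /= normrM (ger0_norm (ou_pdf_ge0 _ _ _)).
rewrite ge0_integralZl//; first by rewrite integral_ou_pdf// mule1.
- by apply/measurable_EFinP; exact: measurable_ou_pdf_y.
- by move=> y _; rewrite lee_fin ou_pdf_ge0.
Qed.

Definition ou_int u y : R := \int[leb]_x (G x * ou_pdf u y x).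

Lemma integrable_ou_pdfM u y : 0 < u ->
  leb.-integrable setT (EFin \o (fun x => G x * ou_pdf u y x)).
Proof.
move=> u0; have [C [_ uC _]] := ou_pdf_bounds y u0.
by apply: integrable_boundedM iG (measurable_ou_pdf u y) _ => x; exact: uC.
Qed.

Lemma integrable_ou_int u : 0 < u -> leb.-integrable setT (EFin \o ou_int u).
Proof.
move=> u0; have := integrable_fubini_F (integrable_ou_pdf2 u0).
apply: eq_integrable => // y _; rewrite /fubini_F /= /ou_int /Rintegral fineK//.
exact: (integrable_fin_num measurableT (integrable_ou_pdfM y u0)).
Qed.

Lemma integral_obox_ou_int u a b : 0 < u ->
  \int[leb]_y (\1_(obox a b) y * ou_int u y) = \int[leb]_x (G x * box_mass u a b x).
Proof.
move=> u0; have mi : measurable_fun setT (\1_(obox a b) : _ -> R).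
  by apply: measurable_indic; exact: measurable_obox.
have i2 : (leb \x leb)%E.-integrable setT
    (EFin \o (fun z : 'rV[R]_n * 'rV[R]_n =>
      G z.2 * ou_pdf u z.1 z.2 * \1_(obox a b) z.1)).
  apply: integrable_boundedM (integrable_ou_pdf2 u0) _ (fun z => normr_indic R _ _).
  exact: (measurableT_comp mi measurable_fst).
rewrite /Rintegral; congr fine.
transitivity (\int[leb]_y \int[leb]_x
    (EFin \o (fun z => (G z.2 * ou_pdf u z.1 z.2 * \1_(obox a b) z.1)%R)) (y, x))%E.
  apply: eq_integral => y _; rewrite /ou_int EFinM /Rintegral fineK; last first.
    exact: (integrable_fin_num measurableT (integrable_ou_pdfM y u0)).
  rewrite -integralZl//; last exact: integrable_ou_pdfM.
  by apply: eq_integral => x _; rewrite /= -EFinM mulrC.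
rewrite Fubini//; apply: eq_integral => x _.
rewrite -integral_box_mass// EFinM /Rintegral.
rewrite [LHS](eq_integral (fun y => (G x)%:E * (\1_(obox a b) y * ou_pdf u y x)%:E)%E); last first.
  by move=> y _; rewrite /comp /= -EFinM; congr EFin; ring.
have iK : leb.-integrable setT (EFin \o (fun y => \1_(obox a b) y * ou_pdf u y x)).
  have iu : leb.-integrable setT (EFin \o (fun y => ou_pdf u y x)).
    apply/integrableP; split; first by apply/measurable_EFinP; exact: measurable_ou_pdf_y.
    under eq_integral do rewrite /= ger0_norm ?ou_pdf_ge0//.
    by rewrite integral_ou_pdf// ltry.
  have := integrable_boundedM iu mi (fun x => normr_indic R _ x).
  by apply: eq_integrable => // y _; rewrite /= mulrC.
rewrite fineK; last exact: (integrable_fin_num measurableT iK).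
exact: integralZl.
Qed.

(** From time t on, the density never exceeds its peak height at time t. The bound does not depend
    on y, hence is dominating on a box. *)
Lemma ou_int_bound (t u : R) y : 0 < t -> t <= u ->
  `|ou_int u y| <= ou_norm t ^+ n * \int[leb]_x `|G x|.
Proof.
move=> t0 tu; have u0 := lt_le_trans t0 tu.
have nle : ou_norm u <= ou_norm t.
  have p0 : 0 < 2 * pi :> R by rewrite mulr_gt0// pi_gt0.
  have pu := mulr_gt0 p0 (ou_sigma_gt0 u0).
  rewrite lef_pV2 ?posrE ?sqrtr_gt0 ?pu ?(mulr_gt0 p0 (ou_sigma_gt0 t0))//.
  rewrite ler_sqrt ?(ltW pu)// (ler_pM2l p0) lerD2l lerN2 ler_pXn2r// ?nnegrE ?expR_ge0//.
  by rewrite ler_expR lerN2.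
have ule x : `|ou_pdf u y x| <= ou_norm t ^+ n.
  rewrite -[in leRHS](card_ord n) -prodr_const normr_prod; apply: ler_prod => i _.
  rewrite normr_ge0 ger0_norm ?ou1_ge0//; apply: le_trans nle; apply: gk_le.
    by rewrite invr_ge0 sqrtr_ge0.
  by rewrite invr_gt0 mulr_gt0// ou_sigma_gt0.
have ia : leb.-integrable setT (EFin \o (fun x => `|G x|)).
  by have := integrable_abse iG; apply: eq_integrable.
apply: (le_trans (le_normr_Rintegral measurableT (integrable_ou_pdfM y u0))).
rewrite -RintegralZl//; apply: le_Rintegral => //.
- by have := integrable_abse (integrable_ou_pdfM y u0); apply: eq_integrable.
- exact: (integrableZl measurableT _ ia).
- by move=> x _; rewrite normrM mulrC ler_wpM2r.
Qed.

Lemma lebesgue_obox_lty a b : (leb (obox a b) < +oo)%E.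
Proof.
have -> : obox a b = [set x : 'rV[R]_n | forall i, `]a i, b i[%classic (x ord0 i)].
  by apply/seteqP; split=> x /= h i; have := h i; rewrite /= in_itv.
have mA i : measurable (`]a i, b i[%classic : set R) by exact: measurable_itv.
have -> := lebesgue_rV_box mA.
have /choice [r rE] (i : 'I_n) : exists r : R,
    lebesgue_measure (`]a i, b i[%classic : set R) = r%:E.
  rewrite lebesgue_measure_itv /=; case: ifP => _; last by exists 0.
  by exists (b i - a i).
by under eq_bigr do rewrite rE; rewrite prodEFin ltry.
Qed.

Lemma cvg_ou_int (t : R) y : 0 < t ->
  ou_int (t + shrink R k) y @[k --> \oo] --> ou_int t y.
Proof.
move=> t0; have tk k : t <= t + shrink R k by rewrite lerDl ltW// shrink_gt0.
have [C [_ uC _]] := ou_pdf_bounds y t0.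
have [|||_ //] := @Rintegral_bounded_cvg _ _ _ leb G
  (fun k => ou_pdf (t + shrink R k) y) (ou_pdf t y) C iG.
- by move=> k; exact: measurable_ou_pdf.
- by move=> k x; exact: uC.
- have ct : t + shrink R k @[k --> \oo] --> t.
    rewrite -[X in _ --> X]addr0.
    by apply: cvgD; [exact: cvg_cst|exact: cvg_harmonic].
  move=> x; apply: (cvg_comp _ (fun u => ou_pdf u y x) ct).
  exact: is_derive_continuous (is_derive_ou_pdf y x t0).
Qed.

Lemma cvg_integral_obox_ou_int (t : R) a b : 0 < t ->
  \int[leb]_y (\1_(obox a b) y * ou_int (t + shrink R k) y) @[k --> \oo] -->
  \int[leb]_y (\1_(obox a b) y * ou_int t y).
Proof.
move=> t0; have tk k : t <= t + shrink R k by rewrite lerDl ltW// shrink_gt0.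
have tk0 k : 0 < t + shrink R k := lt_le_trans t0 (tk k).
have ii : leb.-integrable setT (EFin \o (\1_(obox a b) : _ -> R)).
  apply/integrableP; split; first by apply/measurable_EFinP; apply: measurable_indic; exact: measurable_obox.
  under eq_integral do rewrite /= ger0_norm ?indicE//.
  rewrite -[X in (X < _)%E](_ : (\int[leb]_x (\1_(obox a b) x)%:E)%E = _)//.
  by rewrite integral_indic ?setIT//; [exact: lebesgue_obox_lty|exact: measurable_obox].
have [|||_ //] := @Rintegral_bounded_cvg _ _ _ leb (\1_(obox a b))
  (fun k => ou_int (t + shrink R k)) (ou_int t)
  (ou_norm t ^+ n * \int[leb]_x `|G x|) ii.
- by move=> k; have [/measurable_EFinP] := integrableP _ _ _ (integrable_ou_int (tk0 k)).
- by move=> k x; exact: ou_int_bound.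
- by move=> x; exact: cvg_ou_int.
Qed.

End ou_pdf_mass.

(** * Mehler's formula for the semigroup *)

Section semigroup_mehler.
Context (R : realType) (n : nat).
Local Notation gam := (gaussian_measure R n).
Local Notation leb := (lebesgue_rV R n).
Variables (L : opgraph 'rV[R]_n R) (hL : OU_realisation L).
Variable E : R -> ('rV[R]_n -> R[i]) -> ('rV[R]_n -> R[i]).
Hypothesis hE : semigroup_generated_by gam (oppg L) E.
Implicit Types f : 'rV[R]_n -> R[i].

Lemma gamma_ae (P : 'rV[R]_n -> Prop) :
  {ae leb, forall x, P x} -> {ae gam, forall x, P x}.
Proof.
move=> [N [mN N0 sub]]; exists N; split => //.
rewrite /= gammaE//; apply: null_set_integral => //.
by apply/measurable_EFinP; apply: measurable_funTS; exact: measurable_gauss_density.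
Qed.

Lemma ou_kernelE (t : R) (y x : 'rV[R]_n) : ou_kernel (expR (- t)) x y = ou_pdf t y x.
Proof.
rewrite /ou_kernel /ou_pdf /prodf /ou_factor /ou1 /gk big_split/=; congr (_ * _).
  by rewrite prodr_const card_ord.
rewrite /expsq -expR_sum; congr expR.
rewrite sumrN /sqnv /dotv mulr_sumr; congr (- _).
by apply: eq_bigr => i _; rewrite !mxE expr2.
Qed.

Lemma mehler_intE (t : R) (g : 'rV[R]_n -> R) y :
  mehler_int (expR (- t)) g y =
  ou_int (fun x => g x * gauss_density x) t y / gauss_density y.
Proof.
rewrite /mehler_int /ou_int; congr (_ / _); apply: eq_Rintegral => x _.
by rewrite ou_kernelE; ring.
Qed.

Lemma semigroup_L2 t f : 0 <= t -> L2 gam f -> L2 gam (E t f).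
Proof. by move=> t0; case: hE => -[/(_ _ t0)[H _ _ _] _ _ _] _; exact: H. Qed.

Lemma semigroup_linear t (a : R[i]) f g : 0 <= t -> L2 gam f -> L2 gam g ->
  eqL2 gam (E t (fun x => a * f x + g x)) (fun x => a * E t f x + E t g x).
Proof. by move=> t0; case: hE => -[/(_ _ t0)[_ _ H _] _ _ _] _; exact: H. Qed.

Lemma ou_int_gamma (f : 'rV[R]_n -> R[i]) u y : L2 gam f ->
  ou_int (fun x => complex.Re (f x) * gauss_density x) u y =
  \int[gam]_x (complex.Re (f x) * ou_pdf u y x).
Proof.
move=> [[mf _] _]; rewrite Rintegral_gamma.
  by apply: eq_Rintegral => x _; rewrite mulrAC.
by apply: measurable_funM => //; exact: measurable_ou_pdf.
Qed.

Lemma semigroup_Re (t : R) f : 0 < t -> L2 gam f ->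
  {ae gam, forall x, complex.Re (E t f x) =
    mehler_int (expR (- t)) (fun z => complex.Re (f z)) x}.
Proof.
move=> t0 Lf; have LE := semigroup_L2 (ltW t0) Lf.
pose G1 x := complex.Re (E t f x) * gauss_density x.
pose G2 x := complex.Re (f x) * gauss_density x.
have i1 : leb.-integrable setT (EFin \o G1).
  by have [i _] := integrable_L2 LE; exact: integrable_gamma_leb i.
have i2 : leb.-integrable setT (EFin \o G2).
  by have [i _] := integrable_L2 Lf; exact: integrable_gamma_leb i.
have shift k y : ou_int G1 (shrink R k) y = ou_int G2 (t + shrink R k) y.
  have e1 := ou_int_gamma (shrink R k) y LE.
  have e2 := ou_int_gamma (t + shrink R k) y Lf.
  by rewrite /G1 /G2 e1 e2; exact: (duhamel hL hE y (shrink_gt0 R k) t0 Lf).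
(* Both sides are limits, along tau = 1/(k+1), of the integral of G1 against the mass of the box:
   the left by concentration of the kernel, the right by the time shift and continuity in time. *)
have box a b : \int[leb]_x (G1 x * \1_(obox a b) x) =
    \int[leb]_x (\1_(obox a b) x * ou_int G2 t x).
  have h1 := @cvg_integral_box_mass R n a b G1 i1.
  suff h2 : \int[leb]_x (G1 x * box_mass (shrink R k) a b x) @[k --> \oo] -->
      \int[leb]_x (\1_(obox a b) x * ou_int G2 t x).
    exact: (cvg_unique (@Rhausdorff R) h1 h2).
  apply: cvg_trans (@cvg_integral_obox_ou_int R n G2 i2 t a b t0); apply: near_eq_cvg.
  apply: nearW => k; rewrite -(integral_obox_ou_int i1 a b (shrink_gt0 R k)).
  by apply: eq_Rintegral => y _; rewrite shift.
have iH := integrable_ou_int i2 t0.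
pose Q x := G1 x - ou_int G2 t x.
have iQ : leb.-integrable setT (EFin \o Q).
  exact: (integrableB measurableT i1 iH).
have Q0 A : measurable A -> \int[leb]_(x in A) Q x = 0.
  apply: integral_oboxes_eq0 => // a b.
  have mi : measurable_fun setT (\1_(obox a b) : _ -> R).
    by apply: measurable_indic; exact: measurable_obox.
  rewrite Rintegral_mkcond.
  transitivity (\int[leb]_x (G1 x * \1_(obox a b) x - ou_int G2 t x * \1_(obox a b) x)).
    apply: eq_Rintegral => x _; rewrite patchE indicE /Q.
    by case: ifP => _; rewrite ?mulr1 ?mulr0 ?subrr.
  rewrite RintegralB//; last 2 first.
  - exact: (integrable_boundedM i1 mi (normr_indic R _)).
  - exact: (integrable_boundedM iH mi (normr_indic R _)).
  rewrite box; apply/eqP; rewrite subr_eq0; apply/eqP.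
  by apply: eq_Rintegral => x _; rewrite mulrC.
have aeQ : ae_eq leb setT (EFin \o Q) (cst 0%E).
  apply: integral_ae_eq => // A _ mA; rewrite integral0.
  have := Q0 A mA; rewrite /Rintegral.
  have iA := integrableS measurableT mA (@subsetT _ A) iQ.
  have fA := integrable_fin_num mA iA.
  by move=> h; rewrite -[LHS]fineK// h.
apply: gamma_ae; apply: filterS aeQ => x /(_ I) [] /eqP; rewrite subr_eq0 => /eqP Qx.
by rewrite mehler_intE -Qx /G1 mulfK// gt_eqF// gauss_density_gt0.
Qed.

(** Im z = Re(-i z), so the real case applies to -i f; this is written as (-i - 1) f + f to match
    the form in which linearity is given. *)
Lemma semigroup_Im (t : R) f : 0 < t -> L2 gam f ->
  {ae gam, forall x, complex.Im (E t f x) =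
    mehler_int (expR (- t)) (fun z => complex.Im (f z)) x}.
Proof.
move=> t0 Lf; pose j : R[i] := (0 +i* (- 1))%C.
have Rej (z : R[i]) : complex.Re (j * z) = complex.Im z.
  by case: z => a b /=; rewrite mul0r sub0r mulN1r opprK.
have Lj : L2 gam (fun x => j * f x) by exact: L2Z.
have jE : (fun x => j * f x) = (fun x => (j - 1) * f x + f x).
  by apply/funext => x; ring.
have := semigroup_linear (j - 1) (ltW t0) Lf Lf; rewrite -jE => e1.
apply: filterS2 e1 (semigroup_Re t0 Lj) => x -> h.
rewrite -Rej (_ : j * _ = (j - 1) * E t f x + E t f x); last by ring.
by rewrite h; congr (mehler_int _ _ x); apply/funext => z; exact: Rej.
Qed.

End semigroup_mehler.

Local Open Scope complex_scope.

Theorem theorem3p1 (R : realType) (d : nat) (hd : (1 <= d)%N)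
    (L : opgraph 'rV[R]_d R) (hL : OU_realisation L)
    (expL : R -> ('rV[R]_d -> R[i]) -> ('rV[R]_d -> R[i]))
    (hexpL : semigroup_generated_by (gaussian_measure R d) (oppg L) expL)
    (t : R) (ht : 0 < t) :
  let s : R := (1 - expR (- t)) / (1 + expR (- t)) in
  forall f : 'rV[R]_d -> R[i], L2 (gaussian_measure R d) f ->
    eqL2 (gaussian_measure R d) (expL t f)
      (fun x => ((1 + s) ^+ d)%:C * gauss_weyl (gauss_symbol s) f x).
Proof.
move=> s f Lf; have r01 : 0 < expR (- t) < 1.
  by rewrite expR_gt0 /= -expR0 ltr_expR oppr_lt0.
have [ir ii] := integrable_L2_expsq Lf.
apply: filterS2 (semigroup_Re hL hexpL ht Lf) (semigroup_Im hL hexpL ht Lf) => x re im.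
rewrite gauss_weyl_mehler//; last exact: (proj1 Lf).
by rewrite -re -im; case: (expL t f x).
Qed.
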